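(* Let $m\ge1$ and $n\ge4$ be integers. (i) In the multiplicative group $\mathcal{Y}^{\circ}_{m,n}(\mathrm{RSG})$ one has $Y_i(u+2(mn-m+n))=Y_i(u)$ for all $(i,u)\in\tilde{\mathcal{I}}_{m,n}$. (ii) In the ring $\mathcal{T}^{\circ}_{m,n}(\mathrm{RSG})$ one has $T_i(u+2(mn-m+n))=T_i(u)$ for all $(i,u)\in\tilde{\mathcal{I}}_{m,n}$. (iii) Suppose that a family of positive real numbers $\{Y_i(u)\mid(i,u)\in\tilde{\mathcal{I}}_{m,n}\}$ satisfies $\mathbb{Y}_{m,n}(\mathrm{RSG})$. Then $$\frac{6}{\pi^2}\sum_{\substack{(i,u)\in\tilde{\mathcal{I}}_{m,n}\\ 0\le u<2(mn-m+n)}}L\left(\frac{Y_i(u)}{1+Y_i(u)}\right)=2\bigl(nm^2-m^2+3mn-8m+2n-6\bigr),$$ $$\frac{6}{\pi^2}\sum_{\substack{(i,u)\in\tilde{\mathcal{I}}_{m,n}\\ 0\le u<2(mn-m+n)}}L\left(\frac{1}{1+Y_i(u)}\right)=2\bigl(n^2m-6nm+11m+n^2-5n+6\bigr).$$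
   Context: Let $\tilde{\mathcal{I}}_{m,n}=\{1,\dots,m+n-3\}\times\mathbb{Z}$; $j\sim i$ means $1\le j\le m+n-3$ and $|i-j|=1$. The RSG Y-system $\mathbb{Y}_{m,n}(\mathrm{RSG})$ is the system of relations for a family $\{Y_i(u)\mid(i,u)\in\tilde{\mathcal{I}}_{m,n}\}$ (for all $u\in\mathbb{Z}$): $$Y_i(u-n+1)Y_i(u+n-1)=\prod_{j:j\sim i}(1+Y_j(u)),\qquad i=1,\dots,m-1,$$ $$Y_m(u-n+1)Y_m(u+n-1)=(1+Y_{m-1}(u))\Bigl(\prod_{j=m+1}^{m+n-3}(1+Y_j(u-m-n+1+j))(1+Y_j(u+m+n-1-j))\Bigr)(1+Y_{m+n-3}(u)^{-1})^{-1},$$ $$Y_{m+1}(u-1)Y_{m+1}(u+1)=\frac{1+Y_m(u)}{1+Y_{m+2}(u)^{-1}},$$ $$Y_i(u-1)Y_i(u+1)=\frac{1}{\prod_{j:j\sim i}(1+Y_j(u)^{-1})},\qquad i=m+2,\dots,m+n-3.$$ For $m=1$ the factor $1+Y_{m-1}(u)$ is omitted; for $n=4$ the third relation is replaced with $Y_{m+1}(u-1)Y_{m+1}(u+1)=1+Y_m(u)$. The RSG T-system $\mathbb{T}_{m,n}(\mathrm{RSG})$ is the system of relations for a family $\{T_i(u)\mid(i,u)\in\tilde{\mathcal{I}}_{m,n}\}$: $$T_i(u-n+1)T_i(u+n-1)=\prod_{j:j\sim i}T_j(u)+1,\qquad i=1,\dots,m,$$ $$T_{m+1}(u-1)T_{m+1}(u+1)=T_m(u-n+2)T_m(u+n-2)+T_{m+2}(u),$$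 $$T_i(u-1)T_i(u+1)=T_m(u-m-n+1+i)T_m(u+m+n-1-i)+\prod_{j:j\sim i}T_j(u),\qquad i=m+2,\dots,m+n-4,$$ $$T_{m+n-3}(u-1)T_{m+n-3}(u+1)=T_m(u-2)T_m(u+2)+T_m(u)T_{m+n-4}(u).$$ For $n=4$ the second and the fourth relations are replaced with $T_{m+1}(u-1)T_{m+1}(u+1)=T_m(u-2)T_m(u+2)+T_m(u)$. A semifield is an abelian multiplicative group with a commutative, associative addition over which multiplication distributes. $\mathcal{Y}_{m,n}(\mathrm{RSG})$ is the semifield with generators $Y_i(u)$ and relations $\mathbb{Y}_{m,n}(\mathrm{RSG})$ (addition written $+$), i.e. the quotient of the semifield of subtraction-free rational expressions in the $Y_i(u)$ by these relations; $\mathcal{Y}^{\circ}_{m,n}(\mathrm{RSG})$ is its multiplicative subgroup generated by all $Y_i(u)$ and $1+Y_i(u)$. $\mathcal{T}_{m,n}(\mathrm{RSG})$ is the commutative ring over $\mathbb{Z}$ with identity, generators $T_i(u)^{\pm1}$ and relations $\mathbb{T}_{m,n}(\mathrm{RSG})$ together with $T_i(u)T_i(u)^{-1}=1$; $\mathcal{T}^{\circ}_{m,n}(\mathrm{RSG})$ is its subring generated by all $T_i(u)$. $L(x)=-\frac12\int_0^x\left\{\frac{\log(1-y)}{y}+\frac{\log y}{1-y}\right\}dy$ ($0\le x\le1$) is the Rogers dilogarithm. *)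

(* Defs.v *)
From HB Require Import structures.
From mathcomp Require Import all_boot all_order all_algebra.
From mathcomp Require Import all_classical all_reals all_analysis.

Set Implicit Arguments.
Unset Strict Implicit.
Unset Printing Implicit Defensive.

Import Order.TTheory GRing.Theory Num.Theory.
Import numFieldNormedType.Exports.

Local Open Scope classical_set_scope.
Local Open Scope ring_scope.
Local Open Scope quotient_scope.

(** A semifield has no zero: the multiplication (in [group_scope]) is defined
    and invertible everywhere, the addition (in [ring_scope]) is only a
    commutative semigroup law. *)
HB.mixin Record Group_AddSemigroup_isSemifield S
    of Group S & Algebra.AddSemigroup S := {
  sfmulC : commutative (@monoid.mul S) ;
  sfmulDl : left_distributive (@monoid.mul S) (@Algebra.add S)
}.
#[short(type="semifieldType")]
HB.structure Definition Semifield :=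
  {S of Group_AddSemigroup_isSemifield S & Group S & Algebra.AddSemigroup S}.

(** Subtraction-free rational expressions over the set [G] of generators. *)
Inductive sfexpr (G : Type) : Type :=
| SFGen of G
| SFOne
| SFAdd of sfexpr G & sfexpr G
| SFMul of sfexpr G & sfexpr G
| SFInv of sfexpr G.

Arguments SFOne {G}.

HB.instance Definition _ (G : Type) := gen_eqMixin (sfexpr G).
HB.instance Definition _ (G : Type) := gen_choiceMixin (sfexpr G).

Declare Scope sfexpr_scope.
Delimit Scope sfexpr_scope with sf.
Bind Scope sfexpr_scope with sfexpr.
Notation "1" := SFOne : sfexpr_scope.
Notation "x + y" := (SFAdd x y) : sfexpr_scope.
Notation "x * y" := (SFMul x y) : sfexpr_scope.
Notation "x ^-1" := (SFInv x) : sfexpr_scope.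
Notation "\prod_ ( i | P ) F" :=
  (\big[@SFMul _/SFOne]_(i | P%B) F%sf) : sfexpr_scope.

Fixpoint sfeval (G S : Type) (one : S) (add mul : S -> S -> S) (inv : S -> S)
    (f : G -> S) (e : sfexpr G) : S :=
  let ev := sfeval one add mul inv f in
  match e with
  | SFGen g => f g
  | SFOne => one
  | SFAdd a b => add (ev a) (ev b)
  | SFMul a b => mul (ev a) (ev b)
  | SFInv a => inv (ev a)
  end.

(** The semifield with generators [G] and relations [l = r] for [rel l r]:
    expressions modulo the least congruence that contains the relations and
    the semifield axioms. *)
Section PresentedSemifield.
Variables (G : Type) (rel : sfexpr G -> sfexpr G -> Prop).
Local Open Scope sfexpr_scope.

Inductive sfcong : sfexpr G -> sfexpr G -> Prop :=
| sfcong_refl a : sfcong a a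
| sfcong_sym a b : sfcong a b -> sfcong b a
| sfcong_trans a b c : sfcong a b -> sfcong b c -> sfcong a c
| sfcong_add a a' b b' : sfcong a a' -> sfcong b b' -> sfcong (a + b) (a' + b')
| sfcong_mul a a' b b' : sfcong a a' -> sfcong b b' -> sfcong (a * b) (a' * b')
| sfcong_inv a a' : sfcong a a' -> sfcong a^-1 a'^-1
| sfcong_addC a b : sfcong (a + b) (b + a)
| sfcong_addA a b c : sfcong (a + (b + c)) (a + b + c)
| sfcong_mulC a b : sfcong (a * b) (b * a)
| sfcong_mulA a b c : sfcong (a * (b * c)) (a * b * c)
| sfcong_mul1 a : sfcong (1 * a) a
| sfcong_mulV a : sfcong (a^-1 * a) 1
| sfcong_mulDl a b c : sfcong ((a + b) * c) (a * c + b * c)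
| sfcong_rel a b : rel a b -> sfcong a b.

Definition sfcongb a b := `[< sfcong a b >].

Fact sfcongb_refl : reflexive sfcongb.
Proof. by move=> a; apply/asboolP/sfcong_refl. Qed.
Fact sfcongb_sym : symmetric sfcongb.
Proof. by move=> a b; apply/asboolP/asboolP => /sfcong_sym. Qed.
Fact sfcongb_trans : transitive sfcongb.
Proof.
by move=> b a c /asboolP ab /asboolP bc; apply/asboolP/(sfcong_trans ab bc).
Qed.

Canonical sfcong_equiv := EquivRel sfcongb sfcongb_refl sfcongb_sym sfcongb_trans.

Definition psemifield := {eq_quot sfcong_equiv}.
HB.instance Definition _ := Choice.on psemifield.

Definition psf_class (a : sfexpr G) : psemifield := \pi a.
Definition psf_gen (g : G) : psemifield := psf_class (SFGen g).

Lemma psf_classP a b : psf_class a = psf_class b <-> sfcong a b.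
Proof.
rewrite /psf_class; split=> [/eqmodP/asboolP//|ab].
by apply/eqmodP/asboolP.
Qed.

Definition psf_one := psf_class 1.
Definition psf_add (x y : psemifield) := psf_class (repr x + repr y).
Definition psf_mul (x y : psemifield) := psf_class (repr x * repr y).
Definition psf_inv (x : psemifield) := psf_class (repr x)^-1.

Lemma psf_repr a : sfcong (repr (psf_class a)) a.
Proof. by apply/psf_classP; rewrite /psf_class reprK. Qed.

Lemma psf_addE a b : psf_add (psf_class a) (psf_class b) = psf_class (a + b).
Proof. by apply/psf_classP/sfcong_add; apply: psf_repr. Qed.
Lemma psf_mulE a b : psf_mul (psf_class a) (psf_class b) = psf_class (a * b).
Proof. by apply/psf_classP/sfcong_mul; apply: psf_repr. Qed.
Lemma psf_invE a : psf_inv (psf_class a) = psf_class a^-1.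
Proof. by apply/psf_classP/sfcong_inv; apply: psf_repr. Qed.

Lemma psf_ind (P : psemifield -> Prop) : (forall a, P (psf_class a)) -> forall x, P x.
Proof. by move=> PG x; rewrite -[x]reprK; apply: PG. Qed.

Fact psf_addC : commutative psf_add.
Proof.
elim/psf_ind=> a; elim/psf_ind=> b; rewrite !psf_addE.
exact/psf_classP/sfcong_addC.
Qed.
Fact psf_addA : associative psf_add.
Proof.
elim/psf_ind=> a; elim/psf_ind=> b; elim/psf_ind=> c; rewrite !psf_addE.
exact/psf_classP/sfcong_addA.
Qed.
Fact psf_mulC : commutative psf_mul.
Proof.
elim/psf_ind=> a; elim/psf_ind=> b; rewrite !psf_mulE.
exact/psf_classP/sfcong_mulC.
Qed.
Fact psf_mulA : associative psf_mul.
Proof.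
elim/psf_ind=> a; elim/psf_ind=> b; elim/psf_ind=> c; rewrite !psf_mulE.
exact/psf_classP/sfcong_mulA.
Qed.
Fact psf_mul1l : left_id psf_one psf_mul.
Proof. by elim/psf_ind=> a; rewrite psf_mulE; apply/psf_classP/sfcong_mul1. Qed.
Fact psf_mul1r : right_id psf_one psf_mul.
Proof. by move=> x; rewrite psf_mulC psf_mul1l. Qed.
Fact psf_mulVl : left_inverse psf_one psf_inv psf_mul.
Proof.
by elim/psf_ind=> a; rewrite psf_invE psf_mulE; apply/psf_classP/sfcong_mulV.
Qed.
Fact psf_mulVr : right_inverse psf_one psf_inv psf_mul.
Proof. by move=> x; rewrite psf_mulC psf_mulVl. Qed.
Fact psf_mulDl : left_distributive psf_mul psf_add.
Proof.
elim/psf_ind=> a; elim/psf_ind=> b; elim/psf_ind=> c.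
rewrite psf_addE !psf_mulE psf_addE; exact/psf_classP/sfcong_mulDl.
Qed.

HB.instance Definition _ := isGroup.Build psemifield
  psf_mulA psf_mul1l psf_mul1r psf_mulVl psf_mulVr.
HB.instance Definition _ := Algebra.isAddSemigroup.Build psemifield
  psf_addC psf_addA.
HB.instance Definition _ := Group_AddSemigroup_isSemifield.Build psemifield
  psf_mulC psf_mulDl.

End PresentedSemifield.

(** Expressions in the language of rings over the set [G] of generators. *)
Inductive rexpr (G : Type) : Type :=
| RGen of G
| RZero
| ROne
| ROpp of rexpr G
| RAdd of rexpr G & rexpr G
| RMul of rexpr G & rexpr G.

Arguments RZero {G}.
Arguments ROne {G}.

HB.instance Definition _ (G : Type) := gen_eqMixin (rexpr G).
HB.instance Definition _ (G : Type) := gen_choiceMixin (rexpr G).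

Declare Scope rexpr_scope.
Delimit Scope rexpr_scope with re.
Bind Scope rexpr_scope with rexpr.
Notation "0" := RZero : rexpr_scope.
Notation "1" := ROne : rexpr_scope.
Notation "- x" := (ROpp x) : rexpr_scope.
Notation "x + y" := (RAdd x y) : rexpr_scope.
Notation "x * y" := (RMul x y) : rexpr_scope.
Notation "\prod_ ( i | P ) F" :=
  (\big[@RMul _/ROne]_(i | P%B) F%re) : rexpr_scope.

Fixpoint reval (G : Type) (R : pzRingType) (f : G -> R) (e : rexpr G) : R :=
  match e with
  | RGen g => f g
  | RZero => 0
  | ROne => 1
  | ROpp a => - reval f a
  | RAdd a b => reval f a + reval f b
  | RMul a b => reval f a * reval f b
  end.

(** The commutative ring with generators [G] and relations [l = r] for
    [rel l r]. It is not assumed to be nonzero, hence a [comPzRingType]. *)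
Section PresentedRing.
Variables (G : Type) (rel : rexpr G -> rexpr G -> Prop).
Local Open Scope rexpr_scope.

Inductive rcong : rexpr G -> rexpr G -> Prop :=
| rcong_refl a : rcong a a
| rcong_sym a b : rcong a b -> rcong b a
| rcong_trans a b c : rcong a b -> rcong b c -> rcong a c
| rcong_opp a a' : rcong a a' -> rcong (- a) (- a')
| rcong_add a a' b b' : rcong a a' -> rcong b b' -> rcong (a + b) (a' + b')
| rcong_mul a a' b b' : rcong a a' -> rcong b b' -> rcong (a * b) (a' * b')
| rcong_addC a b : rcong (a + b) (b + a)
| rcong_addA a b c : rcong (a + (b + c)) (a + b + c)
| rcong_add0 a : rcong (0 + a) a
| rcong_addN a : rcong (- a + a) 0
| rcong_mulC a b : rcong (a * b) (b * a)
| rcong_mulA a b c : rcong (a * (b * c)) (a * b * c)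
| rcong_mul1 a : rcong (1 * a) a
| rcong_mulDl a b c : rcong ((a + b) * c) (a * c + b * c)
| rcong_rel a b : rel a b -> rcong a b.

Definition rcongb a b := `[< rcong a b >].

Fact rcongb_refl : reflexive rcongb.
Proof. by move=> a; apply/asboolP/rcong_refl. Qed.
Fact rcongb_sym : symmetric rcongb.
Proof. by move=> a b; apply/asboolP/asboolP => /rcong_sym. Qed.
Fact rcongb_trans : transitive rcongb.
Proof.
by move=> b a c /asboolP ab /asboolP bc; apply/asboolP/(rcong_trans ab bc).
Qed.

Canonical rcong_equiv := EquivRel rcongb rcongb_refl rcongb_sym rcongb_trans.

Definition pring := {eq_quot rcong_equiv}.
HB.instance Definition _ := Choice.on pring.

Definition pr_class (a : rexpr G) : pring := \pi a.
Definition pr_gen (g : G) : pring := pr_class (RGen g).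

Lemma pr_classP a b : pr_class a = pr_class b <-> rcong a b.
Proof.
rewrite /pr_class; split=> [/eqmodP/asboolP//|ab].
by apply/eqmodP/asboolP.
Qed.

Definition pr_zero := pr_class 0.
Definition pr_one := pr_class 1.
Definition pr_opp (x : pring) := pr_class (- repr x).
Definition pr_add (x y : pring) := pr_class (repr x + repr y).
Definition pr_mul (x y : pring) := pr_class (repr x * repr y).

Lemma pr_repr a : rcong (repr (pr_class a)) a.
Proof. by apply/pr_classP; rewrite /pr_class reprK. Qed.

Lemma pr_oppE a : pr_opp (pr_class a) = pr_class (- a).
Proof. by apply/pr_classP/rcong_opp; apply: pr_repr. Qed.
Lemma pr_addE a b : pr_add (pr_class a) (pr_class b) = pr_class (a + b).
Proof. by apply/pr_classP/rcong_add; apply: pr_repr. Qed.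
Lemma pr_mulE a b : pr_mul (pr_class a) (pr_class b) = pr_class (a * b).
Proof. by apply/pr_classP/rcong_mul; apply: pr_repr. Qed.

Lemma pr_ind (P : pring -> Prop) : (forall a, P (pr_class a)) -> forall x, P x.
Proof. by move=> PG x; rewrite -[x]reprK; apply: PG. Qed.

Fact pr_addA : associative pr_add.
Proof.
elim/pr_ind=> a; elim/pr_ind=> b; elim/pr_ind=> c; rewrite !pr_addE.
exact/pr_classP/rcong_addA.
Qed.
Fact pr_addC : commutative pr_add.
Proof.
elim/pr_ind=> a; elim/pr_ind=> b; rewrite !pr_addE.
exact/pr_classP/rcong_addC.
Qed.
Fact pr_add0 : left_id pr_zero pr_add.
Proof. by elim/pr_ind=> a; rewrite pr_addE; apply/pr_classP/rcong_add0. Qed.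
Fact pr_addN : left_inverse pr_zero pr_opp pr_add.
Proof.
by elim/pr_ind=> a; rewrite pr_oppE pr_addE; apply/pr_classP/rcong_addN.
Qed.
Fact pr_mulA : associative pr_mul.
Proof.
elim/pr_ind=> a; elim/pr_ind=> b; elim/pr_ind=> c; rewrite !pr_mulE.
exact/pr_classP/rcong_mulA.
Qed.
Fact pr_mulC : commutative pr_mul.
Proof.
elim/pr_ind=> a; elim/pr_ind=> b; rewrite !pr_mulE.
exact/pr_classP/rcong_mulC.
Qed.
Fact pr_mul1 : left_id pr_one pr_mul.
Proof. by elim/pr_ind=> a; rewrite pr_mulE; apply/pr_classP/rcong_mul1. Qed.
Fact pr_mulDl : left_distributive pr_mul pr_add.
Proof.
elim/pr_ind=> a; elim/pr_ind=> b; elim/pr_ind=> c.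
rewrite pr_addE !pr_mulE pr_addE; exact/pr_classP/rcong_mulDl.
Qed.

HB.instance Definition _ := GRing.isZmodule.Build pring
  pr_addA pr_addC pr_add0 pr_addN.
HB.instance Definition _ := GRing.Zmodule_isComPzRing.Build pring
  pr_mulA pr_mulC pr_mul1 pr_mulDl.

End PresentedRing.

(** Any solution of the relations in a semifield (resp. commutative ring)
    extends to the presented one. *)
Lemma sfcong_eval (G : Type) (rel : sfexpr G -> sfexpr G -> Prop)
    (S : semifieldType) (f : G -> S) :
  let ev := sfeval 1%g (@Algebra.add S) (@monoid.mul S) (@monoid.inv S) f in
  (forall a b, rel a b -> ev a = ev b) ->
  forall a b, sfcong rel a b -> ev a = ev b.
Proof.
rewrite /= => rel_ev a b; elim=> //=.
- by move=> {}a {}b c _ -> _ ->.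
- by move=> {}a a' {}b b' _ -> _ ->.
- by move=> {}a a' {}b b' _ -> _ ->.
- by move=> {}a a' _ ->.
- by move=> {}a {}b; rewrite Algebra.addrC.
- by move=> {}a {}b c; rewrite Algebra.addrA.
- by move=> {}a {}b; rewrite sfmulC.
- by move=> {}a {}b c; rewrite mulgA.
- by move=> {}a; rewrite mul1g.
- by move=> {}a; rewrite mulVg.
- by move=> {}a {}b c; rewrite sfmulDl.
Qed.

Lemma rcong_eval (G : Type) (rel : rexpr G -> rexpr G -> Prop)
    (R : comPzRingType) (f : G -> R) :
  (forall a b, rel a b -> reval f a = reval f b) ->
  forall a b, rcong rel a b -> reval f a = reval f b.
Proof.
move=> rel_ev a b; elim=> //=.
- by move=> {}a {}b c _ -> _ ->.
- by move=> {}a a' _ ->.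
- by move=> {}a a' {}b b' _ -> _ ->.
- by move=> {}a a' {}b b' _ -> _ ->.
- by move=> {}a {}b; rewrite addrC.
- by move=> {}a {}b c; rewrite addrA.
- by move=> {}a; rewrite add0r.
- by move=> {}a; rewrite addNr.
- by move=> {}a {}b; rewrite mulrC.
- by move=> {}a {}b c; rewrite mulrA.
- by move=> {}a; rewrite mul1r.
- by move=> {}a {}b c; rewrite mulrDl.
Qed.

Definition subgroup_gen (G : groupType) (A : set G) : set G :=
  smallest [set H : set G | group_closed (mem H)] A.

Definition subring_gen (R : pzRingType) (A : set R) : set R :=
  smallest [set H : set R | GRing.subring_closed (mem H)] A.

Lemma subgroup_gen_closed (G : groupType) (A : set G) :
  group_closed (mem (subgroup_gen A)).
Proof.
split=> [|x y]; rewrite ?inE.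
  by move=> H [[H1 _] _]; rewrite inE in H1.
move=> /= Ax Ay H [HG AH]; have [_ HD] := HG.
have := HD x y; rewrite !inE; apply.
- exact: Ax.
- exact: Ay.
Qed.

Lemma subring_gen_closed (R : pzRingType) (A : set R) :
  GRing.subring_closed (mem (subring_gen A)).
Proof.
split=> [|x y|x y]; rewrite ?inE.
- by move=> H [[H1 _ _] _]; rewrite inE in H1.
- move=> Ax Ay H [HR AH]; have [_ HD _] := HR.
  by have := HD x y; rewrite !inE; apply; [apply: Ax|apply: Ay].
- move=> Ax Ay H [HR AH]; have [_ _ HD] := HR.
  by have := HD x y; rewrite !inE; apply; [apply: Ax|apply: Ay].
Qed.

Definition subgroup_of (G : groupType) (A : set G) : Type :=
  {x : G | x \in subgroup_gen A}.
HB.instance Definition _ (G : groupType) (A : set G) :=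
  SubChoice.on (subgroup_of A).
HB.instance Definition _ (G : groupType) (A : set G) :=
  SubChoice_isSubGroup.Build G (mem (subgroup_gen A)) (subgroup_of A)
    (subgroup_gen_closed A).

Definition subring_of (R : comPzRingType) (A : set R) : Type :=
  {x : R | x \in subring_gen A}.
HB.instance Definition _ (R : comPzRingType) (A : set R) :=
  SubChoice.on (subring_of A).
HB.instance Definition _ (R : comPzRingType) (A : set R) :=
  GRing.SubChoice_isSubComPzRing.Build R (mem (subring_gen A)) (subring_of A)
    (subring_gen_closed A).

Lemma mem_subgroup_gen (G : groupType) (A : set G) x :
  A x -> x \in subgroup_gen A.
Proof. by move=> Ax; rewrite inE => H [_]; apply. Qed.

Lemma mem_subring_gen (R : comPzRingType) (A : set R) x :
  A x -> x \in subring_gen A.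
Proof. by move=> Ax; rewrite inE => H [_]; apply. Qed.

(** The index set {1, ..., m+n-3}: the element [i] of ['I_(m + n - 3)], which
    starts at 0, stands for the index [lab i = i + 1]. *)
Definition idx (m n : nat) := 'I_(m + n - 3).
Definition lab (m n : nat) (i : idx m n) : nat := i.+1.
Definition adj (m n : nat) (j i : idx m n) : bool :=
  (lab i == (lab j).+1) || (lab j == (lab i).+1).

Section RSG.
Variables m n : nat.
Local Notation I := (idx m n).
Implicit Types (h i j k : I) (u : int).

Section YSystem.
Local Notation Y i u := (SFGen (i : I, u%R : int)).
Local Open Scope sfexpr_scope.

(** In [Ysys_eqm], the product over [lab j + 1 = m] is the factor
    [1 + Y_{m-1}(u)], or 1 when [m = 1]. *)
Variant Ysys : sfexpr (I * int) -> sfexpr (I * int) -> Prop :=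
| Ysys_ltm i u of (lab i < m)%N :
    Ysys (Y i (u - n%:Z + 1) * Y i (u + n%:Z - 1))
         (\prod_(j | adj j i) (1 + Y j u))
| Ysys_eqm i k u of lab i = m & lab k = (m + n - 3)%N :
    Ysys (Y i (u - n%:Z + 1) * Y i (u + n%:Z - 1))
         (\prod_(j | (lab j).+1 == m) (1 + Y j u)
          * (\prod_(j | (m < lab j)%N)
               ((1 + Y j (u - m%:Z - n%:Z + 1 + (lab j)%:Z))
                * (1 + Y j (u + m%:Z + n%:Z - 1 - (lab j)%:Z))))
          * (1 + (Y k u)^-1)^-1)
| Ysys_eqm1 h i k u of (4 < n)%N & lab h = m & lab i = m.+1 & lab k = m.+2 :
    Ysys (Y i (u - 1) * Y i (u + 1))
         ((1 + Y h u) * (1 + (Y k u)^-1)^-1)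
| Ysys_eqm1_n4 h i u of n = 4%N & lab h = m & lab i = m.+1 :
    Ysys (Y i (u - 1) * Y i (u + 1))
         (1 + Y h u)
| Ysys_gtm1 i u of (m.+1 < lab i)%N :
    Ysys (Y i (u - 1) * Y i (u + 1))
         (\prod_(j | adj j i) (1 + (Y j u)^-1))^-1.

End YSystem.

Definition Ysemifield := psemifield Ysys.
HB.instance Definition _ := Semifield.on Ysemifield.

Definition Ygen i u : Ysemifield := psf_gen Ysys (i, u).

Definition Ycirc_gens : set Ysemifield :=
  [set y | exists i u, y = Ygen i u \/ y = (1%g + Ygen i u)%R].

Definition Ycirc := subgroup_of Ycirc_gens.
HB.instance Definition _ := Group.on Ycirc.

Fact Ygen_circ i u : Ygen i u \in subgroup_gen Ycirc_gens.
Proof. by apply: mem_subgroup_gen; exists i, u; left. Qed.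

Definition Yc i u : Ycirc := exist _ (Ygen i u) (Ygen_circ i u).

Definition Ysys_holds (K : fieldType) (Y : I -> int -> K) : Prop :=
  let ev := sfeval 1 +%R *%R (@GRing.inv K) (fun g => Y g.1 g.2) in
  forall l r, Ysys l r -> ev l = ev r.

Section TSystem.
(** The generators are the [T_i(u)], on the left of the sum, and their
    inverses, on the right. *)
Local Notation T i u := (RGen (inl (i : I, u%R : int))).
Local Notation TV i u := (RGen (inr (i : I, u%R : int))).
Local Open Scope rexpr_scope.

Variant Tsys : rexpr (I * int + I * int) -> rexpr (I * int + I * int) -> Prop :=
| Tsys_unit i u :
    Tsys (T i u * TV i u) 1
| Tsys_lem i u of (lab i <= m)%N :
    Tsys (T i (u - n%:Z + 1) * T i (u + n%:Z - 1))
         (\prod_(j | adj j i) T j u + 1)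
| Tsys_eqm1 h i k u of (4 < n)%N & lab h = m & lab i = m.+1 & lab k = m.+2 :
    Tsys (T i (u - 1) * T i (u + 1))
         (T h (u - n%:Z + 2) * T h (u + n%:Z - 2) + T k u)
| Tsys_mid h i u of lab h = m & (m.+2 <= lab i <= m + n - 4)%N :
    Tsys (T i (u - 1) * T i (u + 1))
         (T h (u - m%:Z - n%:Z + 1 + (lab i)%:Z)
            * T h (u + m%:Z + n%:Z - 1 - (lab i)%:Z)
          + \prod_(j | adj j i) T j u)
| Tsys_last h i k u of (4 < n)%N & lab h = m & lab i = (m + n - 3)%N
    & lab k = (m + n - 4)%N :
    Tsys (T i (u - 1) * T i (u + 1))
         (T h (u - 2) * T h (u + 2) + T h u * T k u)
| Tsys_eqm1_n4 h i u of n = 4%N & lab h = m & lab i = m.+1 :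
    Tsys (T i (u - 1) * T i (u + 1))
         (T h (u - 2) * T h (u + 2) + T h u).

End TSystem.

Definition Tring := pring Tsys.
HB.instance Definition _ := GRing.ComPzRing.on Tring.

Definition Tgen i u : Tring := pr_gen Tsys (inl (i, u)).

Definition Tcirc_gens : set Tring := [set t | exists i u, t = Tgen i u].

Definition Tcirc := subring_of Tcirc_gens.
HB.instance Definition _ := GRing.ComPzRing.on Tcirc.

Fact Tgen_circ i u : Tgen i u \in subring_gen Tcirc_gens.
Proof. by apply: mem_subring_gen; exists i, u. Qed.

Definition Tc i u : Tcirc := exist _ (Tgen i u) (Tgen_circ i u).

Definition period : nat := (2 * (m * n - m + n))%N.

End RSG.

Arguments Yc {m n} i u.
Arguments Tc {m n} i u.

(** The integrand is singular at the endpoints; the value given there by the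
    conventions [ln 0 = 0] and [0^-1 = 0] does not affect the integral. *)
Definition rogersL (R : realType) (x : R) : R :=
  - 2^-1 * \int[lebesgue_measure]_(y in `[0, x]) (ln (1 - y) / y + ln y / (1 - y)).

(* Main.v *)
(* Both periodicities come from closed polygons in rank 2. Put e = n-1, N = (m+1)e+1, so that
   the period is 2N. A solution of the T-system is a frieze: there are vectors w_t with
   det(w_t, w_(t+l)) = T_i for l = m+e-i, m < i, det(w_t, w_(t+1)) = T_m, det(w_t, w_(t+e)) = 1
   and det(w_t, w_(t+je+1)) = (-1)^j T_(m-j), at the appropriate times; all relations are
   three-term Pluecker relations, and the boundary relations give w_(t+N) = (-1)^(m+1) w_t.
   In the same way the solutions of the Y-system in a field are cross-ratios of the vertices of
   a sequence w_t for which w_(t+N) is proportional to w_t. This reaches the universal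
   semifield because an identity of subtraction-free expressions that holds at all positive
   rationals holds in every semifield, and because the Y_i(u) are such expressions in a finite
   window of initial values.

   When all Y_i(u) are positive, the polygon with vertices w_0, w_e, w_(2e), ... is convex, so
   Y/(1+Y) (for i > m) and 1/(1+Y) (for i <= m) are cross-ratios of cyclically ordered
   vertices. The five-term relation makes the dilogarithm of the cross-ratio a coboundary of a
   function of triangles; the reflection formula L(x) + L(1-x) = pi^2/6 makes this compatible
   with rotations of the polygon up to multiples of pi^2/6. Summed over all rotations, the
   triangle terms cancel and only multiples of pi^2/6 remain. *)

From HB Require Import structures.
Require Import Defs.
From mathcomp Require Import all_boot all_order all_algebra.
From mathcomp Require Import all_classical all_reals all_analysis.
From mathcomp Require Import measurable_realfun.
From mathcomp Require Import ring lra zify.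

Set Implicit Arguments.
Unset Strict Implicit.
Unset Printing Implicit Defensive.

Import Order.TTheory GRing.Theory Num.Theory.
Import numFieldNormedType.Exports.

Local Open Scope ring_scope.

(** * Periodicity of the T-system *)

(** Two cyclic orders on the vertices coexist. Times [t] advance by 1, polygon positions by [e]; as
    [(m+1)e = N-1], which is [-1] mod [N], one unit of time is [m+1] positions backwards. In polygon
    order, [Y_i] with [i <= m] involves two sides, while [Y_i] with [i > m] involves two diagonals
    of gap [m+1]; this arithmetic is what makes the triangle terms match.

    Vector [w_(t+1)] lies two units of [u] after [w_t], so one polygon sees only one parity class of
    times for each label. The integer offset [c] selects the class and the starting time, and a full
    period [2N] consists of two polygons.

    In the T-ring all [T_i(u)] are units, so the vectors exist over the ring itself. The universal
    Y-semifield has neither zero nor subtraction, so no determinant can be formed there. The detour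
    through rationals starts from free initial values, and the resulting solution obeys the
    relations only after the initial window. Hence the polygon of a Y-system is built from relations
    assumed from some time [B] on, with vertices indexed by natural numbers. *)

Definition det2 (R : pzRingType) (p q : nat -> R) (s t : nat) : R :=
  p s * q t - q s * p t.

Section Plucker.
Variables (R : comPzRingType) (p q : nat -> R).
Notation d := (det2 p q).

Lemma plucker a b c x : d a b * d c x - d a c * d b x + d a x * d b c = 0.
Proof. by rewrite /det2; ring. Qed.

Lemma det2C a b : d b a = - d a b.
Proof. by rewrite /det2; ring. Qed.

Lemma det2xx a : d a a = 0.
Proof. by rewrite /det2; ring. Qed.

Lemma det2_cramer a b c :
  (d a b * p c = d c b * p a + d a c * p b) *
  (d a b * q c = d c b * q a + d a c * q b).
Proof. by rewrite /det2; split; ring. Qed.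
End Plucker.

Lemma unit_cancel (R : comPzRingType) (x y a b : R) : x * y = 1 -> x * a = x * b -> a = b.
Proof.
by move=> xy /(congr1 ( *%R y)); rewrite !mulrA [y * x]mulrC xy !mul1r.
Qed.

(* [P 1] stands for [T_m], [P l] for [T_(m+e-l)] if [1 < l < e], and [Q j] for [T_(m-j)],
   where [e = n-1]; [PV] and [QV] are their inverses. *)
Section TPeriodicity.
Variables (R : comPzRingType) (m e : nat) (P PV Q QV : nat -> int -> R).
Hypotheses (m_gt0 : (0 < m)%N) (e_gt2 : (2 < e)%N).
Hypothesis P1 : P 1%N =1 Q 0%N.
Hypothesis Pe : forall u, P e u = 1.
Hypothesis Qm : forall u, Q m u = 1.
Hypothesis P_unit : forall l u, (0 < l < e)%N -> P l u * PV l u = 1.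
Hypothesis Q_unit : forall j u, (j < m)%N -> Q j u * QV j u = 1.
Hypothesis P_rel : forall l u, (1 < l < e)%N ->
  P l (u - 1) * P l (u + 1) =
  P 1%N (u - l%:Z) * P 1%N (u + l%:Z) + P l.-1 u * P l.+1 u.
Hypothesis Q0_rel : forall u,
  Q 0%N (u - e%:Z) * Q 0%N (u + e%:Z) = Q 1%N u * P e.-1 u + 1.
Hypothesis Q_rel : forall j u, (0 < j < m)%N ->
  Q j (u - e%:Z) * Q j (u + e%:Z) = Q j.+1 u * Q j.-1 u + 1.

Section Offset.
Variable c : int.

(** A pair of consecutive vectors is carried along. The coefficients are forced by Cramer's rule:
    they are the ones for which neighbouring vectors have determinant [P 1] and second neighbours
    [P 2]. The only division is by [T_m]. *)
Fixpoint frieze_vec (t : nat) : (R * R) * (R * R) :=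
  if t is t'.+1 then
    let: (v, w) := frieze_vec t' in
    let k := PV 1%N ((2 * t' + 1)%N%:Z + c) in
    let x := P 2%N ((2 * t' + 2)%N%:Z + c) in
    let y := P 1%N ((2 * t' + 3)%N%:Z + c) in
    (w, (k * (x * w.1 - y * v.1), k * (x * w.2 - y * v.2)))
  else ((1, 0), (0, P 1%N (1 + c))).

Let p t := (frieze_vec t).1.1.
Let q t := (frieze_vec t).1.2.
Notation d := (det2 p q).

Let vecSS t :
  let k := PV 1%N ((2 * t + 1)%N%:Z + c) in
  let x := P 2%N ((2 * t + 2)%N%:Z + c) in
  let y := P 1%N ((2 * t + 3)%N%:Z + c) in
  p t.+2 = k * (x * p t.+1 - y * p t) /\ q t.+2 = k * (x * q t.+1 - y * q t).
Proof. by rewrite /p /q /=; case: (frieze_vec t) => v w. Qed.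

Let d1 t : d t t.+1 = P 1%N ((2 * t + 1)%N%:Z + c).
Proof.
elim: t => [|t IH].
  by rewrite /det2 /p /q /= mul0r subr0 mul1r.
have [E1 E2] := vecSS t.
have U := P_unit ((2 * t + 1)%N%:Z + c) (_ : (0 < 1 < e)%N).
rewrite /det2 E1 E2.
transitivity (PV 1%N ((2 * t + 1)%N%:Z + c) * P 1%N ((2 * t + 3)%N%:Z + c) * d t t.+1).
  by rewrite /det2; ring.
rewrite IH mulrAC [PV _ _ * _]mulrC U ?mul1r; last by lia.
by congr (P 1%N _); lia.
Qed.

Let d2 t : d t t.+2 = P 2%N ((2 * t + 2)%N%:Z + c).
Proof.
have [E1 E2] := vecSS t.
have U := P_unit ((2 * t + 1)%N%:Z + c) (_ : (0 < 1 < e)%N).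
rewrite /det2 E1 E2.
transitivity (PV 1%N ((2 * t + 1)%N%:Z + c) * P 2%N ((2 * t + 2)%N%:Z + c) * d t t.+1).
  by rewrite /det2; ring.
by rewrite d1 mulrAC [PV _ _ * _]mulrC U ?mul1r//; lia.
Qed.

(** The Pluecker relation on two pairs of neighbours is [P_rel]. The unknown longest diagonal
    appears there multiplied by the inner diagonal, which is a unit. *)
Let dP l : (0 < l <= e)%N -> forall t, d t (t + l) = P l ((2 * t + l)%N%:Z + c).
Proof.
elim/ltn_ind: l => -[//|[_ _ t|[_ _ t|l IH le_e t]]].
- by rewrite addn1 d1.
- by rewrite addn2 d2.
have rel := @P_rel l.+2 ((2 * t + l.+3)%N%:Z + c) (_ : (1 < l.+2 < e)%N).
have U := @P_unit l.+1 ((2 * t + l.+3)%N%:Z + c) (_ : (0 < l.+1 < e)%N).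
apply: (unit_cancel (U _)); first by lia.
have := plucker p q t t.+1 (t + l.+2) (t + l.+3).
have -> : (t + l.+3 = (t + l.+2).+1)%N by lia.
rewrite !d1 (IH l.+2) ?(IH l.+1) //; try lia.
have -> : ((t + l.+2).+1 = t.+1 + l.+2)%N by lia.
rewrite (IH l.+2); try lia.
have -> : (t + l.+2 = t.+1 + l.+1)%N by lia.
rewrite (IH l.+1); try lia.
have -> : (2 * t.+1 + l.+1)%N = (2 * t + l.+3)%N by lia.
move: rel => /(_ _)/=.
have -> : (2 * t + l.+3)%:Z + c - 1 = (2 * t + l.+2)%:Z + c by lia.
have -> : (2 * t + l.+3)%:Z + c + 1 = (2 * t.+1 + l.+2)%:Z + c by lia.
have -> : (2 * t + l.+3)%:Z + c - l.+2%:Z = (2 * t + 1)%:Z + c by lia.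
have -> : (2 * t + l.+3)%:Z + c + l.+2%:Z = (2 * (t.+1 + l.+1) + 1)%:Z + c by lia.
move=> -> ; last by lia.
move=> /eqP; rewrite opprD addrA subrr add0r addrC subr_eq0 => /eqP <-.
by rewrite mulrC.
Qed.

Let de t : d t (t + e) = 1.
Proof. by rewrite dP ?Pe//; lia. Qed.

(** Pluecker relations on two pairs at distance [e], where the determinant is 1, are [Q0_rel] and
    [Q_rel]. The sign enters at [j = 0], where the inner diagonal from [t + e] to [t + 1] runs
    backwards, and it persists because later relations tie level [j+1] to level [j-1]. *)
Let dE j : (j <= m)%N ->
  forall t, d t (t + j * e + 1) = (-1) ^+ j * Q j ((2 * t + 1 + j * e)%N%:Z + c).
Proof.
elim/ltn_ind: j => -[_ _ t|[_ _ t|j IH jm t]].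
- by rewrite mul0n !addn0 addn1 d1 expr0 mul1r P1.
- have rel := Q0_rel ((2 * t + 1 + e)%N%:Z + c).
  have U := @P_unit e.-1 ((2 * t + 1 + e)%N%:Z + c) (_ : (0 < e.-1 < e)%N).
  apply: (unit_cancel (U _)); first by lia.
  have := plucker p q t t.+1 (t + e) (t + e).+1.
  have -> : ((t + e).+1 = t.+1 + e)%N by lia.
  rewrite !de !mul1r d1 addSn d1 !P1.
  have -> : (t + e = t.+1 + e.-1)%N by lia.
  rewrite dP; last by lia.
  have -> : (t + 1 * e + 1)%N = (t.+1 + e.-1).+1 by lia.
  have -> : (2 * t + 1)%:Z + c = (2 * t + 1 + e)%:Z + c - e%:Z by lia.
  have -> : (2 * (t.+1 + e.-1) + 1)%:Z + c = (2 * t + 1 + e)%:Z + c + e%:Z by lia.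
  rewrite rel mul1n.
  have -> : (2 * t.+1 + e.-1)%N = (2 * t + 1 + e)%N by lia.
  by rewrite addrK addrC => /eqP; rewrite addr_eq0 => /eqP H; rewrite mulrC H; ring.
have rel := @Q_rel j.+1 ((2 * t + 1 + j.+2 * e)%N%:Z + c) (_ : (0 < j.+1 < m)%N).
have U := @Q_unit j ((2 * t + 1 + j.+2 * e)%N%:Z + c) (_ : (j < m)%N).
apply: (unit_cancel (U _)); first by lia.
have := plucker p q t (t + e) (t + j.+1 * e + 1) (t + j.+2 * e + 1).
rewrite de.
have -> : (t + j.+2 * e + 1 = t + j.+1 * e + 1 + e)%N by lia.
rewrite de IH; try lia.
have -> : (t + j.+1 * e + 1 = t + e + j * e + 1)%N by lia.
rewrite IH; try lia.
have -> : (t + e + j * e + 1 + e = t + e + j.+1 * e + 1)%N by lia.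
rewrite IH; try lia.
have -> : (2 * (t + e) + 1 + j * e)%N = (2 * t + 1 + j.+2 * e)%N by lia.
move: rel => /(_ _)/=.
have -> : (2 * t + 1 + j.+2 * e)%:Z + c - e%:Z = (2 * t + 1 + j.+1 * e)%:Z + c by lia.
have -> : (2 * t + 1 + j.+2 * e)%:Z + c + e%:Z = (2 * (t + e) + 1 + j.+1 * e)%:Z + c by lia.
move=> rel; rewrite mulrACA rel; last by lia.
rewrite !exprS; have s2 : (-1) ^+ j * (-1) ^+ j = 1 :> R.
  by rewrite -expr2 sqrr_sign.
move: (d _ _) (Q j _) (Q j.+2 _) ((-1) ^+ j) s2 => x a b s s2 H.
have E : (-1 * s) * (-1 * s) = 1 by rewrite !mulN1r mulrNN.
have {}H : x * (s * a) = b * a.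
  by apply/eqP; rewrite -subr_eq0; apply/eqP; rewrite -[RHS]H E; ring.
transitivity (s * s * (a * x)); first by rewrite s2 mul1r.
transitivity (s * (x * (s * a))); first by ring.
by rewrite H; ring.
Qed.

Let N := (m.+1 * e + 1)%N.

(** One step beyond the boundary [Q m = 1]: the two other Pluecker terms are both 1 and cancel,
    which leaves the determinant times the unit [Q m.-1], up to sign. *)
Let dN t : d t (t + N) = 0.
Proof.
have U := @Q_unit m.-1 ((2 * (t + e) + 1 + m.-1 * e)%N%:Z + c) (_ : (m.-1 < m)%N).
apply: (unit_cancel (U _)); first by lia.
have := plucker p q t (t + e) (t + m * e + 1) (t + N).
have -> : (t + N = t + m * e + 1 + e)%N by rewrite /N; lia.
rewrite !de dE//.
have -> : (t + m * e + 1 + e = t + e + m * e + 1)%N by lia.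
rewrite dE//.
have {1}-> : (t + m * e + 1 = t + e + m.-1 * e + 1)%N.
  by rewrite -{1}(prednK m_gt0) mulSn; lia.
rewrite dE ?leq_pred// !Qm !mulr1 -expr2 sqrr_sign subrr add0r mulr0.
move: (d _ _) (Q _ _) => x a H.
transitivity ((-1) ^+ m.-1 ^+ 2 * (a * x)); first by rewrite sqrr_sign mul1r.
rewrite expr2.
transitivity ((-1) ^+ m.-1 * (x * ((-1) ^+ m.-1 * a))); first by ring.
by rewrite H mulr0.
Qed.

Let dEN t : d (t + e) (t + N) = (-1) ^+ m.
Proof.
have -> : (t + N = t + e + m * e + 1)%N by rewrite /N; lia.
by rewrite dE// Qm mulr1.
Qed.

Let vecN t : p (t + N) = - (-1) ^+ m * p t /\ q (t + N) = - (-1) ^+ m * q t.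
Proof.
have [] := det2_cramer p q t (t + e) (t + N).
rewrite de !mul1r dN !mul0r !addr0 => -> ->.
by rewrite det2C dEN.
Qed.

Let detN s t : d (s + N) (t + N) = d s t.
Proof.
have [E1 E2] := vecN s; have [E3 E4] := vecN t.
rewrite /det2 E1 E2 E3 E4.
transitivity (((-1) ^+ m) ^+ 2 * d s t); first by rewrite /det2; ring.
by rewrite sqrr_sign mul1r.
Qed.

Lemma P_periodic_offset l : (0 < l < e)%N ->
  P l (l%:Z + c + (2 * N)%:Z) = P l (l%:Z + c).
Proof.
move=> le; have := detN 0 l.
rewrite [(l + N)%N]addnC !add0n -{2}(add0n l) !dP ?muln0; try lia.
by move=> H; rewrite -[in RHS]H; congr (P l _); lia.
Qed.

Lemma Q_periodic_offset j : (j < m)%N ->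
  Q j ((1 + j * e)%N%:Z + c + (2 * N)%:Z) = Q j ((1 + j * e)%N%:Z + c).
Proof.
move=> jm; have := detN 0 (0 + j * e + 1).
have -> : (0 + j * e + 1 + N = N + j * e + 1)%N by lia.
rewrite dE ?(ltnW jm)// add0n dE ?(ltnW jm)// => H.
have {}H : Q j ((2 * N + 1 + j * e)%N%:Z + c) = Q j ((2 * 0 + 1 + j * e)%N%:Z + c).
  by rewrite -[LHS]mul1r -[RHS]mul1r -(sqrr_sign R j) expr2 -!mulrA H.
by rewrite -[in RHS](add0n 1%N) -(muln0 2) -H; congr (Q j _); lia.
Qed.

End Offset.

Lemma P_periodic l u : (0 < l < e)%N ->
  P l (u + (2 * (m.+1 * e + 1))%:Z) = P l u.
Proof.
by move=> le; have := P_periodic_offset (u - l%:Z) le; rewrite [_ + (u - _)]addrC subrK.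
Qed.

Lemma Q_periodic j u : (j < m)%N ->
  Q j (u + (2 * (m.+1 * e + 1))%:Z) = Q j u.
Proof.
move=> jm; have := Q_periodic_offset (u - (1 + j * e)%N%:Z) jm.
by rewrite [_ + (u - _)]addrC subrK.
Qed.
End TPeriodicity.

(** * Products and sums indexed by labels *)

Section Labels.
Variables m n : nat.
Implicit Types i j : idx m n.

Lemma lab_range i : (0 < lab i <= m + n - 3)%N.
Proof. by rewrite /lab ltn_ord. Qed.

Lemma lab_surj k : (0 < k <= m + n - 3)%N -> exists i, lab i = k.
Proof.
case: k => // k /= kn; by exists (Ordinal kn).
Qed.

Lemma big_lab (S : Type) (x : S) (op : Monoid.law x) (F : idx m n -> S) i k :
  lab i = k -> \big[op/x]_(j | lab j == k) F j = F i.
Proof.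
by move=> <-; rewrite (big_pred1 i).
Qed.

Lemma big_lab0 (S : Type) (x : S) (op : Monoid.law x) (F : idx m n -> S) k :
  (k == 0%N) || (m + n - 3 < k)%N -> \big[op/x]_(j | lab j == k) F j = x.
Proof.
move=> k0; rewrite big_pred0 // => j; apply/eqP => jk.
by have := lab_range j; rewrite jk; lia.
Qed.

Lemma big_adj (S : Type) (x : S) (op : Monoid.com_law x) (F : idx m n -> S) i :
  \big[op/x]_(j | adj j i) F j =
  op (\big[op/x]_(j | lab j == (lab i).-1) F j) (\big[op/x]_(j | lab j == (lab i).+1) F j).
Proof.
rewrite (bigID (fun j => lab j == (lab i).-1))/=.
have i0 : (0 < lab i)%N by [].
congr (op _ _); apply: eq_bigl => j; rewrite /adj.
  apply/andP/eqP => [[_ /eqP//]|ji].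
  by rewrite ji !eqxx.
apply/andP/eqP => [[/orP[/eqP h|/eqP->//] /eqP[]]|->]; first by case: h.
by rewrite eqxx orbT; split => //; apply/eqP; rewrite /lab; lia.
Qed.
End Labels.

(** * The T-system in its presented ring *)

Section TLink.
Variables m n : nat.
Hypotheses (hm : (1 <= m)%N) (hn : (4 <= n)%N).
Notation I := (idx m n).
Notation gens := (I * int + I * int)%type.
Notation cl := (@pr_class gens (@Tsys m n)).

Let clM (a b : rexpr gens) : cl (a * b)%re = cl a * cl b.
Proof. by rewrite -[RHS]/(pr_mul _ _) pr_mulE. Qed.
Let clD (a b : rexpr gens) : cl (a + b)%re = cl a + cl b.
Proof. by rewrite -[RHS]/(pr_add _ _) pr_addE. Qed.
Let cl1 : cl ROne = 1.
Proof. by []. Qed.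
Let cl_prod (P : pred I) (F : I -> rexpr gens) :
  cl (\big[@RMul _/ROne]_(i | P i) F i) = \prod_(i | P i) cl (F i).
Proof. by apply: big_morph => //; exact: clM. Qed.

(** A product over at most one index: labels out of range get the value 1, as the products over
    neighbours require at both ends. *)
Let T (k : nat) (u : int) : Tring m n := \prod_(j : I | lab j == k) Tgen j u.
Let TV (k : nat) (u : int) : Tring m n := \prod_(j : I | lab j == k) cl (RGen (inr (j, u))).

Let TE (i : I) u : T (lab i) u = Tgen i u.
Proof. exact: big_lab. Qed.

Let T0 k u : (k == 0%N) || (m + n - 3 < k)%N -> T k u = 1.
Proof. exact: big_lab0. Qed.

Let Trel a b : @Tsys m n a b -> cl a = cl b.
Proof. by move=> ab; apply/pr_classP/rcong_rel. Qed.

Let T_unit k u : T k u * TV k u = 1.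
Proof.
case: (boolP ((k == 0%N) || (m + n - 3 < k)%N)) => [k0|k0].
  by rewrite /T /TV !big_lab0// mulr1.
have [|i ik] := @lab_surj m n k; first by lia.
rewrite /T /TV !(big_lab _ _ ik) -clM -cl1; apply: Trel; exact: Tsys_unit.
Qed.

Let Tadj i u : \prod_(j | adj j i) Tgen j u = T (lab i).-1 u * T (lab i).+1 u.
Proof. exact: big_adj. Qed.

Let T_lem k u : (0 < k <= m)%N ->
  T k (u - n%:Z + 1) * T k (u + n%:Z - 1) = T k.-1 u * T k.+1 u + 1.
Proof.
move=> km; have [|i ik] := @lab_surj m n k; first by lia.
rewrite -ik !TE -clM -Tadj; rewrite -ik in km.
have := Trel (@Tsys_lem m n i u _); rewrite clD cl_prod => -> //; lia.
Qed.

(** The four forms of the relation become one. With [l = m + e - k], the exceptional neighbours are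
    the two ends of the chain [P]: [P e = 1] below [T_(m+1)], and [P 1 = T_m] above the last
    label. *)
Let T_gtm k u : (m < k <= m + n - 3)%N ->
  T k (u - 1) * T k (u + 1) =
  T m (u - (m + n - 1 - k)%N%:Z) * T m (u + (m + n - 1 - k)%N%:Z) +
  (if k == m.+1 then 1 else T k.-1 u) *
  (if k == (m + n - 3)%N then T m u else T k.+1 u).
Proof.
move=> kn; have [|i ik] := @lab_surj m n k; first by lia.
have [|h hk] := @lab_surj m n m; first by lia.
have hE v : T m v = Tgen h v by rewrite -TE hk.
rewrite -ik !TE -clM; rewrite -ik in kn.
case: (ltnP 4 n) => n4; last first.
  have -> : lab i = m.+1 by lia.
  have E : m.+1 = (m + n - 3)%N by lia.
  rewrite eqxx E eqxx mul1r !hE.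
  have := Trel (@Tsys_eqm1_n4 m n h i u _ hk _); rewrite clM => ->; try lia.
  rewrite clD clM; congr (cl (RGen (inl (_, _))) * cl (RGen (inl (_, _))) + _); lia.
case: (ltngtP (lab i) m.+1) => [|im|im]; first by lia.
- case: (ltngtP (lab i) (m + n - 3)%N) => [il|il|il]; first 2 last.
  + have [|k' kk] := @lab_surj m n (m + n - 4)%N; first by lia.
    have := Trel (@Tsys_last m n h i k' u _ hk il kk); rewrite clM => -> //.
    rewrite clD !clM !hE.
    have -> : T (lab i).-1 u = Tgen k' u.
      by rewrite -TE kk il; congr (T _ _); lia.
    congr (_ + _); last by rewrite mulrC.
    by congr (cl (RGen (inl (_, _))) * cl (RGen (inl (_, _)))); lia.
  + have := Trel (@Tsys_mid m n h i u hk _); rewrite clM => ->; try lia.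
    rewrite clD clM cl_prod !hE; congr (_ + _); last exact: Tadj.
    congr (cl (RGen (inl (_, _))) * cl (RGen (inl (_, _)))); lia.
  + by lia.
- have [|k' kk] := @lab_surj m n m.+2; first by lia.
  have := Trel (@Tsys_eqm1 m n h i k' u n4 hk im kk); rewrite clM => ->.
  rewrite im ifF; last by lia.
  rewrite clD clM mul1r !hE -kk TE; congr (_ + _).
  congr (cl (RGen (inl (_, _))) * cl (RGen (inl (_, _)))); lia.
Qed.

Lemma Tgen_periodic (i : I) u : Tgen i (u + (period m n)%:Z) = Tgen i u.
Proof.
pose e := n.-1.
pose P (l : nat) (u : int) := if l == 1%N then T m u else if l == e then 1 else T (m + e - l) u.
pose PV (l : nat) (u : int) := if l == 1%N then TV m u else if l == e then 1 else TV (m + e - l) u.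
pose Q (j : nat) (u : int) := T (m - j) u.
pose QV (j : nat) (u : int) := TV (m - j) u.
have H1 : P 1%N =1 Q 0%N by move=> v; rewrite /P /Q eqxx subn0.
have H2 v : P e v = 1 by rewrite /P eqxx ifF//; rewrite /e; lia.
have H3 v : Q m v = 1 by rewrite /Q subnn T0.
have H4 l v : (0 < l < e)%N -> P l v * PV l v = 1.
  by rewrite /P /PV => _; case: ifP => // _; case: ifP => // _; rewrite mulr1.
have H5 j v : (j < m)%N -> Q j v * QV j v = 1 by rewrite /Q /QV.
have H6 l v : (1 < l < e)%N ->
  P l (v - 1) * P l (v + 1) = P 1%N (v - l%:Z) * P 1%N (v + l%:Z) + P l.-1 v * P l.+1 v.
  move=> le; have l1 : (l == 1%N) = false by lia.
  have le' : (l == e) = false by lia.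
  rewrite /P l1 le' T_gtm; last by rewrite /e in le *; lia.
  have -> : (m + n - 1 - (m + e - l) = l)%N by rewrite /e in le *; lia.
  congr (_ + _); rewrite mulrC; congr (_ * _).
    case: eqP => h1.
      have -> : (l.-1 == 1%N) = true by rewrite /e in le h1 *; lia.
      by [].
    have -> : (l.-1 == 1%N) = false by rewrite /e in le h1 *; lia.
    have -> : (l.-1 == e) = false by rewrite /e in le h1 *; lia.
    by congr T; rewrite /e in le h1 *; lia.
  have -> : (l.+1 == 1%N) = false by rewrite /e in le *; lia.
  case: eqP => h1.
    have -> : (l.+1 == e) = true by rewrite /e in le h1 *; lia.
    by [].
  have -> : (l.+1 == e) = false by rewrite /e in le h1 *; lia.
  by congr T; rewrite /e in le h1 *; lia.
have H7 v : Q 0%N (v - e%:Z) * Q 0%N (v + e%:Z) = Q 1%N v * P e.-1 v + 1.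
  rewrite /Q subn0 subn1; have := @T_lem m v; rewrite hm leqnn => /(_ isT).
  have -> : v - n%:Z + 1 = v - e%:Z by rewrite /e; lia.
  have -> : v + n%:Z - 1 = v + e%:Z by rewrite /e; lia.
  move=> ->; rewrite /P !ifF; try (rewrite /e; lia).
  by congr (_ * T _ _ + _); rewrite /e; lia.
have H8 j v : (0 < j < m)%N ->
  Q j (v - e%:Z) * Q j (v + e%:Z) = Q j.+1 v * Q j.-1 v + 1.
  move=> jm; rewrite /Q; have := @T_lem (m - j) v.
  have -> : v - n%:Z + 1 = v - e%:Z by rewrite /e; lia.
  have -> : v + n%:Z - 1 = v + e%:Z by rewrite /e; lia.
  by move=> ->; [congr (T _ _ * T _ _ + _)|]; lia.
have per : period m n = (2 * (m.+1 * e + 1))%N by rewrite /period /e; nia.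
rewrite per -!TE; have := lab_range i; case: (leqP (lab i) m) => im ir.
  have -> : lab i = (m - (m - lab i))%N by lia.
  apply: (@Q_periodic _ m e P PV Q QV) => //; rewrite /e; lia.
have h l : lab i = (m + e - l)%N -> (1 < l < e)%N ->
    T (lab i) (u + (2 * (m.+1 * e + 1))%N%:Z) = T (lab i) u.
  move=> il le; have := @P_periodic _ m e P PV Q QV hm _ H1 H2 H3 H4 H5 H6 H7 H8 l u.
  rewrite /P ifF ?ifF ?il; try (rewrite /e in le *; lia).
  by apply; rewrite /e in le *; lia.
by apply: (h (m + e - lab i)%N); rewrite /e; lia.
Qed.

Lemma Tc_periodic (i : I) u : Tc i (u + (period m n)%:Z) = Tc i u.
Proof. by apply: val_inj; exact: Tgen_periodic. Qed.

End TLink.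

(** * The polygon of a Y-system *)

(* [Z l u] and [V j u] stand for [Y_(m+e-l)(u)] and [Y_(m-j)(u)], where [e = n-1]; the
   boundary values [Z 1 = V m = 0] make the relations uniform (with [0^-1 = 0]). *)
Record Ysolution (K : fieldType) (m e : nat) (Z V : nat -> int -> K) (B : int) : Prop := {
  Ysol_m_gt0 : (0 < m)%N ;
  Ysol_e_gt2 : (2 < e)%N ;
  Ysol_Z1 : forall u, Z 1%N u = 0 ;
  Ysol_Vm : forall u, V m u = 0 ;
  Ysol_Z_neq0 : forall l u, (1 < l < e)%N -> Z l u != 0 ;
  Ysol_Z1_neq0 : forall l u, (1 < l < e)%N -> 1 + Z l u != 0 ;
  Ysol_V1_neq0 : forall j u, (j < m)%N -> 1 + V j u != 0 ;
  Ysol_Z_rel : forall l u, (1 < l)%N -> (l.+1 < e)%N -> B <= u ->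
  Z l (u - 1) * Z l (u + 1) * ((1 + (Z l.-1 u)^-1) * (1 + (Z l.+1 u)^-1)) = 1 ;
  Ysol_ZV_rel : forall u, B <= u ->
  Z e.-1 (u - 1) * Z e.-1 (u + 1) * (1 + (Z e.-2 u)^-1) = 1 + V 0%N u ;
  Ysol_V0_rel : forall u, B <= u ->
  V 0%N (u - e%:Z) * V 0%N (u + e%:Z) =
  (1 + V 1%N u) *
  (\prod_(2 <= l < e) ((1 + Z l (u - l%:Z)) * (1 + Z l (u + l%:Z)))) *
  (1 + (Z 2%N u)^-1)^-1 ;
  Ysol_V_rel : forall j u, (0 < j < m)%N -> B <= u ->
  V j (u - e%:Z) * V j (u + e%:Z) = (1 + V j.-1 u) * (1 + V j.+1 u)
}.

Section YPolygon.
Variables (K : fieldType) (m e : nat) (Z V : nat -> int -> K) (B : int).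
Hypothesis S : Ysolution m e Z V B.
Let m_gt0 := Ysol_m_gt0 S.
Let e_gt2 := Ysol_e_gt2 S.
Let Z1 := Ysol_Z1 S.
Let Vm := Ysol_Vm S.
Let Z_neq0 := Ysol_Z_neq0 S.
Let Z1_neq0 := Ysol_Z1_neq0 S.
Let V1_neq0 := Ysol_V1_neq0 S.
Let Z_rel := Ysol_Z_rel S.
Let ZV_rel := Ysol_ZV_rel S.
Let V0_rel := Ysol_V0_rel S.
Let V_rel := Ysol_V_rel S.

Variable c : int.
Hypothesis Bc : B <= c.

(** With neighbouring determinants normalized to 1, the case [l = 2] of the cross-ratio formula says
    that two consecutive short diagonals have product [1 + 1/Z 2]. The first value is a free choice:
    it corresponds to rescaling even and odd vectors inversely, which leaves all cross-ratios
    unchanged. *)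
Fixpoint short_diag (t : nat) : K :=
  if t is t'.+1 then (1 + (Z 2%N ((2 * t' + 3)%N%:Z + c))^-1) / short_diag t'
  else 1.

Fixpoint polygon_vec (t : nat) : (K * K) * (K * K) :=
  if t is t'.+1 then
    let: (v, w) := polygon_vec t' in
    (w, (short_diag t' * w.1 - v.1, short_diag t' * w.2 - v.2))
  else ((1, 0), (0, 1)).

Definition polygon_p t := (polygon_vec t).1.1.
Definition polygon_q t := (polygon_vec t).1.2.
Local Notation p := polygon_p.
Local Notation q := polygon_q.
Notation d := (det2 p q).

Lemma Zinv1_neq0 l u : (0 < l < e)%N -> 1 + (Z l u)^-1 != 0.
Proof.
case: l => [|[|l]]// le; first by rewrite Z1 invr0 addr0 oner_neq0.
have z0 := @Z_neq0 l.+2 u le.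
have -> : 1 + (Z l.+2 u)^-1 = (1 + Z l.+2 u) / Z l.+2 u by field.
by rewrite mulf_neq0 ?invr_neq0 ?Z1_neq0.
Qed.

Lemma short_diag_neq0 t : short_diag t != 0.
Proof.
elim: t => [|t IH] /=; first exact: oner_neq0.
by rewrite mulf_neq0 ?invr_neq0// Zinv1_neq0//; lia.
Qed.

Let vecSS t : p t.+2 = short_diag t * p t.+1 - p t /\ q t.+2 = short_diag t * q t.+1 - q t.
Proof. by rewrite /p /q /=; case: (polygon_vec t) => v w. Qed.

Lemma polygon_d1 t : d t t.+1 = 1.
Proof.
elim: t => [|t IH]; first by rewrite /det2 /p /q /= mul0r subr0 mul1r.
have [E1 E2] := vecSS t.
by rewrite -[RHS]IH /det2 E1 E2; ring.
Qed.

Lemma polygon_d2 t : d t t.+2 = short_diag t.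
Proof.
have [E1 E2] := vecSS t.
by rewrite -[RHS]mulr1 -(polygon_d1 t) /det2 E1 E2; ring.
Qed.

Lemma polygon_plucker1 t l : 1 + d t (t + l).+1 * d t.+1 (t + l) = d t (t + l) * d t.+1 (t + l).+1.
Proof.
have := plucker p q t t.+1 (t + l) (t + l).+1.
by rewrite !polygon_d1 mulr1 => /eqP; rewrite addrAC subr_eq0 => /eqP.
Qed.

Definition Ztime l t : int := (2 * t + l + 1)%N%:Z + c.

(** The right side is a cross-ratio, since neighbours have determinant 1. [Z_rel] at one level
    yields the next level from the two before it. At [l = 1] the quadrilateral degenerates, which
    agrees with [Z 1 = 0] and [0^-1 = 0]. *)
Lemma polygon_Z l : (0 < l < e)%N -> forall t,
  (Z l (Ztime l t))^-1 = d t (t + l).+1 * d t.+1 (t + l).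
Proof.
elim/ltn_ind: l => -[//|[_ _ t|[_ _ t|l IH le t]]].
- by rewrite Z1 invr0 addn1 det2xx mulr0.
- have := polygon_plucker1 t 2; rewrite addn2 polygon_d1 !polygon_d2 mulr1 => /eqP.
  rewrite -subr_eq0 [short_diag t.+1]/= mulrC divfK ?short_diag_neq0//.
  rewrite opprD addrACA subrr add0r subr_eq0 => /eqP ->.
  by rewrite /Ztime; congr (Z _ _)^-1; lia.
have rel : Z l.+2 (Ztime l.+2 t) * Z l.+2 (Ztime l.+2 t.+1) *
    ((1 + (Z l.+1 (Ztime l.+1 t.+1))^-1) * (1 + (Z l.+3 (Ztime l.+3 t))^-1)) = 1.
  rewrite -[in RHS](@Z_rel l.+2 (Ztime l.+3 t))//; last by rewrite /Ztime; lia.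
  by congr (Z _ _ * Z _ _ * ((1 + (Z _ _)^-1) * _)); rewrite /Ztime; lia.
have z0 : Z l.+2 (Ztime l.+2 t) != 0 by apply: Z_neq0; lia.
have z1 : Z l.+2 (Ztime l.+2 t.+1) != 0 by apply: Z_neq0; lia.
have n0 : 1 + (Z l.+1 (Ztime l.+1 t.+1))^-1 != 0 by apply: Zinv1_neq0; lia.
have E1 := IH l.+1; have E2 := IH l.+2.
rewrite E1 ?polygon_plucker1 in rel n0; try lia.
apply: (addrI 1); rewrite polygon_plucker1.
apply: (mulfI n0); apply: (mulfI z0); apply: (mulfI z1).
transitivity (1 : K); first by rewrite -[RHS]rel; ring.
have := E2 (ltnSn _) _ t; have := E2 (ltnSn _) _ t.+1.
move=> /(_ (ltnW le))E4 /(_ (ltnW le))E3.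
transitivity (Z l.+2 (Ztime l.+2 t) * (Z l.+2 (Ztime l.+2 t))^-1 *
  (Z l.+2 (Ztime l.+2 t.+1) * (Z l.+2 (Ztime l.+2 t.+1))^-1)).
  by rewrite !mulfV// mulr1.
by rewrite E3 E4 !addSn !addnS; ring.
Qed.

Lemma polygon_Z1 l t : (0 < l < e)%N ->
  1 + (Z l (Ztime l t))^-1 = d t (t + l) * d t.+1 (t + l).+1.
Proof. by move=> le; rewrite polygon_Z// polygon_plucker1. Qed.

Lemma polygon_d_neq0 l t : (0 < l <= e)%N -> d t (t + l) != 0.
Proof.
case: l => [|[|[|l]]]// le; first by rewrite addn1 polygon_d1 oner_neq0.
  by rewrite addn2 polygon_d2 short_diag_neq0.
have : (Z l.+2 (Ztime l.+2 t))^-1 != 0 by rewrite invr_neq0// Z_neq0//; lia.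
rewrite polygon_Z; last by lia.
by rewrite mulf_eq0 negb_or [(t + l.+3)%N]addnS => /andP[].
Qed.

Definition polygon_E j t := d t (t + j * e + 1).
Local Notation E := polygon_E.
Definition polygon_D j t := d t (t + e) * d (t + j * e + 1) (t + j * e + 1 + e).
Local Notation D := polygon_D.

Lemma polygon_D_neq0 j t : D j t != 0.
Proof. by rewrite /D mulf_neq0// polygon_d_neq0//; lia. Qed.

Lemma polygon_plucker j t :
  D j t + E j.+1 t * d (t + e) (t + j * e + 1) = E j t * E j (t + e).
Proof.
have := plucker p q t (t + e) (t + j * e + 1) (t + j * e + 1 + e).
rewrite /D /E; have -> : (t + j.+1 * e + 1 = t + j * e + 1 + e)%N by lia.
have -> : (t + e + j * e + 1 = t + j * e + 1 + e)%N by lia.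
by move=> /eqP; rewrite addrAC subr_eq0 => /eqP.
Qed.

Definition Vtime j t : int := (2 * t + 1 + j.+1 * e)%N%:Z + c.

(** In [ZV_rel], [1 + V 0] stands where [Z_rel] at [e.-1] would have the inverse of [1 + 1/Z e], and
    [D 0 t] is what the latter would be in determinants; the factors [E 0] are 1. *)
Lemma polygon_V0 t : (1 + V 0%N (Vtime 0 t)) * D 0 t = E 0 t * E 0 (t + e).
Proof.
rewrite -ZV_rel; last by rewrite /Vtime; lia.
have -> : Vtime 0 t - 1 = Ztime e.-1 t by rewrite /Vtime /Ztime; lia.
have -> : Vtime 0 t + 1 = Ztime e.-1 t.+1 by rewrite /Vtime /Ztime; lia.
have -> : Vtime 0 t = Ztime e.-2 t.+1 by rewrite /Vtime /Ztime; lia.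
have z0 : Z e.-1 (Ztime e.-1 t) != 0 by apply: Z_neq0; lia.
have z1 : Z e.-1 (Ztime e.-1 t.+1) != 0 by apply: Z_neq0; lia.
rewrite polygon_Z1; last by lia.
have := @polygon_Z e.-1 _ t; have := @polygon_Z e.-1 _ t.+1.
move=> /(_ _)H1 /(_ _)H2; have {}H1 := H1 (_ : (0 < e.-1 < e)%N).
rewrite /D /E !mul0n !addn0 !addn1 !polygon_d1 mul1r.
have h : (0 < e.-1 < e)%N by lia.
apply: (mulfI (invr_neq0 z0)); apply: (mulfI (invr_neq0 z1)).
transitivity (d t.+1 (t.+1 + e.-2) * d t.+2 (t.+1 + e.-2).+1 * (d t (t + e) * d t.+1 (t.+1 + e))).
  by field; rewrite z0 z1.
rewrite mulr1 (polygon_Z h t) (polygon_Z h t.+1).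
have -> : (t.+1 + e.-2 = t + e.-1)%N by lia.
have -> : (t + e = (t + e.-1).+1)%N by lia.
have -> : (t.+1 + e = (t.+1 + e.-1).+1)%N by lia.
by rewrite !addSn; ring.
Qed.

(** Each [1 + Z l] is a quotient of products of determinants based at [s] and [s+1]; the product
    telescopes in the other endpoint. *)
Let prod_right s k : (2 <= k <= e)%N ->
  \prod_(2 <= l < k) (1 + Z l (Ztime l s)) * d s (s + k) = d s (s + 2) * d s.+1 (s + k).
Proof.
elim: k => // k IH; case: (ltnP 1 k) => k1 ke; last first.
  have -> : k = 1%N by lia.
  by rewrite big_geq// mul1r addn2 polygon_d1 mulr1.
rewrite big_nat_recr//=.
have z : Z k (Ztime k s) != 0 by apply: Z_neq0; lia.
have -> : 1 + Z k (Ztime k s) = Z k (Ztime k s) * (1 + (Z k (Ztime k s))^-1) by field.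
have Dk : d s (s + k) != 0 by apply: polygon_d_neq0; lia.
rewrite polygon_Z1; last by lia.
transitivity (\prod_(2 <= l < k) (1 + Z l (Ztime l s)) * d s (s + k) *
  (Z k (Ztime k s) * d s (s + k.+1) * d s.+1 (s + k).+1)); first by ring.
rewrite IH; last by lia.
have := @polygon_Z k _ s => /(_ _)H.
apply: (mulfI (invr_neq0 z)).
transitivity (d s (s + 2) * d s.+1 (s + k) * (d s (s + k.+1) * d s.+1 (s + k).+1)).
  by field.
by rewrite H ?addnS; [ring|lia].
Qed.

(** The mirror image of the previous telescoping, with [s] and [s+1] as the later endpoints. The
    bound [e <= s] keeps the truncated differences [s - l] genuine. *)
Let prod_left s k : (2 <= k <= e)%N -> (e <= s)%N ->
  \prod_(2 <= l < k) (1 + Z l (Ztime l (s - l))) * d (s - k).+1 s.+1 =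
  d (s - k).+1 s * d s.-1 s.+1.
Proof.
move=> + es; elim: k => // k IH; case: (ltnP 1 k) => k1 ke; last first.
  have -> : k = 1%N by lia.
  rewrite big_geq// mul1r; have -> : (s - 2).+1 = s.-1 by lia.
  by have := polygon_d1 s.-1; rewrite prednK; [move=> ->; rewrite mul1r|lia].
rewrite big_nat_recr//=.
have z : Z k (Ztime k (s - k)) != 0 by apply: Z_neq0; lia.
have -> : 1 + Z k (Ztime k (s - k)) = Z k (Ztime k (s - k)) * (1 + (Z k (Ztime k (s - k)))^-1) by field.
have kE := @polygon_Z k _ (s - k); have k1E := @polygon_Z1 k (s - k).
rewrite k1E; last by lia.
have -> : (s - k.+1).+1 = (s - k)%N by lia.
rewrite subnK; last by lia.
rewrite subnK in kE; last by lia.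
transitivity (\prod_(2 <= l < k) (1 + Z l (Ztime l (s - l))) * d (s - k).+1 s.+1 *
  (Z k (Ztime k (s - k)) * d (s - k) s * d (s - k) s.+1)); first by ring.
rewrite IH; last by lia.
apply: (mulfI (invr_neq0 z)).
transitivity (d (s - k) s * d s.-1 s.+1 * (d (s - k) s.+1 * d (s - k).+1 s)).
  by field.
by rewrite kE; [ring|lia].
Qed.

Lemma V_of_V1 j t : (1 + V j (Vtime j t)) * D j t = E j t * E j (t + e) ->
  V j (Vtime j t) * D j t = E j.+1 t * d (t + e) (t + j * e + 1).
Proof.
rewrite -polygon_plucker mulrDl mul1r => H.
by apply: (addrI (D j t)).
Qed.

(** Of the long products in [V0_rel], telescoping leaves two short diagonals around [t + e]. Their
    product is [1 + 1/Z 2], which the last factor of the relation cancels. *)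
Lemma polygon_V1_step t : (1 + V 1%N (Vtime 1 t)) * D 1 t = E 1 t * E 1 (t + e).
Proof.
have rel : V 0%N (Vtime 0 t) * V 0%N (Vtime 0 (t + e)) = (1 + V 1%N (Vtime 1 t)) *
  ((\prod_(2 <= l < e) (1 + Z l (Ztime l (t + e - l)))) *
   (\prod_(2 <= l < e) (1 + Z l (Ztime l (t + e))))) *
  (1 + (Z 2%N (Ztime 2 (t + e).-1))^-1)^-1.
  have -> : Vtime 0 t = Vtime 1 t - e%:Z by rewrite /Vtime; lia.
  have -> : Vtime 0 (t + e) = Vtime 1 t + e%:Z by rewrite /Vtime; lia.
  rewrite V0_rel; last by rewrite /Vtime; lia.
  rewrite -big_split; congr (_ * _ * (1 + (Z _ _)^-1)^-1); last by rewrite /Vtime /Ztime; lia.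
  rewrite !big_nat; apply: eq_bigr => l /andP[l1 l2].
  by congr ((1 + Z _ _) * (1 + Z _ _)); rewrite /Vtime /Ztime; lia.
have PR := @prod_right (t + e) e (_ : (2 <= e <= e)%N).
have PL := @prod_left (t + e) e (_ : (2 <= e <= e)%N) (leq_addl _ _).
have z : 1 + (Z 2%N (Ztime 2 (t + e).-1))^-1 != 0 by apply: Zinv1_neq0; lia.
have zE : 1 + (Z 2%N (Ztime 2 (t + e).-1))^-1 = d (t + e).-1 (t + e).+1 * d (t + e) (t + e + 2).
  rewrite polygon_Z1 ?addn2; last by lia.
  by have -> : ((t + e).-1.+1 = t + e)%N by lia.
have W1 := V_of_V1 (polygon_V0 t).
have W2 := V_of_V1 (polygon_V0 (t + e)).
rewrite addnK in PL.
move: rel PR PL z zE W1 W2.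
set A := \prod_(2 <= l < e) _; set A' := \prod_(2 <= l < e) _.
move=> rel /(_ _)PR /(_ _)PL z zE.
have {}PR : A' * d (t + e) (t + e + e) = d (t + e) (t + e + 2) * d (t + e).+1 (t + e + e).
  by apply: PR; lia.
have {}PL : A * d t.+1 (t + e).+1 = d t.+1 (t + e) * d (t + e).-1 (t + e).+1.
  by apply: PL; lia.
rewrite /D /E !mul0n !mul1n !addn0 !addn1 !addSn => W1 W2.
have n1 : d t.+1 (t + e) != 0.
  have -> : (t + e = t.+1 + e.-1)%N by lia.
  by apply: polygon_d_neq0; lia.
have n2 : d (t + e).+1 (t + e + e) != 0.
  have -> : (t + e + e = (t + e).+1 + e.-1)%N by lia.
  by apply: polygon_d_neq0; lia.
apply: (mulfI n1); apply: (mulfI n2); apply: (mulfI z).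
move: W1 W2; rewrite (det2C p q t.+1 (t + e)) (det2C p q (t + e).+1 (t + e + e)) => W1 W2.
transitivity ((1 + (Z 2%N (Ztime 2 (t + e).-1))^-1) * (V 0%N (Vtime 0 t) * (d t (t + e) * d t.+1 (t + e).+1) *
   (V 0%N (Vtime 0 (t + e)) * (d (t + e) (t + e + e) * d (t + e).+1 (t + e + e).+1)))); last first.
  by rewrite W1 W2; ring.
transitivity ((1 + (Z 2%N (Ztime 2 (t + e).-1))^-1) * (V 0%N (Vtime 0 t) * V 0%N (Vtime 0 (t + e))) *
  (d t (t + e) * d t.+1 (t + e).+1 * d (t + e) (t + e + e) * d (t + e).+1 (t + e + e).+1)); last first.
  by ring.
rewrite rel [X in X * (d t (t + e) * _ * _ * _)]mulrC divfK// zE.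
transitivity ((1 + V 1%N (Vtime 1 t)) * (A * d t.+1 (t + e).+1) * (A' * d (t + e) (t + e + e)) *
   (d t (t + e) * d (t + e).+1 (t + e + e).+1)).
  by rewrite PR PL; ring.
by ring.
Qed.

(** In the induction step the [D] factors obey the same multiplicative pattern as [V_rel], so only
    the [E] factors have to be matched. The ones to be divided out are nonzero because [1 + V j]
    is. *)
Lemma polygon_V j : (j <= m)%N -> forall t,
  (1 + V j (Vtime j t)) * D j t = E j t * E j (t + e).
Proof.
elim/ltn_ind: j => -[_ _ t|[_ _ t|j IH jm t]]; first exact: polygon_V0.
  exact: polygon_V1_step.
have rel : V j.+1 (Vtime j.+1 t) * V j.+1 (Vtime j.+1 (t + e)) =
    (1 + V j (Vtime j (t + e))) * (1 + V j.+2 (Vtime j.+2 t)).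
  have -> : Vtime j.+1 t = Vtime j.+2 t - e%:Z by rewrite /Vtime; lia.
  have -> : Vtime j.+1 (t + e) = Vtime j.+2 t + e%:Z by rewrite /Vtime; lia.
  have -> : Vtime j (t + e) = Vtime j.+2 t by rewrite /Vtime; lia.
  by apply: V_rel; [lia|rewrite /Vtime; lia].
have H0 := IH j (leqW (leqnn _)) (ltnW (ltnW jm)) (t + e).
have H1 := V_of_V1 (IH j.+1 (leqnn _) (ltnW jm) t).
have H2 := V_of_V1 (IH j.+1 (leqnn _) (ltnW jm) (t + e)).
have DD : D j.+1 t * D j.+1 (t + e) = D j (t + e) * D j.+2 t.
  rewrite /D; have -> : (t + e + j * e + 1 = t + j.+1 * e + 1)%N by lia.
  have -> : (t + e + j.+1 * e + 1 = t + j.+1 * e + 1 + e)%N by lia.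
  have -> : (t + j.+2 * e + 1 = t + j.+1 * e + 1 + e)%N by lia.
  by ring.
have EE : E j (t + e) * E j (t + e + e) != 0.
  by rewrite -H0 mulf_neq0 ?polygon_D_neq0// V1_neq0//; lia.
have E1 : d (t + e) (t + j.+1 * e + 1) = E j (t + e).
  by rewrite /E; congr (d _ _); lia.
have E2 : d (t + e + e) (t + e + j.+1 * e + 1) = E j (t + e + e).
  by rewrite /E; congr (d _ _); lia.
rewrite E1 in H1; rewrite E2 in H2.
have Dj := polygon_D_neq0 j (t + e).
apply: (mulfI EE); rewrite -{1}H0.
transitivity ((1 + V j (Vtime j (t + e))) * (1 + V j.+2 (Vtime j.+2 t)) * (D j (t + e) * D j.+2 t)).
  by ring.
rewrite -rel -DD.
transitivity (V j.+1 (Vtime j.+1 t) * D j.+1 t * (V j.+1 (Vtime j.+1 (t + e)) * D j.+1 (t + e))).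
  by ring.
by rewrite H1 H2; ring.
Qed.

Lemma polygon_E_neq0 j t : (j <= m)%N -> E j t != 0.
Proof.
move=> jm; have : E j t * E j (t + e) != 0.
  rewrite -(polygon_V jm) mulf_neq0 ?polygon_D_neq0//.
  move: jm; rewrite leq_eqVlt => /predU1P[->|jm]; last exact: V1_neq0.
  by rewrite Vm addr0 oner_neq0.
by rewrite mulf_eq0 negb_or => /andP[].
Qed.

Definition polygon_size := (m.+1 * e + 1)%N.
Local Notation N := polygon_size.

(** The boundary value [V m = 0] makes a product of two determinants vanish. One of them is
    [E m.-1 (t + e)], which is nonzero, so the other one must vanish. *)
Lemma polygon_closed t : d t (t + N) = 0.
Proof.
have := V_of_V1 (polygon_V (leqnn m) t); rewrite Vm mul0r => /esym/eqP.
have -> : (t + m * e + 1 = t + e + m.-1 * e + 1)%N.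
  by rewrite -{1}(prednK m_gt0) mulSn; lia.
rewrite mulf_eq0 (negPf (polygon_E_neq0 _ (leq_pred _))) orbF => /eqP <-.
by rewrite /E /N; congr (d _ _); lia.
Qed.

(** The Cramer coefficient of vector [t + N] along vector [t]. It may depend on [t], but since
    neighbours have determinant 1, consecutive values are inverse to each other. *)
Definition monodromy t : K := d (t + N) (t + e) / d t (t + e).

Lemma monodromyP t :
  p (t + N) = monodromy t * p t /\ q (t + N) = monodromy t * q t.
Proof.
have [] := det2_cramer p q t (t + e) (t + N).
have n0 : d t (t + e) != 0 by apply: polygon_d_neq0; lia.
rewrite polygon_closed !mul0r !addr0 => H1 H2.
by split; apply: (mulfI n0); rewrite (H1, H2) /monodromy mulrA mulrCA divff ?mulr1.
Qed.

Lemma monodromy_neq0 t : monodromy t != 0.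
Proof.
rewrite /monodromy mulf_neq0 ?invr_neq0 ?polygon_d_neq0//; try lia.
rewrite det2C oppr_eq0; have -> : (t + N = t + e + m * e + 1)%N by rewrite /N; lia.
exact: polygon_E_neq0.
Qed.

Lemma det_monodromy s t : d (s + N) (t + N) = monodromy s * monodromy t * d s t.
Proof.
have [E1 E2] := monodromyP s; have [E3 E4] := monodromyP t.
by rewrite /det2 E1 E2 E3 E4; ring.
Qed.

Lemma monodromyS t : monodromy t * monodromy t.+1 = 1.
Proof.
have := det_monodromy t t.+1.
by rewrite addSn !polygon_d1 mulr1.
Qed.

(** The monodromy factors occur in neighbouring pairs and cancel. *)
Lemma polygon_Z_periodic l : (1 < l < e)%N -> Z l (Ztime l 0 + (2 * N)%:Z) = Z l (Ztime l 0).
Proof.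
move=> le; have -> : Ztime l 0 + (2 * N)%:Z = Ztime l N by rewrite /Ztime; lia.
apply: invr_inj; rewrite !polygon_Z; try lia.
have -> : ((N + l).+1 = l.+1 + N)%N by lia.
have -> : (N + l = l + N)%N by lia.
have := det_monodromy 0 l.+1; rewrite add0n => ->.
have := det_monodromy 1 l; rewrite add1n => ->.
rewrite !add0n; transitivity (monodromy 0 * monodromy 1 * (monodromy l * monodromy l.+1) *
  (d 0 l.+1 * d 1 l)); first by ring.
by rewrite !monodromyS !mul1r.
Qed.

(** As [V j] is a quotient of determinants in the same four vectors, both sides acquire the same
    four monodromy factors. *)
Lemma polygon_V_periodic j : (j < m)%N -> V j (Vtime j 0 + (2 * N)%:Z) = V j (Vtime j 0).
Proof.
move=> jm; have -> : Vtime j 0 + (2 * N)%:Z = Vtime j N by rewrite /Vtime; lia.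
have H0 := V_of_V1 (polygon_V (ltnW jm) 0).
have := V_of_V1 (polygon_V (ltnW jm) N).
have M1 := det_monodromy 0 e; have M2 := det_monodromy 0 (j * e + 1 + e).
rewrite add0n in M1; rewrite add0n in M2; rewrite /E /D.
have -> : (N + e = e + N)%N by lia.
have -> : (N + j * e + 1 = j * e + 1 + N)%N by lia.
have -> : (N + j.+1 * e + 1 = j * e + 1 + e + N)%N by lia.
have -> : (j * e + 1 + N + e = j * e + 1 + e + N)%N by lia.
rewrite M1 M2 !det_monodromy.
have n0 := monodromy_neq0 0; have n1 := monodromy_neq0 e.
have n2 := monodromy_neq0 (j * e + 1); have n3 := monodromy_neq0 (j * e + 1 + e).
move: H0 (polygon_D_neq0 j 0); rewrite /E /D !add0n.
have -> : (j.+1 * e + 1 = j * e + 1 + e)%N by lia.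
move=> H0 D0 H; apply: (mulIf D0); rewrite H0.
apply: (mulfI n0); apply: (mulfI n1); apply: (mulfI n2); apply: (mulfI n3).
by apply: (etrans _ (etrans H _)); ring.
Qed.

End YPolygon.

(** * Identities of subtraction-free expressions *)

Section Digits.

Lemma digits_inj (D k : nat) (c c' : nat -> nat) :
  (forall i, c i < D)%N -> (forall i, c' i < D)%N ->
  (\sum_(i < k) c i * D ^ i = \sum_(i < k) c' i * D ^ i)%N ->
  forall i, (i < k)%N -> c i = c' i.
Proof.
elim: k c c' => [|k IH] c c' cD c'D; first by [].
rewrite !big_ord_recl /= !muln1 => H.
have D0 : (0 < D)%N by apply: leq_trans (cD 0%N).
have shift (a : nat -> nat) :
    (\sum_(i < k) a (bump 0 i) * D ^ bump 0 i = (\sum_(i < k) a i.+1 * D ^ i) * D)%N.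
  by rewrite big_distrl/=; apply: eq_bigr => i _; rewrite expnS mulnCA mulnC.
rewrite !shift in H.
have H0 : c 0%N = c' 0%N.
  have := congr1 (modn^~ D) H.
  by rewrite -modnDmr modnMl addn0 -[in RHS]modnDmr modnMl addn0 !modn_small.
move: H; rewrite H0 => /addnI /eqP; rewrite eqn_pmul2r// => /eqP H [//|i] ik.
exact: (IH (fun i => c i.+1) (fun i => c' i.+1)).
Qed.

Lemma bigmax_mem (s : seq nat) : s != [::] -> \max_(w <- s) w \in s.
Proof.
elim: s => // a [|b s] IH _; first by rewrite big_seq1 mem_seq1.
rewrite big_cons; case: (leqP a (\max_(w <- b :: s) w)) => _.
  by rewrite inE IH ?orbT.
by rewrite inE eqxx.
Qed.

Lemma sum_pow_bounds (X : nat) (s : seq nat) : (0 < X)%N -> s != [::] ->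
  (X ^ (\max_(w <- s) w) <= \sum_(w <- s) X ^ w <= size s * X ^ (\max_(w <- s) w))%N.
Proof.
move=> X0 s0; apply/andP; split.
  by rewrite [leqRHS](big_rem _ (bigmax_mem s0))/= leq_addr.
have -> : (size s * X ^ (\max_(w <- s) w) = \sum_(i <- s) X ^ (\max_(w <- s) w))%N.
  by rewrite big_const_seq count_predT iter_addn_0 mulnC.
rewrite big_seq [leqRHS]big_seq; apply: leq_sum => w ws; apply: leq_pexp2l => //.
exact: (@leq_bigmax_seq _ s xpredT id).
Qed.

(* The dominant terms of both sums agree once the base exceeds the number of terms. *)
Lemma sum_pow_max_le (X : nat) (s s' : seq nat) : s != [::] -> s' != [::] ->
  (size s' < X)%N -> (\sum_(w <- s) X ^ w <= \sum_(w <- s') X ^ w)%N ->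
  (\max_(w <- s) w <= \max_(w <- s') w)%N.
Proof.
move=> s0 s'0 sX le; have X0 : (0 < X)%N by apply: leq_trans sX.
rewrite leqNgt; apply/negP => lt.
have /andP[h1 _] := sum_pow_bounds X0 s0.
have /andP[_ h2] := sum_pow_bounds X0 s'0.
have := leq_trans h1 (leq_trans le h2); apply/negP; rewrite -ltnNge.
apply: leq_trans (_ : X ^ (\max_(w <- s') w).+1 <= _)%N; last by rewrite leq_pexp2l.
by rewrite expnS ltn_pmul2r// expn_gt0 X0.
Qed.

End Digits.

Section Monomials.
Variable G : eqType.
Implicit Types (M : seq G) (P : seq (seq G)).

Definition num_eval (R : comPzSemiRingType) (f : G -> R) P : R :=
  \sum_(M <- P) \prod_(g <- M) f g.

Lemma num_eval_cat (R : comPzSemiRingType) (f : G -> R) P P' :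
  num_eval f (P ++ P') = num_eval f P + num_eval f P'.
Proof. by rewrite /num_eval big_cat. Qed.

Lemma num_eval_mul (R : comPzSemiRingType) (f : G -> R) P P' :
  num_eval f [seq M ++ M' | M <- P, M' <- P'] = num_eval f P * num_eval f P'.
Proof.
rewrite /num_eval big_allpairs_dep/= big_distrl/=; apply: eq_bigr => M _.
by rewrite big_distrr/=; apply: eq_bigr => M' _; rewrite big_cat.
Qed.

Section Weight.
Variables (L : seq G) (D : nat).

(* The value of a monomial under the Kronecker substitution of [X ^ (D ^ i)] for the i-th
   generator is [X ^ weight M]. *)
Definition weight M : nat := \sum_(g <- M) D ^ index g L.

Lemma weight_digits g0 M : uniq L -> {subset M <= L} ->
  weight M = (\sum_(i < size L) count_mem (nth g0 L i) M * D ^ i)%N.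
Proof.
move=> uL; rewrite /weight; elim: M => [_|g M IH gM].
  by rewrite big_nil big1.
have gL : g \in L by apply: gM; rewrite mem_head.
rewrite big_cons IH; last by move=> x xM; apply: gM; rewrite inE xM orbT.
under [RHS]eq_bigr do rewrite /= mulnDl.
rewrite big_split/=; congr (_ + _)%N.
have gi : (index g L < size L)%N by rewrite index_mem.
rewrite (bigD1 (Ordinal gi))//= nth_index// eqxx mul1n big1 ?addn0// => i ig.
rewrite (_ : g == _ = false) ?mul0n//; apply/eqP => gE.
by move/eqP: ig; apply; apply: val_inj; rewrite /= gE index_uniq.
Qed.

Lemma weight_inj M M' : uniq L -> {subset M <= L} -> {subset M' <= L} ->
  (size M < D)%N -> (size M' < D)%N -> weight M = weight M' -> perm_eq M M'.
Proof.
move=> uL ML M'L MD M'D wE; apply/permP => a.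
have cE x : count_mem x M = count_mem x M'.
  have [xL|xL] := boolP (x \in L); last first.
    by rewrite !(count_memPn _)//; apply: contra xL => /ML || apply: contra xL => /M'L.
  rewrite !(@weight_digits x)// in wE.
  have h i : (count_mem (nth x L i) M < D)%N by apply: leq_ltn_trans MD; exact: count_size.
  have h' i : (count_mem (nth x L i) M' < D)%N by apply: leq_ltn_trans M'D; exact: count_size.
  have := digits_inj h h' wE; move=> /(_ (index x L)); rewrite nth_index// index_mem.
  exact.
have : perm_eq M M' by apply/allP => x _; rewrite /= cE.
by move/permP; apply.
Qed.
End Weight.

(* The monomials that dominate under the Kronecker substitution with a large base. *)
Lemma common_monomial P P' : P != [::] -> P' != [::] ->
  (forall f : G -> nat, (forall g, 0 < f g)%N -> num_eval f P = num_eval f P') ->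
  exists M M', [/\ M \in P, M' \in P' & perm_eq M M'].
Proof.
move=> P0 P'0 H.
pose L := undup (flatten (P ++ P')).
(* [D] exceeds every exponent, so the exponents of a monomial are the base-[D] digits of its weight;
   [X] exceeds the number of terms on either side, so the largest weight can be read off the
   value. *)
pose D := (\max_(M <- P ++ P') size M).+1.
pose X := (size P + size P').+2.
have subL M : M \in P ++ P' -> {subset M <= L}.
  by move=> MP g gM; rewrite mem_undup; apply/flattenP; exists M.
have sizeD M : M \in P ++ P' -> (size M < D)%N.
  by move=> MP; rewrite ltnS; exact: (@leq_bigmax_seq _ _ xpredT size).
have numE Q : num_eval (fun g => X ^ (D ^ index g L))%N Q =
    (\sum_(w <- map (weight L D) Q) X ^ w)%N.
  rewrite /num_eval big_map; apply: eq_bigr => M _.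
  by rewrite /weight; elim/big_rec2: _ => // g w x _ ->; rewrite expnD.
have {}H : (\sum_(w <- map (weight L D) P) X ^ w =
    \sum_(w <- map (weight L D) P') X ^ w)%N.
  by rewrite -!numE; apply: H => g; rewrite expn_gt0.
have mapP0 : map (weight L D) P != [::] by case: (P) P0.
have mapP'0 : map (weight L D) P' != [::] by case: (P') P'0.
have wE : \max_(w <- map (weight L D) P) w = \max_(w <- map (weight L D) P') w.
  apply/eqP; rewrite eqn_leq !(@sum_pow_max_le X)// ?size_map ?H//; rewrite /X; lia.
have /mapP[M MP ME] := bigmax_mem mapP0.
have /mapP[M' MP' ME'] := bigmax_mem mapP'0.
have MPP : M \in P ++ P' by rewrite mem_cat MP.
have MPP' : M' \in P ++ P' by rewrite mem_cat MP' orbT.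
exists M, M'; split => //.
apply: (@weight_inj L D); rewrite ?undup_uniq ?sizeD//; try exact: subL.
by rewrite -ME -ME' wE.
Qed.

End Monomials.

HB.instance Definition _ (S : semifieldType) := Monoid.isComLaw.Build S 1%g (@monoid.mul S)
  (@mulgA S) (@sfmulC S) (@mul1g S).

(** * Values of sums of monomials in a semifield *)

Section SemifieldEval.
Variables (G : eqType) (S : semifieldType) (h : G -> S).
Implicit Types (M : seq G) (P : seq (seq G)).

Let oadd := oAC (@Algebra.addrA S) (@Algebra.addrC S).

Definition mon_val M : S := \big[@monoid.mul S/1%g]_(g <- M) h g.

(* A semifield has no zero, so the value of the empty sum is [None]. *)
Definition sum_val P : option S := \big[oadd/None]_(M <- P) Some (mon_val M).

Lemma sum_val_cat P P' : sum_val (P ++ P') = oadd (sum_val P) (sum_val P').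
Proof. by rewrite /sum_val big_cat. Qed.

Lemma sum_val_mulmon M P p : sum_val P = Some p ->
  sum_val [seq M ++ M' | M' <- P] = Some (mon_val M * p)%g.
Proof.
elim: P p => [|M' P IH] p; first by rewrite /sum_val big_nil.
rewrite /= /sum_val !big_cons -/(sum_val P) -/(sum_val (map _ _)).
have MM : mon_val (M ++ M') = (mon_val M * mon_val M')%g by rewrite /mon_val big_cat.
case E : (sum_val P) => [p'|].
  rewrite (IH p')// MM => -[<-]; rewrite /oadd oACE; congr Some.
  by rewrite [RHS]sfmulC sfmulDl ![(_ * mon_val M)%g]sfmulC.
case: P E {IH} => [_|M'' P]; last first.
  by rewrite /sum_val big_cons -/(sum_val P); case: (sum_val P).
by rewrite /sum_val big_nil => -[<-]; rewrite MM.
Qed.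

Lemma sum_val_mul P P' p p' : sum_val P = Some p -> sum_val P' = Some p' ->
  sum_val [seq M ++ M' | M <- P, M' <- P'] = Some (p * p')%g.
Proof.
move=> + E'; elim: P p => [|M P IH] p; first by rewrite /sum_val big_nil.
rewrite /= sum_val_cat (sum_val_mulmon M E').
rewrite /sum_val big_cons -/(sum_val P) -/(sum_val (flatten _)).
case E : (sum_val P) => [q|].
  by rewrite (IH q)// => -[<-]; rewrite /oadd !oACE sfmulDl.
case: P E {IH} => [_|M'' P]; last first.
  by rewrite /sum_val big_cons -/(sum_val P); case: (sum_val P).
by rewrite /= /sum_val big_nil => -[<-].
Qed.
End SemifieldEval.

Section Transfer.
Variable G : eqType.

(** Polynomials are nonempty lists of monomials, with coefficients encoded by repetition. Such a
    list can be evaluated in every semifield, where neither zero nor negative coefficients would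
    make sense. *)
Fixpoint num_den (a : sfexpr G) : seq (seq G) * seq (seq G) :=
  match a with
  | SFGen g => ([:: [:: g]], [:: [::]])
  | SFOne => ([:: [::]], [:: [::]])
  | SFAdd a b =>
    let: (P, Q) := num_den a in let: (P', Q') := num_den b in
    ([seq M ++ M' | M <- P, M' <- Q'] ++ [seq M ++ M' | M <- P', M' <- Q],
     [seq M ++ M' | M <- Q, M' <- Q'])
  | SFMul a b =>
    let: (P, Q) := num_den a in let: (P', Q') := num_den b in
    ([seq M ++ M' | M <- P, M' <- P'], [seq M ++ M' | M <- Q, M' <- Q'])
  | SFInv a => let: (P, Q) := num_den a in (Q, P)
  end.

Notation evalS S h := (sfeval 1%g (@Algebra.add S) (@monoid.mul S) (@monoid.inv S) h).

Lemma sfeval_num_den (S : semifieldType) (h : G -> S) a :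
  exists p q, [/\ sum_val h (num_den a).1 = Some p, sum_val h (num_den a).2 = Some q &
    evalS S h a = (p * q^-1)%g].
Proof.
have one : sum_val h [:: [::]] = Some 1%g.
  by rewrite /sum_val big_seq1 /mon_val big_nil.
elim: a => [g| |a [p [q [Hp Hq Ha]]] b [p' [q' [Hp' Hq' Hb]]]
  |a [p [q [Hp Hq Ha]]] b [p' [q' [Hp' Hq' Hb]]]|a [p [q [Hp Hq Ha]]]] /=.
- exists (h g), 1%g; split => //; last by rewrite invg1 mulg1.
  by rewrite /sum_val big_seq1 /mon_val big_seq1.
- by exists 1%g, 1%g; split => //; rewrite invg1 mulg1.
- move: Hp Hq Hp' Hq'; case: (num_den a) => P Q; case: (num_den b) => P' Q' /= Hp Hq Hp' Hq'.
  exists ((p * q')%g + (p' * q)%g), (q * q')%g; split.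
  + by rewrite sum_val_cat (sum_val_mul Hp Hq') (sum_val_mul Hp' Hq).
  + exact: sum_val_mul.
  + rewrite Ha Hb sfmulDl invgM; congr (_ + _).
      by rewrite mulgA mulgK.
    by rewrite [(q'^-1 * _)%g]sfmulC mulgA mulgK.
- move: Hp Hq Hp' Hq'; case: (num_den a) => P Q; case: (num_den b) => P' Q' /= Hp Hq Hp' Hq'.
  exists (p * p')%g, (q * q')%g; split; [exact: sum_val_mul|exact: sum_val_mul|].
  rewrite Ha Hb invgM -!mulgA; congr (p * _)%g.
  by rewrite [(q'^-1 * _)%g]sfmulC !mulgA [(q^-1 * _)%g]sfmulC.
- move: Hp Hq; case: (num_den a) => P Q /= Hp Hq.
  by exists q, p; rewrite Ha invgM invgK.
Qed.

Lemma ratfun_num_den (f : G -> rat) a : (forall g, 0 < f g) ->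
  [/\ 0 < num_eval f (num_den a).1, 0 < num_eval f (num_den a).2 &
    sfeval 1 +%R *%R (@GRing.inv rat) f a = num_eval f (num_den a).1 / num_eval f (num_den a).2].
Proof.
move=> f0.
have one : num_eval f [:: [::]] = 1 by rewrite /num_eval big_seq1 big_nil.
elim: a => [g| |a [p0 q0 Ha] b [p0' q0' Hb]|a [p0 q0 Ha] b [p0' q0' Hb]|a [p0 q0 Ha]] /=.
- have -> : num_eval f [:: [:: g]] = f g by rewrite /num_eval !big_seq1.
  by rewrite one divr1.
- by rewrite one divr1.
- move: p0 q0 Ha p0' q0' Hb; case: (num_den a) => P Q; case: (num_den b) => P' Q' /= p0 q0 Ha p0' q0' Hb.
  rewrite num_eval_cat !num_eval_mul; split; rewrite ?addr_gt0 ?mulr_gt0//.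
  by rewrite Ha Hb addf_div ?gt_eqF.
- move: p0 q0 Ha p0' q0' Hb; case: (num_den a) => P Q; case: (num_den b) => P' Q' /= p0 q0 Ha p0' q0' Hb.
  rewrite !num_eval_mul; split; rewrite ?mulr_gt0//.
  by rewrite Ha Hb mulf_div.
- move: p0 q0 Ha; case: (num_den a) => P Q /= p0 q0 Ha.
  by rewrite Ha invf_div.
Qed.

(* Common monomials are removed one at a time, since sums in [S] need not be cancellative. *)
Lemma num_eval_eq_sum_val P P' (S : semifieldType) (h : G -> S) :
  (forall f : G -> nat, (forall g, 0 < f g)%N -> num_eval f P = num_eval f P') ->
  sum_val h P = sum_val h P'.
Proof.
have num1_gt0 (M : seq G) Q : (0 < num_eval (fun=> 1%N) (M :: Q))%N.
  by rewrite /num_eval big_cons big1.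
elim: {P}(size P) {-2}P (eqxx (size P)) P' => [|k IH] P /eqP.
  case: P => // _ [//|M' P'] H; have := H (fun=> 1%N) (fun=> isT).
  by have := num1_gt0 M' P'; rewrite /num_eval big_nil => /[swap] <-.
move=> sP P' H; have P0 : P != [::] by case: (P) sP.
have P'0 : P' != [::].
  apply/eqP => P'E; have := H (fun=> 1%N) (fun=> isT); rewrite P'E.
  case: P P0 {sP H} => // M Q _; have := num1_gt0 M Q.
  by rewrite [in RHS]/num_eval big_nil => /[swap] ->.
have [M [M' [MP MP' MM']]] := common_monomial P0 P'0 H.
have [pP pP'] := (perm_to_rem MP, perm_to_rem MP').
have valM : mon_val h M = mon_val h M' by exact: perm_big.
have -> : sum_val h P = sum_val h (M :: rem M P) by exact: perm_big.
have -> : sum_val h P' = sum_val h (M' :: rem M' P') by exact: perm_big.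
rewrite /sum_val !big_cons valM -!/(sum_val _ _); congr (oAC _ _ _ _).
apply: IH; first by rewrite size_rem// sP.
move=> f f0; have := H f f0.
have -> : num_eval f P = num_eval f (M :: rem M P) by exact: perm_big.
have -> : num_eval f P' = num_eval f (M' :: rem M' P') by exact: perm_big.
rewrite /num_eval !big_cons.
have -> : \prod_(g <- M) f g = \prod_(g <- M') f g by exact: perm_big.
exact: addnI.
Qed.

(** Write both sides as fractions and multiply crosswise. The two lists of monomials then agree at
    all positive integers, hence they are permutations of each other up to the order inside
    monomials, and their values agree in any semifield. *)
Lemma sfeval_transfer (a b : sfexpr G) :
  (forall f : G -> rat, (forall g, 0 < f g) ->
    sfeval 1 +%R *%R (@GRing.inv rat) f a = sfeval 1 +%R *%R (@GRing.inv rat) f b) ->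
  forall (S : semifieldType) (h : G -> S), evalS S h a = evalS S h b.
Proof.
move=> H S h.
have [p [q [Hp Hq ->]]] := sfeval_num_den h a.
have [p' [q' [Hp' Hq' ->]]] := sfeval_num_den h b.
suff : Some (p * q')%g = Some (p' * q)%g.
  move=> [E]; rewrite -[p](mulgK q') E -!mulgA; congr (p' * _)%g.
  by rewrite [(q'^-1 * _)%g]sfmulC mulgA mulgV mul1g.
rewrite -(sum_val_mul Hp Hq') -(sum_val_mul Hp' Hq).
apply: num_eval_eq_sum_val => f f0.
pose fq g : rat := (f g)%:R.
have fq0 g : 0 < fq g by rewrite ltr0n.
have [a1 a2 Ea] := ratfun_num_den a fq0.
have [b1 b2 Eb] := ratfun_num_den b fq0.
have castE P : num_eval fq P = (num_eval f P)%:R.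
  rewrite /num_eval natr_sum; apply: eq_bigr => M _.
  by rewrite natr_prod.
apply/eqP; rewrite -(eqr_nat rat) -!castE !num_eval_mul; apply/eqP.
have := H fq fq0; rewrite Ea Eb => /eqP.
by rewrite eqr_div ?(gt_eqF a2) ?(gt_eqF b2)// => /eqP.
Qed.
End Transfer.

(** * Periodicity of the Y-system *)

Lemma sfeval_prod (G S : Type) (one : S) add mul inv (f : G -> S)
    (I : Type) (r : seq I) (P : pred I) (F : I -> sfexpr G) :
  sfeval one add mul inv f (\big[@SFMul G/SFOne]_(i <- r | P i) F i) =
  \big[mul/one]_(i <- r | P i) sfeval one add mul inv f (F i).
Proof. exact: big_morph. Qed.

Lemma sfeval_ext (G S : Type) (one : S) add mul inv (f g : G -> S) a :
  f =1 g -> sfeval one add mul inv f a = sfeval one add mul inv g a.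
Proof. by move=> fg; elim: a => //= [a -> b ->|a -> b ->|a ->]. Qed.

Notation sfsubst s := (sfeval SFOne (@SFAdd _) (@SFMul _) (@SFInv _) s).

Lemma sfeval_subst (G G' S : Type) (one : S) add mul inv (f : G' -> S) (s : G -> sfexpr G') a :
  sfeval one add mul inv f (sfsubst s a) =
  sfeval one add mul inv (fun g => sfeval one add mul inv f (s g)) a.
Proof. by elim: a => //= [a -> b ->|a -> b ->|a ->]. Qed.

(** * Solving the Y-system from a finite window of initial values *)

Section Recursion.
Variables m n : nat.
Hypotheses (hm : (1 <= m)%N) (hn : (4 <= n)%N).
Notation I := (idx m n).
Notation Yg i u := (SFGen (i : I, u%R : int)).
Implicit Types (i j k : I) (u v : int).

(* The index labelled [k], or the junk value [i] if [k] is out of range. *)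
Definition olab i (k : nat) : I := insubd i k.-1.

Lemma lab_olab i (k : nat) : (0 < k <= m + n - 3)%N -> lab (olab i k) = k.
Proof. by case: k => // k kn; rewrite /lab /olab insubdK. Qed.

Definition half_step i : int := if (lab i <= m)%N then n%:Z - 1 else 1.

Local Open Scope sfexpr_scope.
(** As a function of [(i, u)], in contrast to the relation [Ysys], this lets the system be solved
    for the value at the later time. *)
Definition Yrhs i u : sfexpr (I * int) :=
  if (lab i < m)%N then \prod_(j | adj j i) (1 + Yg j u)
  else if lab i == m then
    \prod_(j | (lab j).+1 == m) (1 + Yg j u)
    * (\prod_(j | (m < lab j)%N)
         ((1 + Yg j (u - m%:Z - n%:Z + 1 + (lab j)%:Z))
          * (1 + Yg j (u + m%:Z + n%:Z - 1 - (lab j)%:Z))))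
    * (1 + (Yg (olab i (m + n - 3)) u)^-1)^-1
  else if lab i == m.+1 then
    if (4 < n)%N then (1 + Yg (olab i m) u) * (1 + (Yg (olab i m.+2) u)^-1)^-1
    else 1 + Yg (olab i m) u
  else (\prod_(j | adj j i) (1 + (Yg j u)^-1))^-1.

Lemma Ysys_Yrhs i u :
  Ysys (Yg i (u - half_step i) * Yg i (u + half_step i)) (Yrhs i u).
Proof.
rewrite /Yrhs /half_step; have := lab_range i => ir.
case: ltngtP => [im|im|im].
- have -> : (u - (n%:Z - 1) = u - n%:Z + 1)%R by lia.
  have -> : (u + (n%:Z - 1) = u + n%:Z - 1)%R by lia.
  exact: Ysys_ltm.
- case: eqP => im1.
    case: ltnP => n4.
      by apply: Ysys_eqm1 => //; rewrite lab_olab//; lia.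
    by apply: Ysys_eqm1_n4 => //; rewrite ?lab_olab//; lia.
  by apply: Ysys_gtm1; lia.
- have -> : (u - (n%:Z - 1) = u - n%:Z + 1)%R by lia.
  have -> : (u + (n%:Z - 1) = u + n%:Z - 1)%R by lia.
  by apply: Ysys_eqm => //; rewrite lab_olab//; lia.
Qed.

Local Close Scope sfexpr_scope.

Lemma half_step_gt0 i : 0 < half_step i.
Proof. by rewrite /half_step; case: ifP => _; lia. Qed.

(** All times on the right lie strictly between the two times on the left, so solving for the later
    value is a recursion on time. The tightest case is the label [m], where the products reach [n-2]
    away and the left side [n-1]. *)
Lemma sfeval_Yrhs_local (S : Type) (one : S) add mul inv (f g : I * int -> S) i u :
  (forall j v, u - half_step i < v < u + half_step i -> f (j, v) = g (j, v)) ->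
  sfeval one add mul inv f (Yrhs i u) = sfeval one add mul inv g (Yrhs i u).
Proof.
move=> fg; have fgu j : f (j, u) = g (j, u).
  by apply: fg; have := half_step_gt0 i; lia.
rewrite /Yrhs; case: ltngtP => [im|im|im].
- by rewrite !sfeval_prod; apply: eq_bigr => j _ /=; rewrite fgu.
- case: eqP => im1; last first.
    by rewrite /= !sfeval_prod; congr inv; apply: eq_bigr => j _ /=; rewrite fgu.
  by case: ltnP => n4 /=; rewrite !fgu.
- rewrite /= !sfeval_prod fgu; congr (mul (mul _ _) _).
    by apply: eq_bigr => j _ /=; rewrite fgu.
  apply: eq_bigr => j mj /=; have := lab_range j; have := fg j.
  rewrite /half_step im leqnn => fgj jr.
  by rewrite !fgj//; lia.
Qed.

Section Window.
Variable v0 : int.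

(* The value at [(i, v)] expressed through the window of length [2 * half_step] at [v0];
   [fuel] exceeds the number [v - v0] of time steps. *)
Fixpoint window_expr (fuel : nat) (g : I * int) : sfexpr (I * int) :=
  if fuel is fuel'.+1 then
    let: (i, v) := g in
    if v < v0 + half_step i *+ 2 then SFGen g
    else SFMul (sfsubst (window_expr fuel') (Yrhs i (v - half_step i)))
               (SFInv (window_expr fuel' (i, v - half_step i *+ 2)))
  else SFGen g.

Lemma window_expr_stableS (k : nat) i v : v - v0 < k%:Z -> window_expr k.+1 (i, v) = window_expr k (i, v).
Proof.
elim: k i v => [|k IH] i v vk.
  by rewrite /= ifT//; have := half_step_gt0 i; lia.
rewrite [LHS]/= [RHS]/=; case: ifP => // vw; congr SFMul.
  apply: sfeval_Yrhs_local => j w wv; apply: IH; lia.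
by congr SFInv; apply: IH; have := half_step_gt0 i; lia.
Qed.

Lemma window_expr_stable (k k' : nat) i v : v - v0 < k%:Z -> v - v0 < k'%:Z ->
  window_expr k (i, v) = window_expr k' (i, v).
Proof.
wlog kk' : k k' / (k <= k')%N.
  move=> H h h'; case: (leqP k k') => kk; first exact: H.
  by apply/esym/H => //; exact: ltnW.
move=> h _; rewrite -(subnK kk'); elim: (k' - k)%N => // j ->.
by rewrite addSn window_expr_stableS//; lia.
Qed.

Definition window_value (g : I * int) := window_expr `|g.2 - v0|.+1 g.

Lemma window_valueE i v : v0 + half_step i *+ 2 <= v ->
  window_value (i, v) =
  SFMul (sfsubst window_value (Yrhs i (v - half_step i)))
        (SFInv (window_value (i, v - half_step i *+ 2))).
Proof.
move=> vw; rewrite {1}/window_value/= ifF; last by apply/negbTE; rewrite -leNgt.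
have := half_step_gt0 i => h0; congr SFMul.
  by apply: sfeval_Yrhs_local => j w wv; apply: window_expr_stable => /=; lia.
by congr SFInv; apply: window_expr_stable => /=; lia.
Qed.

Lemma psf_class_eval (G : Type) (rel : sfexpr G -> sfexpr G -> Prop) a :
  sfeval 1%g (@Algebra.add (psemifield rel)) (@monoid.mul _) (@monoid.inv _)
    (psf_gen rel) a = psf_class rel a.
Proof.
elim: a => //= [a -> b ->|a -> b ->|a ->].
- exact: psf_addE.
- exact: psf_mulE.
- exact: psf_invE.
Qed.

Notation evalYsf := (sfeval 1%g (@Algebra.add (Ysemifield m n)) (@monoid.mul _) (@monoid.inv _)).

(** This reduces an identity between generators of the presented semifield to an identity between
    subtraction-free expressions. *)
Lemma window_value_Ygen g : evalYsf (psf_gen (@Ysys m n)) (window_value g) = psf_gen (@Ysys m n) g.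
Proof.
rewrite /window_value; move: (`|g.2 - v0|.+1)%N => fuel.
elim: fuel g => //= fuel IH [i v]; case: ifP => // vw.
rewrite /= sfeval_subst (sfeval_ext _ _ _ _ _ IH) IH psf_class_eval.
have := sfcong_rel (Ysys_Yrhs i (v - half_step i)) => /psf_classP <-.
rewrite -psf_mulE -[psf_mul _ _]/(@monoid.mul (Ysemifield m n) _ _).
have -> : v - half_step i + half_step i = v by lia.
have -> : v - half_step i - half_step i = v - half_step i *+ 2 by lia.
by rewrite sfmulC mulgA mulVg mul1g.
Qed.

Notation evQ := (sfeval 1 +%R *%R (@GRing.inv rat)).

Lemma sfeval_rat_gt0 (G : Type) (f : G -> rat) a : (forall g, 0 < f g) -> 0 < evQ f a.
Proof.
move=> f0; elim: a => //= [a ha b hb|a ha b hb|a ha].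
- exact: addr_gt0.
- exact: mulr_gt0.
- by rewrite invr_gt0.
Qed.

(** The window values are independent: any positive rationals extend to a solution, although only
    for times after the start of the window. Before it, [window_value] is an unconstrained
    generator. *)
Lemma window_value_rat (f : I * int -> rat) i u : (forall g, 0 < f g) ->
  v0 + half_step i <= u ->
  let y g := evQ f (window_value g) in
  y (i, u - half_step i) * y (i, u + half_step i) = evQ y (Yrhs i u).
Proof.
move=> f0 ui; have h0 := half_step_gt0 i.
rewrite /= (window_valueE (_ : v0 + half_step i *+ 2 <= u + half_step i)); last by lia.
rewrite /= sfeval_subst.
have -> : u + half_step i - half_step i = u by lia.
have -> : u + half_step i - half_step i *+ 2 = u - half_step i by lia.
by rewrite mulrC divfK// gt_eqF// sfeval_rat_gt0.
Qed.
End Window.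
End Recursion.

(** * Y-systems with values in a field *)

Section Numeric.
Variables m n : nat.
Hypotheses (hm : (1 <= m)%N) (hn : (4 <= n)%N).
Notation I := (idx m n).
Variables (K : fieldType) (Y : I -> int -> K) (B : int).
Implicit Types (i j : I) (u v : int).

Notation evK := (sfeval 1 +%R *%R (@GRing.inv K) (fun g => Y g.1 g.2)).

Hypothesis Y_neq0 : forall i u, Y i u != 0.
Hypothesis Y1_neq0 : forall i u, 1 + Y i u != 0.
Hypothesis Y_rel : forall i u, B <= u ->
  Y i (u - half_step i) * Y i (u + half_step i) = evK (Yrhs i u).

(** Labels out of range get the value 0. With [0^-1 = 0], both [1 + y] and [1 + 1/y] are then 1, so
    the factors omitted for [m = 1], for [n = 4] and at the last label need no separate
    treatment. *)
Definition ylab (k : nat) u : K := \sum_(j : I | lab j == k) Y j u.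

Lemma ylabE i u : ylab (lab i) u = Y i u.
Proof. exact: big_lab. Qed.

Lemma ylab0 (k : nat) u : (k == 0%N) || (m + n - 3 < k)%N -> ylab k u = 0.
Proof. exact: big_lab0. Qed.

Lemma prod_1Dylab (k : nat) u : \prod_(j : I | lab j == k) (1 + Y j u) = 1 + ylab k u.
Proof.
case: (boolP ((k == 0%N) || (m + n - 3 < k)%N)) => k0.
  by rewrite ylab0// big_lab0// addr0.
have [|i ik] := @lab_surj m n k; first by lia.
by rewrite (big_lab _ _ ik) -ik ylabE.
Qed.

Lemma prod_1DylabV (k : nat) u :
  \prod_(j : I | lab j == k) (1 + (Y j u)^-1) = 1 + (ylab k u)^-1.
Proof.
case: (boolP ((k == 0%N) || (m + n - 3 < k)%N)) => k0.
  by rewrite ylab0// big_lab0// invr0 addr0.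
have [|i ik] := @lab_surj m n k; first by lia.
by rewrite (big_lab _ _ ik) -ik ylabE.
Qed.

Lemma ylab_ltm (k : nat) u : (0 < k < m)%N -> B <= u ->
  ylab k (u - n.-1%:Z) * ylab k (u + n.-1%:Z) =
  (1 + ylab k.-1 u) * (1 + ylab k.+1 u).
Proof.
move=> km Bu; have [|i ik] := @lab_surj m n k; first by lia.
rewrite -ik !ylabE; rewrite -ik in km.
have := Y_rel i Bu; rewrite /half_step ifT; last by lia.
have -> : n%:Z - 1 = n.-1%:Z by lia.
move=> ->; rewrite /Yrhs ifT; last by lia.
by rewrite sfeval_prod/= big_adj !prod_1Dylab.
Qed.

Lemma ylab_gtm (k : nat) u : (m < k <= m + n - 3)%N -> B <= u ->
  ylab k (u - 1) * ylab k (u + 1) =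
  (if k == m.+1 then 1 + ylab m u else (1 + (ylab k.-1 u)^-1)^-1) *
  (1 + (ylab k.+1 u)^-1)^-1.
Proof.
move=> km Bu; have [|i ik] := @lab_surj m n k; first by lia.
rewrite -ik !ylabE; rewrite -ik in km.
have := Y_rel i Bu; rewrite /half_step ifF; last by lia.
move=> ->; rewrite /Yrhs.
have -> : (lab i < m)%N = false by lia.
have -> : (lab i == m) = false by lia.
case: eqP => im1.
  have E : lab (olab i m) = m by apply: lab_olab; lia.
  case: ltnP => n4 /=.
    have E2 : lab (olab i m.+2) = m.+2 by apply: lab_olab; lia.
    by rewrite -!ylabE E E2 im1.
  have z : ylab (lab i).+1 u = 0 by apply: ylab0; rewrite im1; lia.
  by rewrite -!ylabE E z invr0 addr0 invr1 mulr1.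
by rewrite /= sfeval_prod/= big_adj !prod_1DylabV invfM.
Qed.

Lemma prod_gtm (H : nat -> K) :
  \prod_(j : I | (m < lab j)%N) H (lab j) = \prod_(2 <= l < n.-1) H (m + n.-1 - l)%N.
Proof.
rewrite -(@big_geq_mkord _ _ _ m (m + n - 3) xpredT (fun x : nat => H x.+1)) -[X in \prod_(X <= _ < _) _]add0n big_addn.
rewrite -[X in _ = \prod_(X <= _ < _) _]add0n big_addn.
rewrite [RHS]big_nat_rev/=.
have -> : (m + n - 3 - m = n.-1 - 2)%N by lia.
rewrite !big_nat; apply: eq_bigr => l l2; congr H; lia.
Qed.

Lemma ylab_eqm u : B <= u ->
  ylab m (u - n.-1%:Z) * ylab m (u + n.-1%:Z) =
  (1 + ylab m.-1 u) *
  (\prod_(2 <= l < n.-1) ((1 + ylab (m + n.-1 - l) (u - l%:Z)) *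
                          (1 + ylab (m + n.-1 - l) (u + l%:Z)))) *
  (1 + (ylab (m + n - 3) u)^-1)^-1.
Proof.
move=> Bu; have [|i ik] := @lab_surj m n m; first by lia.
rewrite -{1 2}ik !ylabE.
have := Y_rel i Bu; rewrite /half_step ifT; last by lia.
have -> : n%:Z - 1 = n.-1%:Z by lia.
move=> ->; rewrite /Yrhs ifF; last by lia.
rewrite ifT; last by lia.
have E : lab (olab i (m + n - 3)) = (m + n - 3)%N by apply: lab_olab; lia.
rewrite /= !sfeval_prod /= -ylabE E; congr (_ * _ * _).
  by rewrite -prod_1Dylab; apply: eq_bigl => j; apply/eqP/eqP; lia.
pose H k := (1 + ylab k (u - (m + n.-1 - k)%N%:Z)) * (1 + ylab k (u + (m + n.-1 - k)%N%:Z)).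
transitivity (\prod_(j : I | (m < lab j)%N) H (lab j)).
  apply: eq_bigr => j jm; rewrite /H !ylabE; have := lab_range j => jr.
  by congr ((1 + Y _ _) * (1 + Y _ _)); lia.
rewrite (prod_gtm H) !big_nat; apply: eq_bigr => l l2.
by rewrite /H; congr ((1 + ylab _ _) * (1 + ylab _ _)); lia.
Qed.

Lemma Ysolution_ylab :
  Ysolution m n.-1 (fun l : nat => ylab (m + n.-1 - l)) (fun k : nat => ylab (m - k)) B.
Proof.
have nz k u : (0 < k <= m + n - 3)%N -> ylab k u != 0 /\ 1 + ylab k u != 0.
  by move=> /lab_surj[i <-]; rewrite ylabE; split; [exact: Y_neq0|exact: Y1_neq0].
split => //.
- lia.
- by move=> u; rewrite ylab0//; lia.
- by move=> u; rewrite ylab0//; lia.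
- by move=> l u le; apply: (nz _ _ _).1; lia.
- by move=> l u le; apply: (nz _ _ _).2; lia.
- by move=> j u le; apply: (nz _ _ _).2; lia.
- move=> l u l1 le Bu; rewrite ylab_gtm//; last by lia.
  rewrite ifF; last by lia.
  have -> : (m + n.-1 - l.-1 = (m + n.-1 - l).+1)%N by lia.
  have -> : (m + n.-1 - l.+1 = (m + n.-1 - l).-1)%N by lia.
  have n1 : 1 + (ylab (m + n.-1 - l).-1 u)^-1 != 0.
    have [z1 z2] : _ /\ _ := @nz (m + n.-1 - l).-1 u ltac:(lia).
    have -> : 1 + (ylab (m + n.-1 - l).-1 u)^-1 =
      (1 + ylab (m + n.-1 - l).-1 u) / ylab (m + n.-1 - l).-1 u by field.
    by rewrite mulf_neq0 ?invr_neq0.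
  have n2 : 1 + (ylab (m + n.-1 - l).+1 u)^-1 != 0.
    case: (leqP (m + n.-1 - l).+1 (m + n - 3)) => h; last first.
      by rewrite ylab0 ?invr0 ?addr0 ?oner_neq0// h orbT.
    have [z1 z2] : _ /\ _ := @nz (m + n.-1 - l).+1 u ltac:(lia).
    have -> : 1 + (ylab (m + n.-1 - l).+1 u)^-1 =
      (1 + ylab (m + n.-1 - l).+1 u) / ylab (m + n.-1 - l).+1 u by field.
    by rewrite mulf_neq0 ?invr_neq0.
  by rewrite -invfM [X in _ * X]mulrC mulVf// mulf_neq0.
- move=> u Bu; rewrite ylab_gtm//; last by lia.
  rewrite ifT; last by lia.
  rewrite subn0; have -> : (m + n.-1 - n.-1.-2 = (m + n.-1 - n.-1.-1).+1)%N by lia.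
  rewrite divfK//.
  case: (leqP (m + n.-1 - n.-1.-1).+1 (m + n - 3)) => h; last first.
    by rewrite ylab0 ?invr0 ?addr0 ?oner_neq0// h orbT.
  have [z1 z2] : _ /\ _ := @nz (m + n.-1 - n.-1.-1).+1 u ltac:(lia).
  have -> : 1 + (ylab (m + n.-1 - n.-1.-1).+1 u)^-1 =
    (1 + ylab (m + n.-1 - n.-1.-1).+1 u) / ylab (m + n.-1 - n.-1.-1).+1 u by field.
  by rewrite mulf_neq0 ?invr_neq0.
- move=> u Bu; rewrite subn0 ylab_eqm// subn1.
  by have -> : (m + n.-1 - 2 = m + n - 3)%N by lia.
- move=> j u jm Bu; rewrite ylab_ltm//; last by lia.
  have -> : (m - j.-1 = (m - j).+1)%N by lia.
  have -> : (m - j.+1 = (m - j).-1)%N by lia.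
  by rewrite mulrC.
Qed.

(** The offset [c] is chosen so that [u] is the time attached to vertex 0. It may precede [u] by
    almost [N], and the margin keeps it at or after [B]. *)
Lemma Y_periodic i u : B + (m * n - m + n)%N%:Z <= u ->
  Y i (u + (period m n)%:Z) = Y i u.
Proof.
move=> Bu; have S := Ysolution_ylab.
have per : period m n = (2 * polygon_size m n.-1)%N.
  by rewrite /period /polygon_size; nia.
rewrite per -!ylabE; have := lab_range i; case: (leqP (lab i) m) => im ir.
  have jm : (m - lab i < m)%N by lia.
  have Bc : B <= u - (1 + (m - lab i).+1 * n.-1)%N%:Z by nia.
  have := polygon_V_periodic S Bc jm; rewrite /Vtime muln0 add0n.
  by rewrite [_ + (u - _)]addrC subrK (_ : m - (m - lab i) = lab i)%N//; lia.
have le : (1 < m + n.-1 - lab i < n.-1)%N by lia.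
have Bc : B <= u - (m + n.-1 - lab i + 1)%N%:Z by nia.
have := polygon_Z_periodic S Bc le; rewrite /Ztime muln0 add0n.
by rewrite [_ + (u - _)]addrC subrK (_ : m + n.-1 - (m + n.-1 - lab i) = lab i)%N//; lia.
Qed.
End Numeric.

Section Universal.
Variables m n : nat.
Hypotheses (hm : (1 <= m)%N) (hn : (4 <= n)%N).

Lemma Ygen_periodic (i : idx m n) (u : int) : Ygen i (u + (period m n)%:Z) = Ygen i u.
Proof.
(* All relations hold from [v0 + n] on, since [half_step] is less than [n]; the periodicity over a
   field needs a further margin [N] before [u]. *)
pose v0 : int := u - (n + (m * n - m + n))%N%:Z.
rewrite /Ygen -(window_value_Ygen hm hn v0 (i, u)).
rewrite -(window_value_Ygen hm hn v0 (i, u + (period m n)%:Z)).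
apply: sfeval_transfer => f f0.
pose y (j : idx m n) v := sfeval 1 +%R *%R (@GRing.inv rat) f (window_value v0 (j, v)).
have y0 j v : 0 < y j v by exact: sfeval_rat_gt0.
apply: (@Y_periodic m n hm hn _ y (v0 + n%:Z)).
- by move=> j v; rewrite gt_eqF.
- by move=> j v; rewrite gt_eqF// addr_gt0.
- move=> j v jv; rewrite /y (window_value_rat hm hn)//; last first.
    by apply: le_trans jv; rewrite lerD2l /half_step; case: ifP => _; lia.
  by apply: sfeval_ext => -[k w].
- by rewrite /v0; lia.
Qed.

Lemma Yc_periodic (i : idx m n) (u : int) : Yc i (u + (period m n)%:Z) = Yc i u.
Proof. by apply: val_inj; exact: Ygen_periodic. Qed.
End Universal.

(** * Sums of cyclic cocycles *)

Section PeriodicSums.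
Variables (V : nmodType) (N : nat).

Lemma sum_shift (f : nat -> V) k : (forall a, f (a + N)%N = f a) ->
  \sum_(a < N) f (a + k)%N = \sum_(a < N) f a.
Proof.
move=> fN; elim: k => [|k IH]; first by under eq_bigr do rewrite addn0.
rewrite -IH; case: N fN => [|M] fN; first by rewrite !big_ord0.
rewrite big_ord_recr [RHS]big_ord_recl /= add0n addrC.
have -> : (M + k.+1 = k + M.+1)%N by lia.
by rewrite fN; congr (_ + _); apply: eq_bigr => i _; rewrite /bump/=; congr f; lia.
Qed.

Lemma sum_mod_coprime (f : nat -> V) e : (0 < N)%N -> coprime N e ->
  (forall a, f (a %% N)%N = f a) ->
  \sum_(a < N) f (e * a)%N = \sum_(a < N) f a.
Proof.
case: N => // M _ co fN.
pose h (a : 'I_M.+1) : 'I_M.+1 := inord (e * a %% M.+1).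
have hE a : h a = (e * a %% M.+1)%N :> nat by rewrite inordK// ltn_pmod.
have hinj : injective h.
  move=> a b /(congr1 val); rewrite /= !hE => /eqP.
  wlog ab : a b / (a <= b)%N.
    by move=> H /eqP E; case/orP: (leq_total a b) => ab; [|apply/esym]; apply: H => //; rewrite E.
  rewrite eq_sym (eqn_mod_dvd _ (leq_mul (leqnn e) ab)) -mulnBr Gauss_dvdr// => dv.
  apply: val_inj; apply/eqP; rewrite /= eqn_leq ab /= -subn_eq0.
  apply: contraLR dv; rewrite -lt0n => ab0; rewrite gtnNdvd//.
  exact: leq_ltn_trans (leq_subr _ _) (ltn_ord b).
rewrite [RHS](reindex_inj hinj) /=; apply: eq_bigr => a _.
by rewrite hE fN.
Qed.

End PeriodicSums.

Section CyclicCocycle.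
Variables (R : realFieldType) (N : nat) (k : R) (F : nat -> nat -> nat -> nat -> R).
Hypothesis F_mod : forall a b c d, F (a %% N)%N (b %% N)%N (c %% N)%N (d %% N)%N = F a b c d.
Hypothesis F_sym : forall a b c d, F c d a b = F a b c d.
Hypothesis F_rot : forall a b c d, (a < b < c)%N -> (c < d < N)%N ->
  F b c d a = k - F a b c d.
Hypothesis F_cocycle : forall a b c d, (0 < a < b)%N -> (b < c < d)%N -> (d < N)%N ->
  F a b c d = F 0%N b c d - F 0%N a c d + F 0%N a b d - F 0%N a b c.
Hypothesis N_gt0 : (0 < N)%N.

(* [F] is the coboundary of this function of triangles, up to a correction that is linear
   in the vertices; the linear term makes [tri] invariant under cyclic rotation. *)
Definition tri0 a b c : R :=
  (if a == 0%N then 0 else F 0%N a b c) - k / N%:R * (a + b + c)%:R.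

(** The residues of vertices met in cyclic order are increasing after a cyclic rotation; the three
    branches try the three rotations. *)
Definition tri a b c : R :=
  let a' := (a %% N)%N in let b' := (b %% N)%N in let c' := (c %% N)%N in
  if (a' < b' < c')%N then tri0 a' b' c'
  else if (b' < c' < a')%N then tri0 b' c' a' else tri0 c' a' b'.

Lemma tri_addN a b c : tri (a + N) (b + N) (c + N) = tri a b c.
Proof. by rewrite /tri !modnDr. Qed.

Lemma mod_between a b : (a < b)%N -> (b < a + N)%N ->
  (b %% N = a %% N + (b - a))%N /\ (a %% N + (b - a) < N)%N \/
  (b %% N + N = a %% N + (b - a))%N.
Proof.
move=> ab bN; have aN := ltn_pmod a N_gt0.
have E : (b %% N = (a %% N + (b - a)) %% N)%N by rewrite modnDml subnKC// ltnW.
case: (ltnP (a %% N + (b - a)) N) => h; [left|right].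
  by split => //; rewrite E modn_small.
rewrite E -[X in (X %% N)%N](subnK h) modnDr modn_small; lia.
Qed.

Lemma tri_rot a b c : (a < b < c)%N -> (c < a + N)%N -> tri b c (a + N) = tri a b c.
Proof.
move=> /andP[ab bc] ca; rewrite /tri modnDr.
have aN := ltn_pmod a N_gt0; have bN := ltn_pmod b N_gt0; have cN := ltn_pmod c N_gt0.
have H1 := @mod_between a b ab ltac:(lia); have H2 := @mod_between a c ltac:(lia) ca.
move: (a %% N)%N (b %% N)%N (c %% N)%N aN bN cN H1 H2 => a' b' c' aN bN cN H1 H2.
by do ![case: ifP => // ?]; exfalso; lia.
Qed.

Lemma F_tri0 a b c d : (a < b < c)%N -> (c < d < N)%N ->
  F a b c d = tri0 b c d - tri0 a c d + tri0 a b d - tri0 a b c +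
    k / N%:R * (b%:R - a%:R + d%:R - c%:R).
Proof.
move=> abc cd; rewrite /tri0 !natrD.
have -> : (b == 0%N) = false by lia.
case: eqP => [->|/eqP a0]; first by ring.
by rewrite (@F_cocycle a b c d); [ring|lia|lia|lia].
Qed.

(** The cases are which residue is the smallest. The linear term uses the true differences [b - a]
    and [d - c]. If one of these two sides passes a multiple of [N], the term gains [k / N * N = k],
    exactly the constant of [F_rot]; if another side does, [F_sym] or nothing is needed. *)
Lemma F_tri a b c d : (a < b < c)%N -> (c < d < a + N)%N ->
  F a b c d = tri b c d - tri a c d + tri a b d - tri a b c +
    k / N%:R * (b%:R - a%:R + d%:R - c%:R).
Proof.
move=> /andP[ab bc] /andP[cd da]; rewrite -F_mod.
have aN := ltn_pmod a N_gt0; have bN := ltn_pmod b N_gt0.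
have cN := ltn_pmod c N_gt0; have dN := ltn_pmod d N_gt0.
have H1 := @mod_between a b ab ltac:(lia); have H2 := @mod_between a c ltac:(lia) ltac:(lia).
have H3 := @mod_between a d ltac:(lia) da.
have Nk : k / N%:R * N%:R = k by rewrite divfK// pnatr_eq0 -lt0n.
have ba : b%:R - a%:R = (b - a)%:R :> R by rewrite natrB// ltnW.
have dc : d%:R - c%:R = (d - c)%:R :> R by rewrite natrB// ltnW.
rewrite -[_ + d%:R - c%:R]addrA ba dc /tri.
move: (a %% N)%N (b %% N)%N (c %% N)%N (d %% N)%N aN bN cN dN H1 H2 H3
  => a' b' c' d' aN bN cN dN H1 H2 H3.
have E : (b - a)%:R = b'%:R - a'%:R + (if (b' < a')%N then N%:R else 0) :> R.
  have {H2 H3} : (b - a + a' = b' + (if b' < a' then N else 0))%N by case: ltnP; lia.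
  move=> /(congr1 (fun x => x%:R : R)); rewrite !natrD => /eqP.
  by rewrite -subr_eq => /eqP <-; case: ifP => _; ring.
have E' : (d - c)%:R = d'%:R - c'%:R + (if (d' < c')%N then N%:R else 0) :> R.
  have {H1} : (d - c + c' = d' + (if d' < c' then N else 0))%N by case: ltnP; lia.
  move=> /(congr1 (fun x => x%:R : R)); rewrite !natrD => /eqP.
  by rewrite -subr_eq => /eqP <-; case: ifP => _; ring.
rewrite E E'.
have : [\/ (a' < b' < c')%N && (c' < d')%N, (d' < a' < b')%N && (b' < c')%N,
   (c' < d' < a')%N && (a' < b')%N | (b' < c' < d')%N && (d' < a')%N].
  case: H1 => [[h1 h1']|h1]; last by apply: Or44; lia.
  case: H2 => [[h2 h2']|h2]; last by apply: Or43; lia.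
  case: H3 => [[h3 h3']|h3]; last by apply: Or42; lia.
  by apply: Or41; lia.
move=> {H1 H2 H3 E E' ba dc}.
have tE (b1 b2 : bool) (x y z : R) : b1 -> (if b1 then x else if b2 then y else z) = x.
  by move=> ->.
have fE (b1 b2 : bool) (x y z : R) : b1 = false -> b2 ->
  (if b1 then x else if b2 then y else z) = y by move=> -> ->.
have ffE (b1 b2 : bool) (x y z : R) : b1 = false -> b2 = false ->
  (if b1 then x else if b2 then y else z) = z by move=> -> ->.
case => /andP[h1 h2].
- rewrite !tE; try lia.
  have -> : (b' < a')%N = false by lia.
  have -> : (d' < c')%N = false by lia.
  by rewrite (F_tri0 h1); [ring|lia].
- rewrite 3?ffE ?tE; try lia.
  have -> : (b' < a')%N = false by lia.
  have -> : (d' < c')%N = true by lia.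
  rewrite (F_rot h1); last by lia.
  by rewrite (F_tri0 h1); [rewrite -{1}Nk; ring|lia].
- rewrite 2?fE 2?ffE; try lia.
  have -> : (b' < a')%N = false by lia.
  have -> : (d' < c')%N = false by lia.
  by rewrite F_sym (F_tri0 h1); [ring|lia].
- rewrite tE 3?fE; try lia.
  have -> : (b' < a')%N = true by lia.
  have -> : (d' < c')%N = false by lia.
  rewrite -F_sym (F_rot h1); last by lia.
  by rewrite (F_tri0 h1); [rewrite -{1}Nk; ring|lia].
Qed.

Definition tri_sum x y : R := \sum_(a < N) tri a (a + x) (a + x + y).

Lemma tri_sum_shift j x y :
  \sum_(a < N) tri (a + j) (a + j + x) (a + j + x + y) = tri_sum x y.
Proof.
apply: (@sum_shift _ N (fun a => tri a (a + x) (a + x + y)) j) => a.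
by rewrite -[RHS]tri_addN; congr tri; lia.
Qed.

Lemma tri_sum_rot x y : (0 < x)%N -> (0 < y)%N -> (x + y < N)%N ->
  tri_sum x y = tri_sum y (N - (x + y)).
Proof.
move=> x0 y0 xy; rewrite -(tri_sum_shift x y); apply: eq_bigr => a _.
rewrite -tri_rot; [|lia|lia].
by congr tri; lia.
Qed.

Lemma sum_F x y z : (0 < x)%N -> (0 < y)%N -> (0 < z)%N -> (x + y + z < N)%N ->
  \sum_(a < N) F a (a + x) (a + x + y) (a + x + y + z) =
  tri_sum y z - tri_sum (x + y) z + tri_sum x (y + z) - tri_sum x y + k * (x + z)%:R.
Proof.
move=> x0 y0 z0 xyz.
transitivity (\sum_(a < N) (tri (a + x) (a + x + y) (a + x + y + z)
  - tri a (a + (x + y)) (a + (x + y) + z) + tri a (a + x) (a + x + (y + z))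
  - tri a (a + x) (a + x + y) + k / N%:R * (x + z)%:R)).
  apply: eq_bigr => a _; rewrite F_tri; [|lia|lia].
  rewrite !addnA; congr (_ + _ * _); rewrite !natrD; ring.
rewrite !big_split/= !sumrN tri_sum_shift; congr (_ + _).
rewrite sumr_const card_ord -[LHS]mulr_natr mulrAC divfK// pnatr_eq0.
by rewrite -lt0n.
Qed.

End CyclicCocycle.

Section RSGSums.
Variables (R : realFieldType) (m e : nat) (k : R) (F : nat -> nat -> nat -> nat -> R).
Hypotheses (m_gt0 : (0 < m)%N) (e_gt2 : (2 < e)%N).
Let N := (m.+1 * e + 1)%N.
Hypothesis F_mod : forall a b c d, F (a %% N)%N (b %% N)%N (c %% N)%N (d %% N)%N = F a b c d.
Hypothesis F_sym : forall a b c d, F c d a b = F a b c d.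
Hypothesis F_rot : forall a b c d, (a < b < c)%N -> (c < d < N)%N ->
  F b c d a = k - F a b c d.
Hypothesis F_cocycle : forall a b c d, (0 < a < b)%N -> (b < c < d)%N -> (d < N)%N ->
  F a b c d = F 0%N b c d - F 0%N a c d + F 0%N a b d - F 0%N a b c.

(** Both sums telescope by [sum_F]. What survives in each are the triangles with gaps [1], [m+1] and
    [(m+1)(e-1)], whose sum is [N], once in each orientation. They cancel in the difference, and
    every quadrilateral contributes [k] times the sum of its two opposite gaps: [2] in one family,
    [2(m+1)] in the other. *)
Lemma sum_quads :
  \sum_(2 <= l < e) \sum_(a < N) F a (a + m.+1) (a + m.+1 * l) (a + m.+1 * l.+1)
  - \sum_(1 <= i < m.+1) \sum_(a < N) F a (a + 1) (a + i + 1) (a + i + 2) =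
  k * 2 * (m.+1%:R * (e - 2)%:R - m%:R).
Proof.
have N_gt0 : (0 < N)%N by rewrite /N addn1.
have SF := sum_F F_mod F_sym F_rot F_cocycle N_gt0.
have Srot := tri_sum_rot k F N_gt0.
pose S := tri_sum N k F.
have sumA M : (M <= m)%N ->
    \sum_(1 <= i < M.+1) \sum_(a < N) F a (a + 1) (a + i + 1) (a + i + 2) =
    S 1%N M.+1 - S M.+1 1%N + k * 2 * M%:R.
  elim: M => [|M IH] Mm; first by rewrite big_geq// subrr mulr0 addr0.
  rewrite big_nat_recr//= IH ?(ltnW Mm)//.
  have -> : \sum_(a < N) F a (a + 1)%N (a + M.+1 + 1)%N (a + M.+1 + 2)%N =
      \sum_(a < N) F a (a + 1)%N (a + 1 + M.+1)%N (a + 1 + M.+1 + 1)%N.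
    by apply: eq_bigr => a _; congr F; lia.
  rewrite SF//; last by rewrite /N; nia.
  by rewrite -/S !add1n addn1 -[M.+1%:R]natr1; ring.
have sumC M : (1 < M <= e)%N ->
    \sum_(2 <= l < M) \sum_(a < N) F a (a + m.+1) (a + m.+1 * l) (a + m.+1 * l.+1) =
    S m.+1 (m.+1 * M.-1)%N - S (m.+1 * M.-1)%N m.+1 + k * 2 * (m.+1%:R * (M - 2)%:R).
  elim: M => // M IH /andP[M1 Me]; case: (ltnP 1 M) => M2; last first.
    have -> : M = 1%N by lia.
    by rewrite big_geq//= muln1 subrr subnn !mulr0 addr0.
  rewrite big_nat_recr//= IH; last by lia.
  have -> : \sum_(a < N) F a (a + m.+1)%N (a + m.+1 * M)%N (a + m.+1 * M.+1)%N =
      \sum_(a < N) F a (a + m.+1)%N (a + m.+1 + m.+1 * M.-1)%N (a + m.+1 + m.+1 * M.-1 + m.+1)%N.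
    by apply: eq_bigr => a _; congr F; nia.
  rewrite SF//; [|by nia|by rewrite /N; nia].
  have -> : (m.+1 + m.+1 * M.-1 = m.+1 * M)%N by nia.
  have -> : (m.+1 * M.-1 + m.+1 = m.+1 * M)%N by nia.
  have -> : (M.+1 - 2 = (M - 2).+1)%N by lia.
  by rewrite -/S natrD -[(M - 2).+1]addn1 natrD; ring.
rewrite sumA// sumC ?e_gt2 ?leqnn ?andbT ?(ltnW e_gt2)//.
have E1 : S (m.+1 * e.-1)%N m.+1 = S m.+1 1%N.
  rewrite /S Srot//; [congr tri_sum; rewrite /N; nia|by nia|by rewrite /N; nia].
have E2 : S m.+1 (m.+1 * e.-1)%N = S 1%N m.+1.
  rewrite /S Srot//; [|by nia|by rewrite /N; nia].
  rewrite Srot//; [|by nia|by rewrite /N; nia|by rewrite /N; nia].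
  by congr tri_sum; rewrite /N; nia.
by rewrite E1 E2; ring.
Qed.
End RSGSums.

(** * Convexity of the polygon of a positive Y-system *)

Section ConvexPolygon.
Variables (K : realFieldType) (m e : nat) (Z V : nat -> int -> K) (B : int).
Hypothesis S : Ysolution m e Z V B.
Hypothesis Z_gt0 : forall l u, (1 < l < e)%N -> 0 < Z l u.
Hypothesis V_gt0 : forall j u, (j < m)%N -> 0 < V j u.
Variable c : int.
Hypothesis Bc : B <= c.

Notation p := (polygon_p Z c).
Notation q := (polygon_q Z c).
Notation d := (det2 p q).
Notation E := (polygon_E e Z c).
Notation D := (polygon_D e Z c).
Notation N := (polygon_size m e).
Let e_gt2 := Ysol_e_gt2 S.

Lemma short_diag_gt0 t : 0 < short_diag Z c t.
Proof.
elim: t => [|t IH] //=; rewrite divr_gt0// addr_gt0// invr_gt0 Z_gt0//; lia.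
Qed.

Lemma polygon_d_gt0 l t : (0 < l <= e)%N -> 0 < d t (t + l).
Proof.
elim/ltn_ind: l t => -[|[|[|l]]] IH t // le; first by rewrite addn1 polygon_d1 ltr01.
  by rewrite addn2 polygon_d2 short_diag_gt0.
have : 0 < (Z l.+2 (Ztime c l.+2 t))^-1 by rewrite invr_gt0 Z_gt0//; lia.
rewrite (polygon_Z S Bc); last by lia.
have -> : (t + l.+2 = t.+1 + l.+1)%N by lia.
rewrite pmulr_lgt0; last by apply: IH; lia.
by have -> : ((t.+1 + l.+1).+1 = t + l.+3)%N by lia.
Qed.

Lemma polygon_D_gt0 j t : 0 < D j t.
Proof. by rewrite /polygon_D mulr_gt0// polygon_d_gt0//; lia. Qed.

Lemma polygon_VE j t : (j < m)%N ->
  V j (Vtime e c j t) * D j t = E j.+1 t * d (t + e) (t + j * e + 1).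
Proof. by move=> jm; apply: (V_of_V1 S Bc (polygon_V S Bc _ t)); exact: ltnW. Qed.

Lemma polygon_E_sign j t : (j <= m)%N -> 0 < (-1) ^+ j * E j t.
Proof.
elim/ltn_ind: j t => -[_ t _|[_ t jm|j IH t jm]].
- by rewrite /polygon_E mul0n addn0 addn1 polygon_d1 expr0 mul1r ltr01.
- have : 0 < V 0%N (Vtime e c 0 t) * D 0 t by rewrite mulr_gt0 ?V_gt0 ?polygon_D_gt0.
  rewrite polygon_VE// mul0n addn0 addn1 det2C mulrN -mulNr pmulr_lgt0.
    by rewrite expr1 mulN1r.
  have -> : (t + e = t.+1 + e.-1)%N by lia.
  by apply: polygon_d_gt0; lia.
have : 0 < V j.+1 (Vtime e c j.+1 t) * D j.+1 t by rewrite mulr_gt0 ?V_gt0 ?polygon_D_gt0.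
rewrite polygon_VE//.
have -> : d (t + e) (t + j.+1 * e + 1) = E j (t + e) by rewrite /polygon_E; congr (det2 _ _ _ _); lia.
have := IH j (leqW (leqnn _)) (t + e)%N (ltnW (ltnW jm)).
rewrite !exprS !mulN1r opprK; move: ((-1) ^+ j) (sqrr_sign K j) => s s2 h1 h2.
have : 0 < (s * E j.+2 t) * (s * E j (t + e)).
  by rewrite mulrACA -expr2 s2 mul1r.
by rewrite pmulr_lgt0.
Qed.

Notation mon := (monodromy m e Z c).

Lemma monodromy_sign t : 0 < (-1) ^+ m.+1 * mon t.
Proof.
have h : d (t + N) (t + e) = - E m (t + e).
  by rewrite det2C /polygon_E /polygon_size; congr (- det2 _ _ _ _); lia.
rewrite /monodromy h exprS mulN1r [X in _ * X]mulNr mulrNN mulrA.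
by rewrite divr_gt0 ?polygon_E_sign ?polygon_d_gt0//; lia.
Qed.

Lemma monodromy_iter l t : exists k, [/\ 0 < (-1) ^+ (m.+1 * l) * k,
  p (t + N * l) = k * p t & q (t + N * l) = k * q t].
Proof.
elim: l => [|l [k [k0 kp kq]]].
  by exists 1; rewrite !muln0 addn0 !mul1r ltr01.
exists (mon (t + N * l) * k); have [h1 h2] := monodromyP S Bc (t + N * l).
have -> : (t + N * l.+1 = t + N * l + N)%N by rewrite mulnSr addnA.
split; [|by rewrite h1 kp mulrA|by rewrite h2 kq mulrA].
have := mulr_gt0 k0 (monodromy_sign (t + N * l)).
by rewrite mulrACA -exprD -mulnSr [k * _]mulrC.
Qed.

(* The vertices in polygon order; the signs account for the monodromy. *)
Definition pdet a b : K := (-1) ^+ (a + b).+1 * d (e * a) (e * b).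

Lemma pdet_plucker a b x y :
  pdet a x * pdet b y = pdet a b * pdet x y + pdet a y * pdet b x.
Proof.
have := plucker p q (e * a) (e * b) (e * x) (e * y).
rewrite /pdet !exprS !exprD => H.
apply/eqP; rewrite -subr_eq0; apply/eqP.
set s := (-1) ^+ a; set s1 := (-1) ^+ b; set s2 := (-1) ^+ x; set s3 := (-1) ^+ y.
by apply: (etrans _ (etrans (congr1 (fun z => - (s * s1 * s2 * s3) * z) H) (mulr0 _))); ring.
Qed.

Lemma pdet_interpolate a b x y : 0 < pdet a b -> 0 < pdet a y ->
  0 < pdet b x -> 0 < pdet x y -> 0 < pdet b y -> 0 < pdet a x.
Proof.
move=> ab ay bx xy byy; have : 0 < pdet a x * pdet b y.
  by rewrite pdet_plucker addr_gt0// mulr_gt0.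
by rewrite pmulr_lgt0.
Qed.

Lemma polygon_det_shift s t : exists2 k, 0 < k & d (s + N) (t + N) = k * d s t.
Proof.
exists (mon s * mon t); last exact: (det_monodromy S Bc).
have := mulr_gt0 (monodromy_sign s) (monodromy_sign t).
by rewrite mulrACA -expr2 sqrr_sign mul1r.
Qed.

(** After one turn of the first vertices, these are the determinants [E j] with [j = m+1-l], because
    [(j e + 1) + l e = N]. *)
Lemma pdet_gap_small a l : (0 < l <= m.+1)%N -> 0 < pdet a (a + l).
Proof.
move=> l0; have [k k0 kE] := polygon_det_shift (e * a) (e * (a + l)).
rewrite -(pmulr_rgt0 _ k0) /pdet mulrCA -kE.
pose j := (m.+1 - l)%N; pose t := (e * a + N - (j * e + 1))%N.
have jN : (j * e + 1 + l * e = N)%N by rewrite /j /polygon_size; nia.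
have -> : (e * a + N = t + j * e + 1)%N by rewrite /t; lia.
have -> : (e * (a + l) + N = t + N)%N by rewrite /t; lia.
have [h1 h2] := monodromyP S Bc t.
have -> : d (t + j * e + 1) (t + N) = - (mon t * E j t).
  by rewrite /det2 h1 h2 /polygon_E /det2; ring.
have jm : (j <= m)%N by rewrite /j; lia.
have := mulr_gt0 (monodromy_sign t) (polygon_E_sign t jm).
rewrite mulrACA -exprD mulrN -mulNr; congr (0 < _ * _).
rewrite -signr_odd -[(-1) ^+ (_ + _).+1]signr_odd -signrN; congr (_ ^+ nat_of_bool _).
by rewrite /j; lia.
Qed.

(** As [e (m+1) l = N l - l], these gaps are short time differences [l] up to [l] turns. *)
Lemma pdet_gap_mult a l : (0 < l <= e)%N -> 0 < pdet a (a + m.+1 * l).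
Proof.
move=> l0; have [k k0 kE] := polygon_det_shift (e * a) (e * (a + m.+1 * l)).
rewrite -(pmulr_rgt0 _ k0) /pdet mulrCA -kE.
pose t := (e * a + N - l)%N.
have NE : N = (m.+1 * e + 1)%N by [].
have -> : (e * a + N = t + l)%N by rewrite /t; nia.
have -> : (e * (a + m.+1 * l) + N = t + N * l)%N by rewrite /t NE; nia.
have [k' [k'0 h1 h2]] := monodromy_iter l t.
have -> : d (t + l) (t + N * l) = - (k' * d t (t + l)).
  by rewrite /det2 h1 h2; ring.
have := mulr_gt0 k'0 (polygon_d_gt0 t l0).
rewrite -mulrA mulrN -mulNr; congr (0 < _ * _).
rewrite -signr_odd -[(-1) ^+ (_ + _).+1]signr_odd -signrN; congr (_ ^+ nat_of_bool _).
by lia.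
Qed.

(** A general gap lies between consecutive multiples of [m+1]. The Pluecker relation with these two
    neighbours expresses it through determinants of the two kinds already known to be positive. *)
Lemma pdet_gt0 a b : (a < b < a + N)%N -> 0 < pdet a b.
Proof.
move=> /andP[ab bN]; pose g := (b - a)%N.
have -> : b = (a + g)%N by rewrite /g; lia.
have gN : (g <= m.+1 * e)%N by rewrite /g /polygon_size in bN *; lia.
case: (leqP g m.+1) => gm; first by apply: pdet_gap_small; rewrite /g in gm *; lia.
pose l := (g %/ m.+1)%N; have gE := divn_eq g m.+1; rewrite -/l in gE.
have gr : (g %% m.+1 < m.+1)%N by rewrite ltn_pmod.
have l0 : (0 < l)%N by rewrite divn_gt0// ltnW.
case: (posnP (g %% m.+1)) => r0.
  by rewrite gE r0 addn0 mulnC; apply: pdet_gap_mult; nia.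
have le : (l < e)%N by nia.
apply: (@pdet_interpolate a (a + m.+1 * l) _ (a + m.+1 * l.+1)).
- by apply: pdet_gap_mult; lia.
- by apply: pdet_gap_mult; lia.
- have -> : (a + g = a + m.+1 * l + g %% m.+1)%N by lia.
  by apply: pdet_gap_small; lia.
- have -> : (a + m.+1 * l.+1 = a + g + (m.+1 - g %% m.+1))%N by nia.
  by apply: pdet_gap_small; lia.
- have -> : (a + m.+1 * l.+1 = a + m.+1 * l + m.+1)%N by nia.
  by apply: pdet_gap_small; lia.
Qed.

(** The normalization with values in []0, 1[] at cyclically ordered vertices, for which a rotation
    of the vertices is the reflection [x -> 1 - x]. *)
Definition cross_ratio t1 t2 t3 t4 : K := d t1 t2 * d t3 t4 / (d t1 t3 * d t2 t4).
Local Notation cross := cross_ratio.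

Lemma polygon_det_mod t : exists2 k, k != 0 & forall x, d t x = k * d (t %% N)%N x.
Proof.
have [k [k0 h1 h2]] := monodromy_iter (t %/ N) (t %% N).
exists k; first by apply: contraTneq k0 => ->; rewrite mulr0 ltxx.
have tE : t = (t %% N + N * (t %/ N))%N by rewrite mulnC addnC -divn_eq.
by move=> x; rewrite {1}tE /det2 h1 h2; ring.
Qed.

Lemma cross_mod t1 t2 t3 t4 :
  cross (t1 %% N)%N (t2 %% N)%N (t3 %% N)%N (t4 %% N)%N = cross t1 t2 t3 t4.
Proof.
have [k1 n1 E1] := polygon_det_mod t1; have [k2 n2 E2] := polygon_det_mod t2.
have [k3 n3 E3] := polygon_det_mod t3; have [k4 n4 E4] := polygon_det_mod t4.
have F2 x : d x t2 = k2 * d x (t2 %% N)%N by rewrite det2C E2 -mulrN -det2C.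
have F3 x : d x t3 = k3 * d x (t3 %% N)%N by rewrite det2C E3 -mulrN -det2C.
have F4 x : d x t4 = k4 * d x (t4 %% N)%N by rewrite det2C E4 -mulrN -det2C.
rewrite /cross E1 F2 E3 F4 E1 F3 E2 F4.
rewrite [X in _ = X / _](_ : _ = k1 * k2 * k3 * k4 *
  (d (t1 %% N)%N (t2 %% N)%N * d (t3 %% N)%N (t4 %% N)%N)); last by ring.
rewrite [X in _ = _ / X](_ : _ = k1 * k2 * k3 * k4 *
  (d (t1 %% N)%N (t3 %% N)%N * d (t2 %% N)%N (t4 %% N)%N)); last by ring.
by rewrite -[RHS]mulf_div divff ?mul1r// !mulf_neq0.
Qed.

Lemma cross_eqmod t1 t2 t3 t4 s1 s2 s3 s4 :
  t1 = s1 %[mod N] -> t2 = s2 %[mod N] -> t3 = s3 %[mod N] -> t4 = s4 %[mod N] ->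
  cross t1 t2 t3 t4 = cross s1 s2 s3 s4.
Proof.
by move=> e1 e2 e3 e4; rewrite -cross_mod e1 e2 e3 e4 cross_mod.
Qed.

Lemma cross_sym t1 t2 t3 t4 : cross t3 t4 t1 t2 = cross t1 t2 t3 t4.
Proof.
rewrite /cross (det2C _ _ t1 t3) (det2C _ _ t2 t4) mulrNN.
by rewrite [d t3 t4 * _]mulrC.
Qed.

Lemma cross_rev t1 t2 t3 t4 : cross t4 t3 t2 t1 = cross t1 t2 t3 t4.
Proof.
rewrite /cross (det2C _ _ t3 t4) (det2C _ _ t1 t2) (det2C _ _ t2 t4) (det2C _ _ t1 t3) !mulrNN.
by rewrite [d t3 t4 * _]mulrC [d t2 t4 * _]mulrC.
Qed.

Definition polygon_cross a b x y : K := cross (e * a) (e * b) (e * x) (e * y).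
Local Notation pcross := polygon_cross.

Lemma pcrossE a b x y : pcross a b x y = pdet a b * pdet x y / (pdet a x * pdet b y).
Proof.
rewrite /pcross /cross /pdet !exprS !exprD.
rewrite [X in _ = X / _](_ : _ = (-1) ^+ a * (-1) ^+ b * (-1) ^+ x * (-1) ^+ y *
  (d (e * a) (e * b) * d (e * x) (e * y))); last by ring.
rewrite [X in _ = _ / X](_ : _ = (-1) ^+ a * (-1) ^+ b * (-1) ^+ x * (-1) ^+ y *
  (d (e * a) (e * x) * d (e * b) (e * y))); last by ring.
by rewrite -[RHS]mulf_div divff ?mul1r// !mulf_neq0// signr_eq0.
Qed.

Section SortedCross.
Variables a b x y : nat.
Hypotheses (abx : (a < b < x)%N) (xy : (x < y < a + N)%N).

Lemma pcross_compl : 1 - pcross a b x y = pdet a y * pdet b x / (pdet a x * pdet b y).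
Proof.
have n1 : pdet a x != 0 by rewrite gt_eqF// pdet_gt0//; lia.
have n2 : pdet b y != 0 by rewrite gt_eqF// pdet_gt0//; lia.
rewrite pcrossE -[X in X - _](divff (mulf_neq0 n1 n2)) -mulrBl.
congr (_ / _); rewrite (pdet_plucker a b x y).
by rewrite addrAC subrr add0r.
Qed.

Lemma pcross_01 : 0 < pcross a b x y < 1.
Proof.
apply/andP; split.
  by rewrite pcrossE divr_gt0// mulr_gt0// pdet_gt0//; lia.
by rewrite -subr_gt0 pcross_compl divr_gt0// mulr_gt0// pdet_gt0//; lia.
Qed.

Lemma pcross_rot : pcross b x y a = 1 - pcross a b x y.
Proof.
rewrite pcross_compl pcrossE.
have pC s t : pdet t s = - pdet s t by rewrite /pdet det2C addnC mulrN.
by rewrite (pC a y) (pC a x) !mulrN invrN mulrNN [pdet b y * _]mulrC [pdet b x * _]mulrC.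
Qed.
End SortedCross.

End ConvexPolygon.

(** * The Rogers dilogarithm *)

Section Basel.
Variable R : realType.
Implicit Types (x : R) (n k : nat).

Lemma sin_lt_id x : 0 < x < pi / 2 -> sin x < x.
Proof.
case/andP=> x0 xpi; have : exists2 c, c \in `]0, x[%R & (sin x - sin 0) = cos c * (x - 0).
  apply: MVT => //.
  by apply: continuous_subspaceT => y; exact: continuous_sin.
case=> c; rewrite in_itv/= => /andP[c0 cx]; rewrite sin0 !subr0 => ->.
rewrite gtr_pMl// -[ltRHS]cos0 ltr_cos// ?in_itv/=; have := @pi_gt0 R; lra.
Qed.

Lemma id_lt_tan x : 0 < x < pi / 2 -> x < tan x.
Proof.
case/andP=> x0 xpi.
have cos_pos y : 0 <= y <= x -> 0 < cos y.
  move=> /andP[y0 yx]; apply: cos_gt0_pihalf; have := @pi_gt0 R; lra.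
have : exists2 c, c \in `]0, x[%R & (tan x - tan 0) = (cos c)^-2 * (x - 0).
  apply: MVT => //.
    move=> y; rewrite in_itv/= => /andP[y0 yx]; apply: is_derive_tan.
    by rewrite gt_eqF// cos_pos// !ltW.
  apply: continuous_in_subspaceT => y; rewrite inE/= in_itv/= => /andP[y0 yx].
  by apply: continuous_tan; rewrite gt_eqF// cos_pos// y0.
case=> c; rewrite in_itv/= => /andP[c0 cx].
rewrite tan0 !subr0 => ->; rewrite ltr_pMl //.
have cc : 0 < cos c by apply: cos_pos; rewrite !ltW.
rewrite -exprVn exprn_egt1 //.
rewrite invf_gt1//.
rewrite -[ltRHS]cos0 ltr_cos// ?in_itv/=; have := @pi_gt0 R; lra.
Qed.

Definition zeta2_sum n : R := \sum_(k < n) (k.+1%:R ^+ 2)^-1.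

Lemma zeta2_sumS n : zeta2_sum n.+1 = zeta2_sum n + (n.+1%:R ^+ 2)^-1.
Proof. by rewrite /zeta2_sum big_ord_recr. Qed.

Definition odd_zeta2_sum n : R := \sum_(0 <= k < n) ((k.*2.+1)%:R ^+ 2)^-1.

Lemma zeta2_sum_double n : zeta2_sum n.*2 = odd_zeta2_sum n + zeta2_sum n / 4.
Proof.
elim: n => [|n IH].
  by rewrite /zeta2_sum /odd_zeta2_sum big_geq// !big_ord0 mul0r addr0.
rewrite doubleS !zeta2_sumS IH /odd_zeta2_sum big_nat_recr //= mulrDl.
have -> : (n.*2.+2%:R ^+ 2)^-1 = (n.+1%:R ^+ 2)^-1 / 4 :> R.
  by rewrite -doubleS -muln2 natrM exprMn invfM; congr (_ / _); rewrite -natrX.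
by rewrite !addrA; congr (_ + _); rewrite addrAC.
Qed.

(* At these angles the sum of [1 / sin^2] is computed exactly by iterating
   [1 / sin^2 x + 1 / cos^2 x = 4 / sin^2 (2 x)], and [sin x < x < tan x] compares it with
   the sum of [1 / x^2]. *)
Let angle n k : R := (k.*2.+1)%:R * pi / (2 ^ n.+2)%:R.

Lemma angle_bound n k : (k < 2 ^ n)%N -> 0 < angle n k < pi / 2.
Proof.
move=> kn; rewrite /angle.
have p0 : (0 : R) < (2 ^ n.+2)%:R by rewrite ltr0n expn_gt0.
rewrite divr_gt0 ?mulr_gt0 ?pi_gt0//= ltr_pdivrMr// mulrAC ltr_pdivlMr//.
rewrite mulrAC [ltRHS]mulrC ltr_pM2r ?pi_gt0// -natrM ltr_nat.
rewrite !expnS; lia.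
Qed.

Lemma sin_angle_double n k :
  (k < 2 ^ n)%N ->
  (sin (angle n.+1 k) ^+ 2)^-1 + (sin (angle n.+1 (2 ^ n.+1 - k.+1)) ^+ 2)^-1
   = 4 * (sin (angle n k) ^+ 2)^-1.
Proof.
move=> kn; have kn1 : (k < 2 ^ n.+1)%N by rewrite expnS; lia.
have /andP[a0 a1] := angle_bound kn1.
have E : angle n k = angle n.+1 k *+ 2.
  have p0 : ((2 ^ n.+2)%:R : R) != 0 by rewrite pnatr_eq0 expn_eq0.
  by rewrite /angle [in RHS]expnS natrM; field.
have E2 : angle n.+1 (2 ^ n.+1 - k.+1) = pi / 2 - angle n.+1 k.
  have p0 : ((2 ^ n.+2)%:R : R) != 0 by rewrite pnatr_eq0 expn_eq0.
  have H : (((2 ^ n.+1 - k.+1).*2).+1 = 2 ^ n.+2 - k.*2.+1)%N.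
    by rewrite !expnS in kn *; lia.
  rewrite /angle H natrB; last by rewrite !expnS in kn *; lia.
  by rewrite [(2 ^ n.+3)%N]expnS natrM; field.
rewrite E2 sinB sin_pihalf cos_pihalf mul0r subr0 mul1r E sin_mulr2n.
have s0 : 0 < sin (angle n.+1 k) by apply: sin_gt0_pihalf; rewrite a0.
have c0 : 0 < cos (angle n.+1 k) by apply: cos_gt0_pihalf; rewrite a1 (lt_trans _ a0)// oppr_lt0 divr_gt0 ?pi_gt0.
have := cos2Dsin2 (angle n.+1 k).
move: (sin _) (cos _) s0 c0 => s c s0 c0 H.
transitivity ((c^+2 + s^+2) / (s ^+ 2 * c ^+ 2)); first by field; rewrite !gt_eqF.
by rewrite H; field; rewrite !gt_eqF.
Qed.

Lemma sum_inv_sin2 n :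
  \sum_(0 <= k < 2 ^ n) (sin (angle n k) ^+ 2)^-1 = 2 * 4 ^+ n.
Proof.
elim: n => [|n IH].
  rewrite big_nat1 /angle mul1r expr0 mulr1.
  have a : tan (pi / 4) = 1 :> R by rewrite tan_piquarter.
  have c0 : 0 < cos (pi / 4 : R).
    by apply: cos_gt0_pihalf; have := @pi_gt0 R; lra.
  have : sin (pi / 4) = cos (pi / 4) :> R.
    by move: a; rewrite /tan => /(congr1 ( *%R^~ (cos (pi / 4)))); rewrite divfK ?gt_eqF// mul1r.
  have := cos2Dsin2 (pi / 4 : R) => /[swap] ->.
  move=> H; have -> : cos (pi / 4) ^+ 2 = 2^-1 :> R by lra.
  by rewrite invrK.
rewrite expnS mul2n -addnn (big_cat_nat _ (n := 2 ^ n)) ?leq_addr//=.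
rewrite [X in _ + X]big_nat_rev /=.
rewrite -[X in \sum_(X <= _ < _ + _) _]add0n big_addn addnK.
rewrite -big_split/= big_nat.
under eq_bigr => k /andP[_ kn].
  have -> : (2 ^ n + (2 ^ n + 2 ^ n) - (k + 2 ^ n).+1 = 2 ^ n.+1 - k.+1)%N.
    by rewrite expnS; lia.
  rewrite sin_angle_double//; over.
by rewrite -big_nat -mulr_sumr IH exprS; ring.
Qed.

(** The upper bound is [sin x < x]. For the lower one, [1/sin^2 = 1/tan^2 + 1] is below [1/x^2 + 1];
    the extra 1 at each of the [2^n] angles is the relative error [2^-(n+1)] of the total
    [2 * 4^n]. *)
Lemma odd_zeta2_sum_bounds n :
  pi ^+ 2 / 8 * (1 - 2^-1 ^+ n.+1) <= odd_zeta2_sum (2 ^ n) <= pi ^+ 2 / 8.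
Proof.
pose c : R := (2 ^ n.+2)%:R ^+ 2 / pi ^+ 2.
have p2 : (0 : R) < (2 ^ n.+2)%:R by rewrite ltr0n expn_gt0.
have pi0 := @pi_gt0 R.
have c0 : 0 < c by rewrite divr_gt0// exprn_gt0.
have angleE k : (angle n k ^+ 2)^-1 = c * ((k.*2.+1)%:R ^+ 2)^-1.
  rewrite /angle /c; move: (pi : R) pi0 ((2 ^ n.+2)%:R : R) p2 => p p0 q q0.
  by field; rewrite !gt_eqF//= ltr_wpDr// ler0n.
have cE : c * (pi ^+ 2 / 8) = 2 * 4 ^+ n.
  have -> : (4 : R) ^+ n = (2 ^ n)%:R ^+ 2.
    by rewrite natrX exprAC -[(2 : R) ^+ 2]natrX.
  rewrite /c !expnS !natrM; move: (pi : R) pi0 => p p0.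
  by field; rewrite gt_eqF.
apply/andP; split; last first.
  rewrite -(ler_pM2l c0) cE -sum_inv_sin2 /odd_zeta2_sum mulr_sumr.
  rewrite !big_nat; apply: ler_sum => k /andP[_ kn]; rewrite -angleE.
  have ab := angle_bound kn; case/andP: (ab) => a0 a1.
  have s0 : 0 < sin (angle n k) by apply: sin_gt0_pihalf; rewrite a0.
  rewrite lef_pV2 ?posrE ?exprn_gt0// ler_pXn2r ?nnegrE ?ltW//.
  exact: sin_lt_id.
rewrite -(ler_pM2l c0) mulrA cE.
have -> : 2 * 4 ^+ n * (1 - 2^-1 ^+ n.+1) = 2 * 4 ^+ n - (2 ^ n)%:R :> R.
  rewrite mulrBr mulr1; congr (_ - _).
  have -> : (4 : R) = 2 * 2 by rewrite -natrM.
  rewrite exprMn exprVn natrX exprS; field.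
  by rewrite expf_neq0// pnatr_eq0.
rewrite lerBlDr -sum_inv_sin2 /odd_zeta2_sum mulr_sumr.
have -> : (2 ^ n)%:R = \sum_(0 <= k < 2 ^ n) (1 : R).
  by rewrite sumr_const_nat subn0.
rewrite -big_split !big_nat; apply: ler_sum => k /andP[_ kn]; rewrite -angleE.
have ab := angle_bound kn; case/andP: (ab) => a0 a1.
have s0 : 0 < sin (angle n k) by apply: sin_gt0_pihalf; rewrite a0.
have co0 : 0 < cos (angle n k) by apply: cos_gt0_pihalf; rewrite a1 andbT; lra.
have := id_lt_tan ab; have := cos2Dsin2 (angle n k).
rewrite /tan; move: (angle n k) (sin _) (cos _) a0 s0 co0 => x s co x0 s0 co0 E.
rewrite ltr_pdivlMr// => xs.
have -> : (s ^+ 2)^-1 = (co / s) ^+ 2 + 1.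
  transitivity ((co ^+ 2 + s ^+ 2) / s ^+ 2); first by rewrite E mul1r.
  by field; rewrite gt_eqF.
rewrite lerD2r -exprVn ler_pXn2r ?nnegrE ?divr_ge0 ?invr_ge0 ?ltW//.
by rewrite ltr_pdivrMr// mulrC ltr_pdivlMr// mulrC.
Qed.

Lemma zeta2_sum_bounds n :
  pi ^+ 2 / 6 - pi ^+ 2 / 4 * 2^-1 ^+ n <= zeta2_sum (2 ^ n) <= pi ^+ 2 / 6.
Proof.
elim: n => [|n /andP[IH1 IH2]].
  rewrite expr0 /zeta2_sum big_ord1 expr1n invr1.
  by have := odd_zeta2_sum_bounds 0; rewrite /odd_zeta2_sum big_nat1 expr1n invr1 expr1; move: (pi ^+ 2) => p; lra.
have /andP [] := odd_zeta2_sum_bounds n.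
rewrite expnS mul2n zeta2_sum_double ![2^-1 ^+ n.+1]exprS.
move: (2^-1 ^+ n) (pi ^+ 2) IH1 IH2 => q p H1 H2 H3 H4.
by apply/andP; split; lra.
Qed.

End Basel.

(** * Integrands unbounded at the endpoints *)

Section ImproperFTC.
Local Open Scope classical_set_scope.
Local Open Scope ring_scope.
Variable R : realType.
Notation mu := (@lebesgue_measure R).

(** The open interval is exhausted by compact ones; nonnegativity allows monotone convergence, so
    integrability is a consequence and not an assumption. *)
Lemma ge0_FTC2_oo (f F : R -> R) (a b : R) : a < b ->
  {in `]a, b[, forall x, 0 <= f x} ->
  {in `]a, b[, continuous f} ->
  {in `]a, b[, forall x : R, is_derive x 1 F (f x)} ->
  F x @[x --> a^'+] --> F a -> F x @[x --> b^'-] --> F b ->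
  (\int[mu]_(x in `[a, b]) (f x)%:E = (F b - F a)%:E)%E.
Proof.
move=> ab f0 cf dF Fa Fb.
have mf : measurable_fun `]a, b[ f.
  apply: open_continuous_measurable_fun => // x; rewrite inE/=; exact: cf.
rewrite integral_itv_bndoo; last exact/measurable_EFinP.
(* The denominator starts at 3, so that already the first compact interval is nondegenerate. *)
pose e n : R := (b - a) / n.+3%:R.
have e0 n : 0 < e n by rewrite divr_gt0// subr_gt0.
have eab n : a + e n < b - e n.
  have : e n * n.+3%:R = b - a by rewrite divfK// pnatr_eq0.
  have := e0 n; have := ler0n R n; rewrite -addn3 natrD; nra.
have e_dec i j : (i <= j)%N -> e j <= e i.
  by move=> ij; rewrite /e ler_pM2l ?subr_gt0// lef_pV2 ?posrE// ler_nat.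
have e_cvg : e n @[n --> \oo] --> (0 : R).
  rewrite -[X in _ --> X](mulr0 (b - a)); apply: cvgMr.
  have := @cvg_harmonic R; rewrite -(cvg_shiftn 2) /harmonic.
  by under eq_fun do rewrite addn2.
have sub n : `[a + e n, b - e n] `<=` `]a, b[.
  move=> x /=; rewrite !in_itv/= => /andP[x1 x2].
  by have := e0 n; apply/implyP/implyP => ?; apply/andP; split; lra.
have -> : `]a, b[%classic = \bigcup_n `[a + e n, b - e n]%classic.
  apply/seteqP; split => [x /=|x [n _]]; last exact: sub.
  rewrite in_itv/= => /andP[ax xb].
  have m0 : 0 < Num.min (x - a) (b - x) by rewrite lt_min !subr_gt0 ax.
  have /cvgr0Pnorm_lt /(_ _ m0) [n _ /(_ n (leqnn n))] := e_cvg.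
  rewrite /= gtr0_norm// lt_min => /andP[n1 n2]; exists n => //=.
  by rewrite in_itv/=; apply/andP; split; lra.
suff H : (\int[mu]_(x in `[(a + e n)%R, (b - e n)%R]) (f x)%:E @[n --> \oo]
    --> (F b - F a)%:E)%E.
  rewrite -(cvg_lim _ H)//; apply/esym/cvg_lim => //.
  apply: ge0_nondecreasing_set_cvg_integral => //.
  - move=> i j ij; rewrite subsetEset => x /=; rewrite !in_itv/= => /andP[x1 x2].
    by have := e_dec _ _ ij; apply/implyP/implyP => ?; apply/andP; split; lra.
  - by move=> n; apply/measurable_EFinP; apply: measurable_funS mf.
  - by move=> n x /sub xab; rewrite lee_fin; exact: f0.
have E (n : nat) : (\int[mu]_(x in `[(a + e n)%R, (b - e n)%R]) (f x)%:E =
    (F (b - e n) - F (a + e n))%:E)%E.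
  rewrite (@continuous_FTC2 _ f F)//.
  + apply: continuous_in_subspaceT => x; rewrite inE/= => /sub xab; exact: cf.
  + have dFn x : x \in `[a + e n, b - e n] -> derivable F x 1.
      by move=> /sub xab; apply: ex_derive; exact: dF.
    have : {within `[(a + e n)%R, (b - e n)%R], continuous F}.
      exact: derivable_within_continuous.
    move=> /(continuous_within_itvP _ (eab n))[_ ? ?]; split=> // x.
    by move=> /subset_itv_oo_cc; exact: dFn.
  + move=> x /subset_itv_oo_cc/sub /= xab; rewrite derive1E; apply: derive_val; exact: dF.
rewrite (eq_cvg _ _ E).
apply: cvg_EFin; first exact: nearW.
apply: cvgB.
+ move/cvg_at_leftP : Fb; apply; split=> [n|]; first by rewrite gtrBl.
  by rewrite -[X in _ --> X]subr0; apply: cvgB => //; exact: cvg_cst.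
+ move/cvg_at_rightP : Fa; apply; split=> [n|]; first by rewrite ltrDl.
  by rewrite -[X in _ --> X]addr0; apply: cvgD => //; exact: cvg_cst.
Qed.

End ImproperFTC.

(** * The power series of the logarithm and zeta(2) *)

Section Dilogarithm.
Local Open Scope classical_set_scope.
Local Open Scope ring_scope.
Variable R : realType.
Implicit Types (x y : R).

Lemma is_derive1_mul (f g : R -> R) x df dg :
  is_derive x 1 f df -> is_derive x 1 g dg ->
  is_derive x 1 (fun t => f t * g t) (f x * dg + df * g x).
Proof.
move=> Hf Hg; have H := is_deriveM Hf Hg.
by apply: (is_derive_eq H); rewrite /GRing.scale/= [g x * df]mulrC.
Qed.

Lemma is_derive1_scale (f : R -> R) x df k :
  is_derive x 1 f df -> is_derive x 1 (fun t => k * f t) (k * df).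
Proof. by move=> Hf; exact: (is_deriveZ k Hf). Qed.

Lemma is_derive_exprn n x : is_derive x 1 (fun t : R => t ^+ n) (n%:R * x ^+ n.-1).
Proof.
have H := is_deriveX n (is_derive_id x (1 : R)).
have E : (fun t : R => t ^+ n) = id ^+ n by apply/funext => t; rewrite fctE.
by rewrite E; apply: (is_derive_eq H); rewrite /GRing.scale/= mulr1.
Qed.

Lemma is_derive_1B y : is_derive y 1 (fun t : R => 1 - t) (-1).
Proof.
have H := is_deriveB (is_derive_cst (1 : R) y 1) (is_derive_id y 1).
by apply: (is_derive_eq H); rewrite sub0r.
Qed.

Lemma is_derive_ln1B y : y < 1 -> is_derive y 1 (fun t => ln (1 - t)) (- (1 - y)^-1).
Proof.
move=> y1; have d1 : is_derive (1 - y : R) 1 (@ln R) (1 - y)^-1.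
  by apply: is_derive1_ln; rewrite subr_gt0.
have := @is_derive1_comp R (@ln R) (fun t => 1 - t) y _ _ d1 (is_derive_1B y).
by rewrite mulrN1.
Qed.

Lemma is_derive_ln1B_poly n y :
  is_derive y 1 (fun t => \sum_(k < n) t ^+ k.+1 / k.+1%:R) (\sum_(k < n) y ^+ k).
Proof.
elim: n => [|n IH].
  under eq_fun do rewrite big_ord0.
  by rewrite big_ord0; exact: is_derive_cst.
under eq_fun do rewrite big_ord_recr /=.
rewrite big_ord_recr/=; apply: (is_deriveD IH).
under eq_fun do rewrite mulrC.
apply: (is_derive_eq (is_derive1_scale n.+1%:R^-1 (is_derive_exprn n.+1 y))).
by rewrite mulrA mulVf ?mul1r// pnatr_eq0.
Qed.

Lemma geometric_rem n y : y != 1 ->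
  y ^+ n / (1 - y) = (1 - y)^-1 - \sum_(k < n) y ^+ k.
Proof.
move=> y1; have yn : 1 - y != 0 by rewrite subr_eq0 eq_sym.
elim: n => [|n IH]; first by rewrite big_ord0 subr0 div1r.
by rewrite big_ord_recr/= opprD addrA -IH exprS; field.
Qed.

(** The remainder has derivative [t^n / (1 - t)], so the mean value theorem applies. The case
    [n = 0] is reused as a crude bound on [ln (1 - x)] near 0. *)
Lemma ln1B_series_rem n y : 0 <= y < 1 ->
  0 <= - ln (1 - y) - \sum_(k < n) y ^+ k.+1 / k.+1%:R <= y ^+ n.+1 / (1 - y).
Proof.
case/andP; rewrite le_eqVlt => /predU1P[<- _|y0 y1].
  rewrite subr0 ln1 oppr0 big1 ?subr0 ?expr0n/= ?mul0r ?lexx//.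
  by move=> k _; rewrite expr0n mul0r.
pose f t : R := - ln (1 - t) - \sum_(k < n) t ^+ k.+1 / k.+1%:R.
have df (t : R) : t < 1 -> is_derive t 1 f (t ^+ n / (1 - t)).
  move=> t1; rewrite geometric_rem ?lt_eqF// -[X in X - _]opprK.
  have d1 := is_derive_ln1B t1.
  have d2 := is_derive_ln1B_poly n t.
  by apply: is_deriveB.
have [| |c] := @MVT R f (fun t => t ^+ n / (1 - t)) 0 y y0.
- by move=> c; rewrite in_itv/= => /andP[_ cy]; apply: df; exact: lt_trans y1.
- apply: derivable_within_continuous => c; rewrite in_itv/= => /andP[_ cy].
  by apply: ex_derive; apply: df; exact: le_lt_trans y1.
rewrite in_itv/= => /andP[c0 cy].
have -> : f 0 = 0.
  by rewrite /f subr0 ln1 oppr0 big1 ?subr0// => k _; rewrite expr0n mul0r.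
rewrite !subr0 -/(f y) => ->.
have c1 : 0 < 1 - c by rewrite subr_gt0 (lt_trans cy).
have y1' : 0 < 1 - y by rewrite subr_gt0.
rewrite mulr_ge0 ?divr_ge0 ?exprn_ge0 ?(ltW c0) ?(ltW c1) ?(ltW y0)//=.
rewrite exprSr [leRHS]mulrAC ler_pM2r//.
rewrite ler_pM ?exprn_ge0 ?invr_ge0 ?(ltW c0) ?(ltW c1)//.
  by rewrite lerXn2r ?nnegrE ?(ltW c0) ?(ltW y0) ?(ltW cy).
by rewrite lef_pV2 ?posrE// lerD2l lerN2 ltW.
Qed.

Definition li2' y : R := - (ln (1 - y) / y).

Lemma ln1B_series y : 0 < y < 1 ->
  (\sum_(0 <= k <oo) (y ^+ k / k.+1%:R)%:E = (li2' y)%:E)%E.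
Proof.
case/andP=> y0 y1; apply/cvg_lim => //.
rewrite (_ : (fun n => _) = EFin \o (fun n => \sum_(0 <= k < n) (y ^+ k / k.+1%:R))); last first.
  by apply/funext => n /=; rewrite -sumEFin.
apply: cvg_EFin; first exact: nearW.
apply/cvgrPdist_le => /= e e0.
have : (y ^+ n / (1 - y)) @[n --> \oo] --> (0 : R).
  rewrite -[X in _ --> X](mul0r (1 - y)^-1); apply: cvgMl.
  by apply: cvg_expr; rewrite gtr0_norm.
move=> /cvgr0Pnorm_le /(_ _ e0)[N _ HN]; exists N => // n /= /HN /=.
apply: le_trans.
have /andP[h1 h2] := @ln1B_series_rem n y (introT andP (conj (ltW y0) y1)).
have -> : li2' y - \sum_(0 <= k < n) y ^+ k / k.+1%:R =
  (- ln (1 - y) - \sum_(k < n) y ^+ k.+1 / k.+1%:R) / y.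
  rewrite mulrBl mulr_suml big_mkord /li2' mulNr; congr (_ - _).
  by apply: eq_bigr => k _; rewrite exprSr mulrAC mulfK ?gt_eqF.
rewrite ger0_norm ?divr_ge0 ?(ltW y0)// ger0_norm; last first.
  by rewrite divr_ge0 ?exprn_ge0 ?subr_ge0 ?ltW.
by rewrite ler_pdivrMr// mulrAC -exprSr.
Qed.

Lemma zeta2_series : (\sum_(0 <= k <oo) ((k.+1%:R ^+ 2)^-1)%:E = (pi ^+ 2 / 6 : R)%:E)%E.
Proof.
apply/cvg_lim => //.
rewrite (_ : (fun n => _) = EFin \o (@zeta2_sum R)); last first.
  by apply/funext => n /=; rewrite /zeta2_sum -(big_mkord xpredT (fun k => (k.+1%:R ^+ 2)^-1)) -sumEFin.
apply: cvg_EFin; first exact: nearW.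
have zS m n : (m <= n)%N -> zeta2_sum R m <= zeta2_sum R n.
  elim: n => [|n IH]; first by rewrite leqn0 => /eqP ->.
  rewrite leq_eqVlt => /predU1P[->//|/IH]; move=> /le_trans; apply.
  by rewrite zeta2_sumS lerDl invr_ge0 exprn_ge0.
apply/cvgrPdist_le => /= e e0.
have : (pi ^+ 2 / 4 * 2^-1 ^+ n) @[n --> \oo] --> (0 : R).
  rewrite -[X in _ --> X](mulr0 (pi ^+ 2 / 4)); apply: cvgMr.
  by apply: cvg_expr; rewrite ger0_norm// invf_lt1// ltr1n.
move=> /cvgr0Pnorm_le /(_ _ e0)[N _ /(_ N (leqnn N)) /= HN].
exists (2 ^ N)%N => // n /= nN.
have /andP[h1 h2] := zeta2_sum_bounds R N.
have n2 : zeta2_sum R n <= pi ^+ 2 / 6.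
  apply: le_trans (_ : zeta2_sum R (2 ^ n) <= _).
    by apply: zS; rewrite ltnW// ltn_expl.
  by have /andP[] := zeta2_sum_bounds R n.
rewrite ger0_norm ?subr_ge0//; apply: le_trans HN.
apply: le_trans (ler_norm _); have := zS _ _ nN.
move: h1; set q := pi ^+ 2 / 4 * _; set p := pi ^+ 2 / 6; lra.
Qed.

End Dilogarithm.

(** * Integrals over the unit interval *)

Section DilogarithmIntegrals.
Local Open Scope classical_set_scope.
Local Open Scope ring_scope.
Variable R : realType.
Notation mu := (@lebesgue_measure R).
Notation li2' := (@li2' R).
Implicit Types (x y : R).

Lemma continuous_li2' y : 0 < y < 1 -> {for y, continuous li2'}.
Proof.
move=> /andP[y0 y1]; apply: differentiable_continuous; apply/derivable1_diffP.
apply: ex_derive; rewrite /li2'.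
have H := is_derive1_mul (is_derive_ln1B y1) (is_deriveV (lt0r_neq0 y0) (is_derive_id y 1)).
exact: (is_deriveN H).
Qed.

Lemma li2'_ge0 y : 0 < y < 1 -> 0 <= li2' y.
Proof.
move=> /andP[y0 y1]; rewrite /li2' -mulNr divr_ge0 ?(ltW y0)// oppr_ge0 ln_le0//.
by rewrite gerBl ltW.
Qed.

Lemma measurable_li2' : measurable_fun (`]0, 1[%classic : set R) li2'.
Proof.
apply: open_continuous_measurable_fun => // x; rewrite inE/= in_itv/=.
exact: continuous_li2'.
Qed.

Lemma integral_exprn_div k :
  (\int[mu]_(y in `]0%R, 1%R[) (y ^+ k / k.+1%:R)%:E = ((k.+1%:R ^+ 2)^-1)%:E)%E.
Proof.
have ck : continuous (fun y : R => y ^+ k / k.+1%:R).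
  by move=> y; apply: cvgMl; exact: exprn_continuous.
rewrite -(@integral_itv_bndoo R 0 1 _ true false); last first.
  apply/measurable_EFinP; apply: measurable_funTS.
  exact: continuous_measurable_fun.
have cF : continuous (fun y : R => (k.+1%:R ^+ 2)^-1 * y ^+ k.+1).
  by move=> y; apply: cvgMr; exact: exprn_continuous.
rewrite (@ge0_FTC2_oo R _ (fun y : R => (k.+1%:R ^+ 2)^-1 * y ^+ k.+1))//.
- by rewrite expr1n expr0n mulr1 mulr0 subr0.
- by move=> y; rewrite in_itv/= => /andP[y0 _]; rewrite divr_ge0 ?exprn_ge0 ?ltW.
- move=> y _.
  apply: (is_derive_eq (is_derive1_scale _ (is_derive_exprn k.+1 y))) => /=.
  by field; rewrite addrC natr1 pnatr_eq0.
- exact/cvg_at_right_filter/cF.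
- exact/cvg_at_left_filter/cF.
Qed.

(** The series of the integrand has nonnegative terms and can be integrated termwise, which gives
    zeta(2). *)
Lemma integral_li2' : (\int[mu]_(y in `[0%R, 1%R]) (li2' y)%:E = (pi ^+ 2 / 6)%:E)%E.
Proof.
rewrite integral_itv_bndoo; last first.
  by apply/measurable_EFinP; apply: measurable_li2'.
transitivity (\int[mu]_(y in `]0%R, 1%R[) (\sum_(0 <= k <oo) (y ^+ k / k.+1%:R)%:E))%E.
  apply: eq_integral => y; rewrite inE/= in_itv/= => y01.
  by rewrite ln1B_series.
rewrite integral_nneseries//=.
- under eq_eseriesr do rewrite integral_exprn_div.
  exact: zeta2_series.
- move=> k; apply/measurable_EFinP; apply: measurable_funTS.
  apply: continuous_measurable_fun => y.
  by apply: cvgMl; exact: exprn_continuous.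
- move=> k y; rewrite in_itv/= => /andP[y0 _].
  by rewrite lee_fin divr_ge0 ?exprn_ge0 ?ltW.
Qed.

Lemma integrable_li2' : mu.-integrable `[0%R, 1%R] (EFin \o li2').
Proof.
have m : measurable_fun (`[0, 1]%classic : set R) (EFin \o li2').
  apply/measurable_EFinP; apply/measurable_fun_itv_bndo_bndcP.
  by apply/measurable_fun_itv_obnd_cbndP; exact: measurable_li2'.
apply/integrableP; split => //.
rewrite [ltLHS](_ : _ = (pi ^+ 2 / 6)%:E)%E ?ltry// -integral_li2'.
rewrite integral_itv_bndoo; last first.
  by apply: measurableT_comp => //; apply/measurable_EFinP; apply: measurable_li2'.
rewrite [RHS]integral_itv_bndoo; last by apply/measurable_EFinP; apply: measurable_li2'.
apply: eq_integral => y; rewrite inE/= in_itv/= => y01.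
by rewrite ger0_norm// li2'_ge0.
Qed.

Definition li2 x : R := \int[mu]_(y in `[0, x]) li2' y.

Lemma is_derive_li2 x : 0 < x < 1 -> is_derive x 1 li2 (li2' x).
Proof.
move=> x01; have /andP[x0 x1] := x01.
have [d1 d2] := @continuous_FTC1_closed R li2' 0 x 1 x1 integrable_li2' x0 (continuous_li2' x01).
by rewrite -d2 derive1E; exact: derivableP.
Qed.

Lemma li2_1 : li2 1 = pi ^+ 2 / 6.
Proof. by rewrite /li2 /Rintegral integral_li2'. Qed.

Lemma cvg_li2_0 : li2 x @[x --> 0^'+] --> li2 0.
Proof.
have := @parameterized_integral_continuous R 0 1 li2' ler01 integrable_li2'.
by move=> /(continuous_within_itvP _ ltr01)[].
Qed.

Lemma cvg_li2_1 : li2 x @[x --> 1^'-] --> li2 1.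
Proof.
have := @parameterized_integral_continuous R 0 1 li2' ler01 integrable_li2'.
by move=> /(continuous_within_itvP _ ltr01)[].
Qed.

Lemma ln_mul_ln1B_small e : 0 < e ->
  exists2 d : R, 0 < d & forall x, 0 < x < d -> `|ln x * ln (1 - x)| <= e.
Proof.
(* For [x < 1/2] the two factors are at most [2 / sqrt x] and [2 x] in absolute value, so the
   product is at most [4 sqrt x]. *)
move=> e0; exists (Num.min 2^-1 ((e / 4) ^+ 2)).
  by rewrite lt_min invr_gt0 ltr0n exprn_gt0// divr_gt0.
move=> x /andP[x0]; rewrite lt_min => /andP[x2 xe].
have x1 : x < 1 by lra.
have := @ln1B_series_rem R 0 x; rewrite big_ord0 subr0 expr1 ltW//= => /(_ x1)/andP[l1 l2].
have l3 : - ln (1 - x) <= 2 * x.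
  apply: le_trans l2 _; rewrite ler_pdivrMr ?subr_gt0//; nra.
pose s := Num.sqrt x.
have s0 : 0 < s by rewrite sqrtr_gt0.
have xE : x = s ^+ 2 by rewrite sqr_sqrtr// ltW.
have se : s <= e / 4.
  rewrite -(@ler_pXn2r _ 2) ?nnegrE ?(ltW s0)// ?divr_ge0 ?(ltW e0)//.
  by rewrite -xE ltW.
have lx : - ln x <= 2 * s^-1.
  have := ln_sublinear (_ : 0 < s^-1); rewrite invr_gt0 => /(_ s0).
  by rewrite lnV ?posrE// xE lnXn//; lra.
have lx0 : 0 <= - ln x by rewrite oppr_ge0 ln_le0// ltW.
rewrite -mulrNN ger0_norm ?mulr_ge0//.
apply: le_trans (_ : (2 * s^-1) * (2 * x) <= e); first exact: ler_pM.
rewrite xE; have -> : 2 * s^-1 * (2 * s ^+ 2) = 4 * s by field; rewrite gt_eqF.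
lra.
Qed.

Definition rogers' y : R := - 2^-1 * (ln (1 - y) / y + ln y / (1 - y)).

Lemma is_derive_rogers_primitive x : 0 < x < 1 ->
  is_derive x 1 (fun t => li2 t + 2^-1 * (ln t * ln (1 - t))) (rogers' x).
Proof.
move=> x01; have /andP[x0 x1] := x01.
have H1 := is_derive1_mul (is_derive1_ln x0) (is_derive_ln1B x1).
have H := is_deriveD (is_derive_li2 x01) (is_derive1_scale 2^-1 H1).
apply: (is_derive_eq H); rewrite /li2' /rogers'.
by field; rewrite subr_eq0 gt_eqF// gt_eqF.
Qed.

Lemma continuous_rogers' y : 0 < y < 1 -> {for y, continuous rogers'}.
Proof.
move=> /andP[y0 y1]; apply: differentiable_continuous; apply/derivable1_diffP.
apply: ex_derive; rewrite /rogers'.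
have y1' : 1 - y != 0 by rewrite subr_eq0 gt_eqF.
have H1 := is_derive1_mul (is_derive_ln1B y1) (is_deriveV (lt0r_neq0 y0) (is_derive_id y 1)).
have H2 := is_derive1_mul (is_derive1_ln y0) (@is_deriveV R (fun t => 1 - t) y (-1) 1 y1' (is_derive_1B y)).
exact: (is_derive1_scale (- 2^-1) (is_deriveD H1 H2)).
Qed.

Lemma rogers'_ge0 y : 0 < y < 1 -> 0 <= rogers' y.
Proof.
move=> /andP[y0 y1]; rewrite /rogers' mulNr -mulrN mulr_ge0// opprD addr_ge0//.
  by rewrite -mulNr divr_ge0 ?(ltW y0)// oppr_ge0 ln_le0// gerBl ltW.
by rewrite -mulNr divr_ge0 ?subr_ge0 ?(ltW y1)// oppr_ge0 ln_le0// ltW.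
Qed.

Lemma measurable_rogers' : measurable_fun (`]0, 1[%classic : set R) rogers'.
Proof.
apply: open_continuous_measurable_fun => // x; rewrite inE/= in_itv/=.
exact: continuous_rogers'.
Qed.

(** The integrand differs from [li2'] by the derivative of [ln t * ln (1 - t) / 2], which tends to 0
    at both ends. *)
Lemma integral_rogers' : (\int[mu]_(y in `[0%R, 1%R]) (rogers' y)%:E = (pi ^+ 2 / 6)%:E)%E.
Proof.
pose k t : R := 2^-1 * (ln t * ln (1 - t)).
have k_small e : 0 < e -> exists2 d : R, 0 < d & forall x, 0 < x < d -> `|k x| <= e.
  move=> e0; have [d d0 Hd] := ln_mul_ln1B_small e0.
  exists d => // x /Hd; apply: le_trans; rewrite /k normrM ger0_norm//.
  by rewrite ler_piMl// invf_le1// ler1n.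
have kV x : k (1 - x) = k x by rewrite /k subKr mulrC [ln x * _]mulrC mulrC.
rewrite (@ge0_FTC2_oo R _ (fun t => li2 t + k t))//.
- rewrite /k ln1 mul0r mulr0 addr0 subr0 ln1 mulr0 mulr0 addr0 li2_1.
  by rewrite /li2 set_itv1 Rintegral_set1 subr0.
- by move=> x; rewrite in_itv/=; exact: rogers'_ge0.
- by move=> x; rewrite in_itv/=; exact: continuous_rogers'.
- by move=> x; rewrite in_itv/=; exact: is_derive_rogers_primitive.
- apply: cvgD; first exact: cvg_li2_0.
  have -> : k 0 = 0 by rewrite /k subr0 ln1 !mulr0.
  apply/cvgr0Pnorm_le => e /k_small[d d0 kd]; near=> x; apply: kd.
  by apply/andP; split; near: x; [exact: nbhs_right_gt|exact: nbhs_right_lt].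
- apply: cvgD; first exact: cvg_li2_1.
  have -> : k 1 = 0 by rewrite /k ln1 mul0r mulr0.
  apply/cvgr0Pnorm_le => e /k_small[d d0 kd]; near=> x; rewrite -kV; apply: kd.
  rewrite subr_gt0 ltrBlDr -ltrBlDl.
  by apply/andP; split; near: x; [exact: nbhs_left_lt|apply: nbhs_left_gt; rewrite gtrBl].
Unshelve. all: by end_near. Qed.

Lemma integrable_rogers' : mu.-integrable `[0%R, 1%R] (EFin \o rogers').
Proof.
have m : measurable_fun (`[0, 1]%classic : set R) (EFin \o rogers').
  apply/measurable_EFinP; apply/measurable_fun_itv_bndo_bndcP.
  by apply/measurable_fun_itv_obnd_cbndP; exact: measurable_rogers'.
apply/integrableP; split => //.
rewrite [ltLHS](_ : _ = (pi ^+ 2 / 6)%:E)%E ?ltry// -integral_rogers'.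
rewrite integral_itv_bndoo; last first.
  by apply: measurableT_comp => //; apply/measurable_EFinP; apply: measurable_rogers'.
rewrite [RHS]integral_itv_bndoo; last by apply/measurable_EFinP; apply: measurable_rogers'.
apply: eq_integral => y; rewrite inE/= in_itv/= => y01.
by rewrite ger0_norm// rogers'_ge0.
Qed.

End DilogarithmIntegrals.

(** * Derivative, continuity and reflection formula of the Rogers dilogarithm *)

Section RogersL.
Local Open Scope classical_set_scope.
Local Open Scope ring_scope.
Variable R : realType.
Notation mu := (@lebesgue_measure R).
Notation rogers' := (@rogers' R).
Notation L := (@rogersL R).
Implicit Types (x y : R).

Lemma rogersLE x : x <= 1 -> L x = \int[mu]_(y in `[0, x]) rogers' y.
Proof.
move=> x1; rewrite /rogersL.
have i : mu.-integrable `[0, x] (EFin \o rogers').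
  apply: integrableS (integrable_rogers' R) => //; exact: subset_itvl.
transitivity (- 2^-1 * \int[mu]_(y in `[0, x]) (- 2 * rogers' y)).
  congr (_ * _); apply: eq_Rintegral => y _.
  by rewrite /rogers' mulrA mulrNN divff ?mul1r// pnatr_eq0.
rewrite RintegralZl//; by field.
Qed.

(** The integration interval is empty or a point. This extension makes [L] continuous at 0 from both
    sides, so continuity at 0 composes without one-sided limits. *)
Lemma rogersL_le0 x : x <= 0 -> L x = 0.
Proof.
rewrite le_eqVlt => /predU1P[->|x0].
  by rewrite rogersLE// set_itv1 Rintegral_set1.
rewrite rogersLE ?(le_trans (ltW x0))// set_itv_ge ?Rintegral_set0//.
by rewrite bnd_simp -ltNge.
Qed.

Lemma rogersL1 : L 1 = pi ^+ 2 / 6.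
Proof. by rewrite rogersLE// /Rintegral integral_rogers'. Qed.

Lemma is_derive_rogersL x : 0 < x < 1 -> is_derive x 1 L (rogers' x).
Proof.
move=> x01; have /andP[x0 x1] := x01.
have [d1 d2] := @continuous_FTC1_closed R rogers' 0 x 1 x1 (integrable_rogers' R) x0 (continuous_rogers' x01).
have H : is_derive x 1 (fun t => \int[mu]_(y in `[0, t]) rogers' y) (rogers' x).
  by rewrite -d2 derive1E; exact: derivableP.
apply: near_eq_is_derive H; near=> t.
by rewrite rogersLE//; near: t; exact: lt_le_nbhsl.
Unshelve. all: by end_near. Qed.

Let within_rogersL : {within `[0, 1], continuous (fun x => \int[mu]_(y in `[0, x]) rogers' y)}.
Proof. exact: (parameterized_integral_continuous ler01 (integrable_rogers' R)). Qed.

Lemma cvg_rogersL_1 : L x @[x --> 1^'-] --> L 1.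
Proof.
have /(continuous_within_itvP _ ltr01)[_ _] := within_rogersL.
rewrite -rogersLE//; apply: cvg_trans; apply: near_eq_cvg; near=> x.
by rewrite rogersLE.
Unshelve. all: by end_near. Qed.

Lemma continuous_rogersL x : x < 1 -> {for x, continuous L}.
Proof.
move=> x1; have [x0|x0|<-] := ltgtP 0 x.
- apply: differentiable_continuous; apply/derivable1_diffP.
  by apply: ex_derive; apply: is_derive_rogersL; rewrite x0.
- rewrite /prop_for /continuous_at (rogersL_le0 (ltW x0)).
  apply: cvg_near_cst; near=> t; apply/eqP; rewrite rogersL_le0//.
  by near: t; exact: lt_le_nbhsl.
- rewrite /prop_for /continuous_at; apply/left_right_continuousP; split.
    rewrite rogersL_le0//; apply: cvg_near_cst; near=> t; apply/eqP.
    by rewrite rogersL_le0//; near: t; exact: nbhs_left_le.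
  have /(continuous_within_itvP _ ltr01)[_ + _] := within_rogersL.
  rewrite -rogersLE//; apply: cvg_trans; apply: near_eq_cvg; near=> t.
  by rewrite rogersLE//; near: t; exact: nbhs_right_le.
Unshelve. all: by end_near. Qed.

Lemma rogers'_onem y : rogers' (1 - y) = rogers' y.
Proof. by rewrite /rogers' subKr addrC. Qed.

Lemma rogersL_reflect x : 0 <= x <= 1 -> L x + L (1 - x) = pi ^+ 2 / 6.
Proof.
wlog x1 : x / x < 1.
  move=> H /andP[x0]; rewrite le_eqVlt => /predU1P[->|x1]; last first.
    by apply: H => //; rewrite x0 ltW.
  by rewrite subrr (rogersL_le0 (lexx _)) addr0 rogersL1.
case/andP=> + _; rewrite le_eqVlt => /predU1P[<-|x0].
  by rewrite subr0 (rogersL_le0 (lexx _)) add0r rogersL1.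
pose f t : R := L t + L (1 - t).
have df (t : R) : 0 < t < 1 -> is_derive t 1 f 0.
  move=> t01; have /andP[t0 t1] := t01.
  have t01' : 0 < 1 - t < 1 by rewrite subr_gt0 t1 gtrBl.
  have H := @is_derive1_comp R L (fun t => 1 - t) t _ _ (is_derive_rogersL t01') (is_derive_1B t).
  by apply: (is_derive_eq (is_deriveD (is_derive_rogersL t01) H)); rewrite rogers'_onem mulrN1 subrr.
have f0 : f 0 = pi ^+ 2 / 6.
  by rewrite /f subr0 (rogersL_le0 (lexx _)) add0r rogersL1.
have [| |c] := @MVT R f (cst 0) 0 x x0.
- by move=> t; rewrite in_itv/= => /andP[t0 tx]; apply: df; rewrite t0 (lt_trans tx).
- apply/(continuous_within_itvP _ x0); split.
  + move=> t; rewrite in_itv/= => /andP[t0 tx].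
    apply: differentiable_continuous; apply/derivable1_diffP.
    by apply: ex_derive; apply: df; rewrite t0 (lt_trans tx).
  + apply: cvgD.
      by apply/cvg_at_right_filter; exact: continuous_rogersL.
    rewrite subr0; apply/cvgrPdist_le => e e0.
    have /cvgrPdist_le /(_ _ e0) := cvg_rogersL_1.
    move=> [d /= d0 Hd]; near=> t; apply: Hd => /=.
      rewrite subKr ger0_norm; last by near: t; exact: nbhs_right_ge.
      by near: t; exact: nbhs_right_lt.
    by rewrite gtrBl; near: t; exact: nbhs_right_gt.
  + apply/cvg_at_left_filter; apply: differentiable_continuous; apply/derivable1_diffP.
    by apply: ex_derive; apply: df; rewrite x0.
- by move=> _ /eqP; rewrite mul0r subr_eq0 => /eqP; rewrite f0.
Unshelve. all: by end_near. Qed.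

End RogersL.

(** * The five-term relation *)

Section FiveTerm.
Local Open Scope classical_set_scope.
Local Open Scope ring_scope.
Variable R : realType.
Notation rogers' := (@rogers' R).
Notation L := (@rogersL R).
Implicit Types (x y : R).

Lemma is_derive_continuous (f : R -> R) x df :
  is_derive x 1 f df -> {for x, continuous f}.
Proof.
move=> H; apply: differentiable_continuous; apply/derivable1_diffP.
exact: ex_derive.
Qed.

Lemma continuous_rogersL_comp (g : R -> R) x dg :
  is_derive x 1 g dg -> g x < 1 -> {for x, continuous (fun t => L (g t))}.
Proof.
move=> H g1; apply: (@continuous_comp _ _ _ g L).
  exact: is_derive_continuous H.
exact: continuous_rogersL.
Qed.

Lemma is_derive_rogersL_comp (g : R -> R) x dg :
  is_derive x 1 g dg -> 0 < g x < 1 ->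
  is_derive x 1 (fun t => L (g t)) (rogers' (g x) * dg).
Proof.
move=> H g1; exact: (@is_derive1_comp R L g x _ _ (is_derive_rogersL g1) H).
Qed.

Lemma is_derive1_div (f g : R -> R) x df dg : g x != 0 ->
  is_derive x 1 f df -> is_derive x 1 g dg ->
  is_derive x 1 (fun t => f t / g t) ((df * g x - f x * dg) / g x ^+ 2).
Proof.
move=> g0 Hf Hg.
apply: (is_derive_eq (is_derive1_mul Hf (is_deriveV g0 Hg))).
by rewrite /GRing.scale/=; field.
Qed.

Section FixedY.
Variable y : R.
Hypothesis y01 : 0 < y < 1.

Let u t := t * y.
Let v t := t * (1 - y) / (1 - t * y).
Let w t := y * (1 - t) / (1 - t * y).

Let is_derive_u (t : R) : is_derive t 1 u y.
Proof.
have H := is_derive1_mul (is_derive_id t (1 : R)) (is_derive_cst y t (1 : R)).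
by apply: (is_derive_eq H); rewrite mulr0 add0r mul1r.
Qed.

Let is_derive_1u (t : R) : is_derive t 1 (fun t => 1 - t * y) (- y).
Proof.
have H := is_deriveB (is_derive_cst (1 : R) t (1 : R)) (is_derive_u t).
by apply: (is_derive_eq H); rewrite sub0r.
Qed.

Let is_derive_v (t : R) : 1 - t * y != 0 ->
  is_derive t 1 v ((1 - y) / (1 - t * y) ^+ 2).
Proof.
move=> ty.
have H := is_derive1_mul (is_derive_id t (1 : R)) (is_derive_cst (1 - y) t (1 : R)).
apply: (is_derive_eq (@is_derive1_div (fun s => s * (1 - y)) (fun s => 1 - s * y) t _ _ ty H (is_derive_1u t))).
by rewrite /=; field.
Qed.

Let is_derive_w (t : R) : 1 - t * y != 0 ->
  is_derive t 1 w (- (y * (1 - y)) / (1 - t * y) ^+ 2).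
Proof.
move=> ty.
apply: (is_derive_eq (@is_derive1_div (fun s => y * (1 - s)) (fun s => 1 - s * y) t _ _ ty (is_derive1_scale y (is_derive_1B t)) (is_derive_1u t))).
by rewrite /=; field.
Qed.

Let f t := L t + L y - L (u t) - L (v t) - L (w t).

Let is_derive_f (t : R) : 0 < t < 1 -> is_derive t 1 f 0.
Proof.
move=> t01; have /andP[t0 t1] := t01; have /andP[y0 y1] := y01.
have ty : 0 < 1 - t * y by nra.
have ty0 : 1 - t * y != 0 by rewrite gt_eqF.
have u01 : 0 < u t < 1 by rewrite /u; apply/andP; split; nra.
have v01 : 0 < v t < 1.
  apply/andP; split; last by rewrite /v ltr_pdivrMr//; nra.
  by rewrite /v divr_gt0// mulr_gt0// subr_gt0.
have w01 : 0 < w t < 1.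
  apply/andP; split; last by rewrite /w ltr_pdivrMr//; nra.
  by rewrite /w divr_gt0// mulr_gt0// subr_gt0.
have Hu := is_derive_rogersL_comp (is_derive_u t) u01.
have Hv := is_derive_rogersL_comp (is_derive_v ty0) v01.
have Hw := is_derive_rogersL_comp (is_derive_w ty0) w01.
have Hc := is_deriveD (is_derive_rogersL t01) (is_derive_cst (L y) t (1 : R)).
apply: (is_derive_eq (is_deriveB (is_deriveB (is_deriveB Hc Hu) Hv) Hw)).
have p1 : 0 < 1 - t by rewrite subr_gt0.
have p2 : 0 < 1 - y by rewrite subr_gt0.
(* Since [1 - v] and [1 - w] factor as well, all logarithms split into the same five, whose
   coefficients cancel as rational functions. *)
have vE : 1 - v t = (1 - t) / (1 - t * y) by rewrite /v; field.
have wE : 1 - w t = (1 - y) / (1 - t * y) by rewrite /w; field.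
rewrite /rogers' vE wE /u /v /w.
rewrite !ln_div ?posrE ?mulr_gt0// !lnM ?posrE//.
move: (ln t) (ln y) (ln (1 - t)) (ln (1 - y)) (ln (1 - t * y)) => a b c d e.
by field; rewrite !gt_eqF.
Qed.

(** For fixed [y] the difference of the two sides has derivative 0 in [x], and it vanishes at
    [x = 0], where the last argument becomes [y]. *)
Lemma rogersL_five_term x : 0 < x < 1 ->
  L x + L y =
  L (x * y) + L (x * (1 - y) / (1 - x * y)) + L (y * (1 - x) / (1 - x * y)).
Proof.
move=> x01; have /andP[x0 x1] := x01; have /andP[y0 y1] := y01.
have [| |c] := @MVT R f (cst 0) 0 x x0.
- move=> t; rewrite in_itv/= => /andP[t0 tx]; apply: is_derive_f.
  by rewrite t0 (lt_trans tx).
- apply: continuous_in_subspaceT => t; rewrite inE/= in_itv/= => /andP[t0 tx].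
  have t1 : t < 1 by exact: le_lt_trans x1.
  have ty : 0 < 1 - t * y by nra.
  have ty0 : 1 - t * y != 0 by rewrite gt_eqF.
  have Cu := continuous_rogersL_comp (is_derive_u t).
  have Cv := continuous_rogersL_comp (is_derive_v ty0).
  have Cw := continuous_rogersL_comp (is_derive_w ty0).
  apply: cvgB; [apply: cvgB; [apply: cvgB; [apply: cvgD|]|]|].
  + exact: continuous_rogersL.
  + exact: cvg_cst.
  + by apply: Cu; rewrite /u; nra.
  + by apply: Cv; rewrite /v ltr_pdivrMr//; nra.
  + by apply: Cw; rewrite /w ltr_pdivrMr//; nra.
- have -> : f 0 = 0.
    rewrite /f /u /v /w !mul0r !subr0 divr1 mulr1 (rogersL_le0 (lexx _)).
    by rewrite add0r !subr0 subrr.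
  by move=> _ /eqP; rewrite mul0r subr0 /f /u /v /w => /eqP H; lra.
Qed.

End FixedY.
End FiveTerm.

(** * The dilogarithm identities *)

Section DilogSums.
Variables (R : realType) (m e : nat) (Z V : nat -> int -> R) (B : int).
Hypothesis S : Ysolution m e Z V B.
Hypothesis Z_gt0 : forall l u, (1 < l < e)%N -> 0 < Z l u.
Hypothesis V_gt0 : forall j u, (j < m)%N -> 0 < V j u.
Variable c : int.
Hypothesis Bc : B <= c.

Notation N := (polygon_size m e).
Notation L := (@rogersL R).
Notation k := (pi ^+ 2 / 6 : R).
Notation cross := (cross_ratio Z c).
Notation pcross := (polygon_cross e Z c).
Let e_gt2 := Ysol_e_gt2 S.
Let m_gt0 := Ysol_m_gt0 S.
Let F a b x y : R := L (pcross a b x y).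

Let F_mod a b x y : F (a %% N)%N (b %% N)%N (x %% N)%N (y %% N)%N = F a b x y.
Proof.
by rewrite /F /polygon_cross; congr L; apply: (cross_eqmod S Z_gt0 V_gt0 Bc); rewrite modnMmr.
Qed.

Let F_sym a b x y : F x y a b = F a b x y.
Proof. by rewrite /F /polygon_cross cross_sym. Qed.

Let F_rot a b x y : (a < b < x)%N -> (x < y < N)%N -> F b x y a = k - F a b x y.
Proof.
move=> abx xy; rewrite /F (pcross_rot S Z_gt0 V_gt0 Bc abx); last by lia.
have /andP[h0 h1] : 0 < pcross a b x y < 1.
  by apply: (pcross_01 S Z_gt0 V_gt0 Bc) => //; lia.
rewrite -(@rogersL_reflect R (pcross a b x y)); first by rewrite addrAC subrr add0r.
by rewrite !ltW.
Qed.

(* The five-term relation is the cocycle condition for the dilogarithm of cross-ratios. *)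
Let F_cocycle a b x y : (0 < a < b)%N -> (b < x < y)%N -> (y < N)%N ->
  F a b x y = F 0%N b x y - F 0%N a x y + F 0%N a b y - F 0%N a b x.
Proof.
move=> ab bx xy; rewrite /F.
have pp s t : (s < t < s + N)%N -> 0 < pdet e Z c s t by exact: (pdet_gt0 S Z_gt0 V_gt0 Bc).
have h1 : 0 < pcross 0 b x y < 1 by apply: (pcross_01 S Z_gt0 V_gt0 Bc); lia.
have h2 : 0 < pcross 0 a b y < 1 by apply: (pcross_01 S Z_gt0 V_gt0 Bc); lia.
(* The arguments are the cross-ratios of [0, b, x, y] and [0, a, b, y]; their product is that of
   [0, a, x, y], and the other two terms are those of [a, b, x, y] and [0, a, b, x]. *)
have := rogersL_five_term h2 h1.
have c1 := @pcross_compl R m e Z V B S Z_gt0 V_gt0 c Bc 0 b x y ltac:(lia) ltac:(lia).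
have c2 := @pcross_compl R m e Z V B S Z_gt0 V_gt0 c Bc 0 a b y ltac:(lia) ltac:(lia).
have c3 := @pcross_compl R m e Z V B S Z_gt0 V_gt0 c Bc 0 a x y ltac:(lia) ltac:(lia).
have n1 : pdet e Z c 0 b != 0 by rewrite gt_eqF// pp//; lia.
have n2 : pdet e Z c 0 x != 0 by rewrite gt_eqF// pp//; lia.
have n3 : pdet e Z c b y != 0 by rewrite gt_eqF// pp//; lia.
have n4 : pdet e Z c a y != 0 by rewrite gt_eqF// pp//; lia.
have n5 : pdet e Z c 0 y != 0 by rewrite gt_eqF// pp//; lia.
have n6 : pdet e Z c a x != 0 by rewrite gt_eqF// pp//; lia.
have E1 : pcross 0 b x y * pcross 0 a b y = pcross 0 a x y.
  by rewrite !pcrossE; field; rewrite n1 n2 n3 n4.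
rewrite E1 c1 c2 c3.
have -> : pcross 0 b x y * (pdet e Z c 0 y * pdet e Z c a b / (pdet e Z c 0 b * pdet e Z c a y)) /
    (pdet e Z c 0 y * pdet e Z c a x / (pdet e Z c 0 x * pdet e Z c a y)) = pcross a b x y.
  by rewrite !pcrossE; field; rewrite n1 n2 n3 n4 n5 n6.
have -> : pcross 0 a b y * (pdet e Z c 0 y * pdet e Z c b x / (pdet e Z c 0 x * pdet e Z c b y)) /
    (pdet e Z c 0 y * pdet e Z c a x / (pdet e Z c 0 x * pdet e Z c a y)) = pcross 0 a b x.
  by rewrite !pcrossE; field; rewrite n1 n2 n3 n4 n5 n6.
move: (L _) (L _) (L _) (L _) (L _) => l1 l2 l3 l4 l5; lra.
Qed.

Let N_gt0 : (0 < N)%N.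
Proof. by rewrite /polygon_size addn1. Qed.

Let coNe : coprime N e.
Proof. by rewrite /polygon_size /coprime gcdnC gcdnMDl gcdn1. Qed.

(* Vertices of the polygon are reached from times [t] by multiplication by [e] modulo [N]. *)
Let sum_time (f : nat -> R) b : (forall t, f (t %% N)%N = f t) ->
  \sum_(t < N) f t = \sum_(a < N) f (e * (a + b))%N.
Proof.
move=> fN; rewrite (@sum_shift _ N (fun a => f (e * a)%N)) => [|a].
  by rewrite sum_mod_coprime.
by rewrite -fN mulnDr addnC modnMDl fN.
Qed.

Lemma sum_V j : (j < m)%N ->
  \sum_(t < N) L (1 / (1 + V j (Vtime e c j t))) =
  \sum_(a < N) F a (a + 1) (a + (m - j) + 1) (a + (m - j) + 2).
Proof.
move=> jm; pose f t := L (cross t (t + e) (t + j * e + 1) (t + j * e + 1 + e)).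
transitivity (\sum_(t < N) f t).
  apply: eq_bigr => t _; congr L.
  have V0 : 1 + V j (Vtime e c j t) != 0 by rewrite gt_eqF// addr_gt0// V_gt0.
  have HV := polygon_V S Bc (ltnW jm) t.
  have D0 : polygon_D e Z c j t != 0 by rewrite gt_eqF// (polygon_D_gt0 S Z_gt0 Bc).
  have -> : cross t (t + e) (t + j * e + 1) (t + j * e + 1 + e) =
      polygon_D e Z c j t / (polygon_E e Z c j t * polygon_E e Z c j (t + e)).
    rewrite /cross_ratio /polygon_D /polygon_E; congr (_ / (_ * det2 _ _ _ _)); lia.
  by rewrite -HV; field; rewrite V0 D0.
(* The shift puts time [t + j e + 1] at position [a], after one turn. The four times then form two
   sides of the polygon. *)
rewrite (@sum_time f (m - j + 1)%N) => [|t].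
  apply: eq_bigr => a _; rewrite /f -F_sym /F; congr L.
  rewrite /polygon_cross; apply: (cross_eqmod S Z_gt0 V_gt0 Bc).
  - by congr ((_ * _) %% _)%N; lia.
  - by congr (_ %% _)%N; lia.
  - have -> : (e * (a + (m - j + 1)) + j * e + 1 = e * a + N)%N by rewrite /polygon_size; nia.
    by rewrite modnDr.
  - have -> : (e * (a + (m - j + 1)) + j * e + 1 + e = e * (a + 1) + N)%N by rewrite /polygon_size; nia.
    by rewrite modnDr.
rewrite /f; congr L; apply: (cross_eqmod S Z_gt0 V_gt0 Bc); rewrite -?addnA ?modnDml//.
by rewrite modn_mod.
Qed.

Lemma sum_Z l : (1 < l < e)%N ->
  \sum_(t < N) L (Z l (Ztime c l t) / (1 + Z l (Ztime c l t))) =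
  \sum_(a < N) F a (a + m.+1) (a + m.+1 * l) (a + m.+1 * l.+1).
Proof.
move=> le; pose f t := L (cross t (t + 1) (t + l) (t + l + 1)).
transitivity (\sum_(t < N) f t).
  apply: eq_bigr => t _; congr L.
  have z0 : Z l (Ztime c l t) != 0 by rewrite gt_eqF// Z_gt0.
  have z1 : 1 + Z l (Ztime c l t) != 0 by rewrite gt_eqF// addr_gt0// Z_gt0.
  have HZ := polygon_Z1 S Bc t (_ : (0 < l < e)%N).
  rewrite /cross_ratio !addn1 !polygon_d1 mul1r -HZ; last by lia.
  by field; rewrite z0 addrC z1.
(* A unit of time is [m+1] positions backwards, so the order of the vertices is reversed; the shift
   puts the latest time at position [a]. *)
rewrite (@sum_time f (m.+1 * l.+1)%N) => [|t].
  apply: eq_bigr => a _; rewrite /f /F; congr L.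
  rewrite /polygon_cross -[RHS]cross_rev; apply: (cross_eqmod S Z_gt0 V_gt0 Bc).
  - by [].
  - have -> : (e * (a + m.+1 * l.+1) + 1 = e * (a + m.+1 * l) + N)%N by rewrite /polygon_size; nia.
    by rewrite modnDr.
  - have : (e * (a + m.+1 * l.+1) + l = e * (a + m.+1) + l * N)%N by rewrite /polygon_size; nia.
    by move=> ->; rewrite addnC modnMDl.
  - have : (e * (a + m.+1 * l.+1) + l + 1 = e * a + l.+1 * N)%N by rewrite /polygon_size; nia.
    by move=> ->; rewrite addnC modnMDl.
rewrite /f; congr L; apply: (cross_eqmod S Z_gt0 V_gt0 Bc); rewrite -?addnA ?modnDml//.
by rewrite modn_mod.
Qed.

Lemma sum_ZV :
  \sum_(2 <= l < e) \sum_(t < N) L (Z l (Ztime c l t) / (1 + Z l (Ztime c l t)))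
  - \sum_(0 <= j < m) \sum_(t < N) L (1 / (1 + V j (Vtime e c j t))) =
  k * 2 * (m.+1%:R * (e - 2)%:R - m%:R).
Proof.
rewrite -(sum_quads m_gt0 e_gt2 F_mod F_sym F_rot F_cocycle); congr (_ - _).
  by rewrite !big_nat; apply: eq_bigr => l le; exact: sum_Z.
rewrite big_nat_rev big_add1/= !big_nat; apply: eq_bigr => j jm.
rewrite sum_V; last by lia.
have -> : (m - (0 + m - j.+1) = j.+1)%N by lia.
by [].
Qed.
End DilogSums.

Lemma sum_even_odd (V : nmodType) (g : nat -> V) M :
  \sum_(a < 2 * M) g a = \sum_(t < M) (g (2 * t)%N + g (2 * t + 1)%N).
Proof.
elim: M => [|M IH]; first by rewrite !big_ord0.
rewrite mulnS add2n !big_ord_recr/= IH -addrA.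
by rewrite addn1.
Qed.

(** The even and odd times of a period belong to the polygons with offsets 0 and 1. The shift [s]
    aligns the summation with the time attached to vertex 0. *)
Lemma sum_period (R : realType) (f : int -> R) M s :
  (forall u, f (u + (2 * M)%N%:Z) = f u) ->
  \sum_(0 <= u < 2 * M) f u%:Z =
  \sum_(t < M) f ((2 * t + s)%N%:Z + 0) + \sum_(t < M) f ((2 * t + s)%N%:Z + 1).
Proof.
move=> fM; rewrite big_mkord -(@sum_shift _ (2 * M) (fun a => f a%:Z) s); last first.
  by move=> a; rewrite -[RHS]fM; congr f; lia.
rewrite (sum_even_odd (fun a => f (a + s)%N%:Z)) -big_split; apply: eq_bigr => t _ /=.
by congr (f _ + f _); lia.
Qed.

Section LabelSums.
Variables (m n : nat) (V : nmodType) (H : nat -> V).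
Hypotheses (hm : (1 <= m)%N) (hn : (4 <= n)%N).

Lemma sum_lab : \sum_(i : idx m n) H (lab i) =
  \sum_(0 <= j < m) H (m - j)%N + \sum_(2 <= l < n.-1) H (m + n.-1 - l)%N.
Proof.
rewrite -(big_mkord xpredT (fun x : nat => H x.+1)) (big_cat_nat _ (n := m)) ?leq0n//=; last by lia.
congr (_ + _); rewrite big_nat_rev/=.
  by rewrite !big_nat; apply: eq_bigr => j jm; congr H; lia.
rewrite -[X in \sum_(X <= _ < _) _]add0n big_addn.
rewrite -[X in _ = \sum_(X <= _ < _) _]add0n big_addn.
have -> : (m + n - 3 - m = n.-1 - 2)%N by lia.
by rewrite !big_nat; apply: eq_bigr => l l2; congr H; lia.
Qed.
End LabelSums.

Section DilogIdentities.
Variables (R : realType) (m n : nat).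
Hypotheses (hm : (1 <= m)%N) (hn : (4 <= n)%N).
Variable Y : idx m n -> int -> R.
Hypothesis Y_gt0 : forall i u, 0 < Y i u.
Hypothesis Y_sys : Ysys_holds Y.
Notation L := (@rogersL R).
Notation k := (pi ^+ 2 / 6 : R).
Notation P := (period m n).
Notation y := (ylab Y).
Notation Z := (fun l : nat => y (m + n.-1 - l)).
Notation V := (fun j : nat => y (m - j)).

Let Yrel i u : Y i (u - half_step i) * Y i (u + half_step i) =
  sfeval 1 +%R *%R (@GRing.inv R) (fun g => Y g.1 g.2) (Yrhs i u).
Proof. exact: Y_sys (Ysys_Yrhs hm hn i u). Qed.

Let S B : Ysolution m n.-1 Z V B.
Proof.
apply: Ysolution_ylab => // [i u|i u]; first by rewrite gt_eqF.
by rewrite gt_eqF// addr_gt0.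
Qed.

Let y_gt0 x u : (0 < x <= m + n - 3)%N -> 0 < y x u.
Proof. by move=> /lab_surj[i <-]; rewrite ylabE. Qed.

Let Z_gt0 l u : (1 < l < n.-1)%N -> 0 < Z l u.
Proof. by move=> le; apply: y_gt0; lia. Qed.

Let V_gt0 j u : (j < m)%N -> 0 < V j u.
Proof. by move=> le; apply: y_gt0; lia. Qed.

Let PE : P = (2 * polygon_size m n.-1)%N.
Proof. by rewrite /period /polygon_size; nia. Qed.

Let Yper i u : Y i (u + P%:Z) = Y i u.
Proof.
apply: (@Y_periodic m n hm hn R Y (u - (m * n - m + n)%N%:Z)).
- by move=> j v; rewrite gt_eqF.
- by move=> j v; rewrite gt_eqF// addr_gt0.
- by move=> j v _; exact: Yrel.
- by rewrite subrK.
Qed.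

Let yper x u : y x (u + (2 * polygon_size m n.-1)%N%:Z) = y x u.
Proof. by rewrite -PE /ylab; apply: eq_bigr => i _; exact: Yper. Qed.

Let reflect (x : R) : 0 < x -> L (x / (1 + x)) = k - L (1 / (1 + x)).
Proof.
move=> x0; have x1 : 0 < 1 + x by rewrite addr_gt0.
have -> : x / (1 + x) = 1 - 1 / (1 + x) by field; rewrite gt_eqF.
rewrite -(@rogersL_reflect R (1 / (1 + x))); first by rewrite addrAC subrr add0r.
by rewrite divr_ge0 ?ler01 ?(ltW x1)//= ler_pdivrMr// mul1r lerDl (ltW x0).
Qed.

Let Zsum l : (1 < l < n.-1)%N ->
  \sum_(0 <= u < P) L (Z l u%:Z / (1 + Z l u%:Z)) =
  \sum_(t < polygon_size m n.-1) L (Z l (Ztime 0 l t) / (1 + Z l (Ztime 0 l t))) +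
  \sum_(t < polygon_size m n.-1) L (Z l (Ztime 1 l t) / (1 + Z l (Ztime 1 l t))).
Proof.
move=> le; rewrite PE.
rewrite (@sum_period R (fun u => L (Z l u / (1 + Z l u))) _ (l + 1)); last first.
  by move=> u; rewrite yper.
by congr (_ + _); apply: eq_bigr => t _; rewrite /Ztime addnA.
Qed.

Let Vsum j : (j < m)%N ->
  \sum_(0 <= u < P) L (V j u%:Z / (1 + V j u%:Z)) =
  P%:R * k -
  (\sum_(t < polygon_size m n.-1) L (1 / (1 + V j (Vtime n.-1 0 j t))) +
   \sum_(t < polygon_size m n.-1) L (1 / (1 + V j (Vtime n.-1 1 j t)))).
Proof.
move=> jm.
under eq_bigr do rewrite reflect ?V_gt0//.
rewrite sumrB sumr_const_nat subn0 -[X in X - _]mulr_natl; congr (_ - _).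
rewrite PE (@sum_period R (fun u => L (1 / (1 + y (m - j) u))) _ (1 + j.+1 * n.-1)); last first.
  by move=> u; rewrite yper.
by congr (_ + _); apply: eq_bigr => t _; rewrite /Vtime addnA.
Qed.

(** For labels up to [m], reflection replaces each term by [k] minus the dilogarithm that [sum_ZV]
    controls, whence [m P]. The other part is the value of [sum_ZV], once for each of the two
    polygons. *)
Lemma sum_rogersL_Y :
  \sum_(i : idx m n) \sum_(0 <= u < P) L (Y i u%:Z / (1 + Y i u%:Z)) =
  k * (m%:R * P%:R + 4 * (m.+1%:R * (n - 3)%:R - m%:R)).
Proof.
transitivity (\sum_(i : idx m n) \sum_(0 <= u < P) L (y (lab i) u%:Z / (1 + y (lab i) u%:Z))).
  by apply: eq_bigr => i _; apply: eq_bigr => u _; rewrite ylabE.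
rewrite (@sum_lab m n _ (fun x => \sum_(0 <= u < P) L (y x u%:Z / (1 + y x u%:Z))))//.
have H0 := @sum_ZV R m n.-1 Z V 0 (S 0) Z_gt0 V_gt0 0 (lexx _).
have H1 := @sum_ZV R m n.-1 Z V 1 (S 1) Z_gt0 V_gt0 1 (lexx _).
have -> : \sum_(0 <= j < m) \sum_(0 <= u < P) L (y (m - j)%N u%:Z / (1 + y (m - j)%N u%:Z)) =
  m%:R * (P%:R * k) -
  (\sum_(0 <= j < m) \sum_(t < polygon_size m n.-1) L (1 / (1 + V j (Vtime n.-1 0 j t))) +
   \sum_(0 <= j < m) \sum_(t < polygon_size m n.-1) L (1 / (1 + V j (Vtime n.-1 1 j t)))).
  rewrite -big_split/= big_nat.
  under eq_bigr => j jm do rewrite Vsum//.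
  by rewrite -big_nat sumrB sumr_const_nat subn0 -[X in X - _]mulr_natl.
have -> : \sum_(2 <= l < n.-1) \sum_(0 <= u < P)
    L (y (m + n.-1 - l)%N u%:Z / (1 + y (m + n.-1 - l)%N u%:Z)) =
  \sum_(2 <= l < n.-1) \sum_(t < polygon_size m n.-1) L (Z l (Ztime 0 l t) / (1 + Z l (Ztime 0 l t))) +
  \sum_(2 <= l < n.-1) \sum_(t < polygon_size m n.-1) L (Z l (Ztime 1 l t) / (1 + Z l (Ztime 1 l t))).
  rewrite -big_split/= !big_nat; apply: eq_bigr => l le; exact: Zsum.
have -> : (n - 3 = n.-1 - 2)%N by lia.
have combine (x a0 b0 a1 b1 w : R) : a0 - b0 = w -> a1 - b1 = w ->
    x - (b0 + b1) + (a0 + a1) = x + w + w by move=> /(canRL (subrK _)) -> /(canRL (subrK _)) ->; ring.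
apply: etrans (combine _ _ _ _ _ _ H0 H1) _.
by move: (pi ^+ 2 / 6 : R) => q; ring.
Qed.

Lemma sum_rogersL_onemY :
  \sum_(i : idx m n) \sum_(0 <= u < P) L (1 / (1 + Y i u%:Z)) =
  k * (m + n - 3)%:R * P%:R -
  \sum_(i : idx m n) \sum_(0 <= u < P) L (Y i u%:Z / (1 + Y i u%:Z)).
Proof.
apply/eqP; rewrite eq_sym subr_eq addrC eq_sym -big_split/=; apply/eqP.
transitivity (\sum_(i : idx m n) (k * P%:R)).
  apply: eq_bigr => i _; rewrite -big_split/=.
  under eq_bigr do rewrite reflect// subrK.
  by rewrite sumr_const_nat subn0 -[LHS]mulr_natr.
by rewrite sumr_const card_ord -[LHS]mulr_natr mulrAC.
Qed.

Let pi_neq0 : (pi : R) != 0.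
Proof. by rewrite gt_eqF// pi_gt0. Qed.

Lemma natr_period : P%:R = 2 * (m%:R * n%:R - m%:R + n%:R) :> R.
Proof.
rewrite /period natrM natrD natrB ?natrM//.
by rewrite leq_pmulr//; lia.
Qed.

Lemma dilog_identities :
  6 / pi ^+ 2 * (\sum_(i : idx m n) \sum_(0 <= u < P) L (Y i u%:Z / (1 + Y i u%:Z)))
    = 2 * (n%:R * m%:R ^+ 2 - m%:R ^+ 2 + 3 * m%:R * n%:R
           - 8 * m%:R + 2 * n%:R - 6) /\
  6 / pi ^+ 2 * (\sum_(i : idx m n) \sum_(0 <= u < P) L (1 / (1 + Y i u%:Z)))
    = 2 * (n%:R ^+ 2 * m%:R - 6 * n%:R * m%:R + 11 * m%:R
           + n%:R ^+ 2 - 5 * n%:R + 6).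
Proof.
rewrite sum_rogersL_onemY sum_rogersL_Y natr_period !natrB; try lia.
rewrite natrD -[m.+1%:R]natr1; move: (pi : R) pi_neq0 => q q0.
by split; field.
Qed.
End DilogIdentities.

Theorem theorem7p9 (m n : nat) (hm : (1 <= m)%N) (hn : (4 <= n)%N) :
  (forall (i : idx m n) (u : int), Yc i (u + (period m n)%:Z) = Yc i u) /\
  (forall (i : idx m n) (u : int), Tc i (u + (period m n)%:Z) = Tc i u) /\
  (forall (R : realType) (Y : idx m n -> int -> R),
    (forall i u, 0 < Y i u) -> Ysys_holds Y ->
    6 / pi ^+ 2 * (\sum_(i : idx m n) \sum_(0 <= u < period m n)
                     rogersL (Y i u%:Z / (1 + Y i u%:Z)))
      = 2 * (n%:R * m%:R ^+ 2 - m%:R ^+ 2 + 3 * m%:R * n%:R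
             - 8 * m%:R + 2 * n%:R - 6) /\
    6 / pi ^+ 2 * (\sum_(i : idx m n) \sum_(0 <= u < period m n)
                     rogersL (1 / (1 + Y i u%:Z)))
      = 2 * (n%:R ^+ 2 * m%:R - 6 * n%:R * m%:R + 11 * m%:R
             + n%:R ^+ 2 - 5 * n%:R + 6)).
Proof.
split; first by move=> i u; exact: Yc_periodic.
split; first by move=> i u; exact: Tc_periodic.
by move=> R Y Y0 YS; exact: dilog_identities.
Qed.
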